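(* Let $k\in\mathbb N$, $a=\pi/k$, $\alpha,\beta\in\{0,1\}$, and let $q,\tilde q\in L_2(0,\pi)$ be complex-valued. Let $\{\lambda_n\}_{n\ge1}$ and $\{\tilde\lambda_n\}_{n\ge1}$ be the spectra of the problems $L(q,a,\alpha,\beta)$ and $L(\tilde q,a,\alpha,\beta)$, respectively. (1) In the non-degenerate case: if $\{\lambda_n\}_{n\ge1}=\{\tilde\lambda_n\}_{n\ge1}$, then $q(x)=\tilde q(x)$ a.e. on $(0,\pi)$. (2) In the degenerate case: let $k>1$ and suppose there exists an operator $K:L_2(0,a)\to L_2(0,a)$ such that $I+K$ is invertible ($I$ the identity) and $$q(a-t)=K(q(a+t)),\qquad \tilde q(a-t)=K(\tilde q(a+t)),\qquad 0<t<a$$ (i.e. the function $t\mapsto q(a-t)$ on $(0,a)$ is the image under $K$ of $t\mapsto q(a+t)$, and likewise for $\tilde q$). Then $\{\lambda_n\}_{n\ge1}=\{\tilde\lambda_n\}_{n\ge1}$ implies $q(x)=\tilde q(x)$ a.e. on $(0,\pi)$.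
   Context: For $k\in\mathbb N$, $a=\pi/k$, $\alpha,\beta\in\{0,1\}$ and complex-valued $q\in L_2(0,\pi)$, $L(q,a,\alpha,\beta)$ denotes the boundary value problem $$-y''(x)+q(x)y(a)=\lambda y(x),\quad 0<x<\pi,\qquad y^{(\alpha)}(0)=y^{(\beta)}(\pi)=0,$$ with spectral parameter $\lambda=\rho^2$. Let $C(x,\lambda),S(x,\lambda)$ be the solutions of this equation with $C(a,\lambda)=S'(a,\lambda)=1$, $S(a,\lambda)=C'(a,\lambda)=0$; explicitly $C(x,\lambda)=\cos\rho(x-a)+\int_a^x\frac{\sin\rho(x-t)}{\rho}q(t)\,dt$, $S(x,\lambda)=\frac{\sin\rho(x-a)}{\rho}$. The characteristic function is $\Delta_{\alpha,\beta}(\lambda)=C^{(\alpha)}(0,\lambda)S^{(\beta)}(\pi,\lambda)-S^{(\alpha)}(0,\lambda)C^{(\beta)}(\pi,\lambda)$; the eigenvalues are its zeros, and the spectrum is the sequence of its zeros counted with multiplicities. The degenerate case means that one of the following holds: (i) $\alpha=\beta=0$; (ii) $\alpha=1,\beta=0$ and $k$ odd; (iii) $\alpha=\beta=1$ and $k$ even. The non-degenerate case means that one of the following holds: (iv) $\alpha=0,\beta=1$; (v) $\alpha=1,\beta=0$ and $k$ even; (vi) $\alpha=\beta=1$ and $k$ odd. *)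

(* Defs.v *)
From HB Require Import structures.
From mathcomp Require Import all_boot all_order all_algebra.
From mathcomp Require Import all_classical all_reals all_analysis.
From mathcomp Require Import complex.
Import Order.TTheory GRing.Theory Num.Theory.
Import numFieldNormedType.Exports.

Set Implicit Arguments.
Unset Strict Implicit.
Unset Printing Implicit Defensive.

Local Open Scope classical_set_scope.
Local Open Scope ring_scope.
Local Open Scope complex_scope.

Section Defs.
Variable R : realType.

Local Notation C := R[i].
Local Notation mu := (@lebesgue_measure R).

Definition cexp (z : C) : C :=
  (expR (complex.Re z))%:C * (cos (complex.Im z) +i* sin (complex.Im z)).
Definition ccos (z : C) : C := (cexp ('i * z) + cexp (- ('i * z))) / 2%:R.
Definition csin (z : C) : C := (cexp ('i * z) - cexp (- ('i * z))) / (2%:R * 'i).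

(* with rho^2 = lambda (both functions are even in rho, so the choice of
   square root is irrelevant):
   cosl lambda s = cos (rho s),
   sinl lambda s = sin (rho s) / rho   (= s when lambda = 0, entire extension) *)
Definition cosl (lam : C) (s : R) : C := ccos (sqrtC lam * s%:C).
Definition sinl (lam : C) (s : R) : C :=
  if lam == 0 then s%:C else csin (sqrtC lam * s%:C) / sqrtC lam.

Definition cintegral (D : set R) (f : R -> C) : C :=
  (\int[mu]_(t in D) complex.Re (f t)) +i* (\int[mu]_(t in D) complex.Im (f t)).

Definition oint (u v : R) (f : R -> C) : C :=
  if u <= v then cintegral `[u, v] f else - cintegral `[v, u] f.

Definition L2c (D : set R) (f : R -> C) : Prop :=
  [/\ measurable_fun D (fun x => complex.Re (f x)),
      measurable_fun D (fun x => complex.Im (f x)) &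
      mu.-integrable D (fun x => ((complex.Re (f x)) ^+ 2 + (complex.Im (f x)) ^+ 2)%:E)].

Definition ae_eqc (D : set R) (f g : R -> C) : Prop :=
  {ae mu, forall x, D x -> f x = g x}.

Definition Cf (q : R -> C) (a x : R) (lam : C) : C :=
  cosl lam (x - a) + oint a x (fun t => sinl lam (x - t) * q t).
Definition Cd (q : R -> C) (a x : R) (lam : C) : C :=
  - lam * sinl lam (x - a) + oint a x (fun t => cosl lam (x - t) * q t).
Definition Sf (a x : R) (lam : C) : C := sinl lam (x - a).
Definition Sd (a x : R) (lam : C) : C := cosl lam (x - a).

(* j-th derivative in x (j = 0 or 1) *)
Definition Cder (j : bool) q a x lam := if j then Cd q a x lam else Cf q a x lam.
Definition Sder (j : bool) a x lam := if j then Sd a x lam else Sf a x lam.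

Definition Delta (q : R -> C) (a : R) (alpha beta : bool) (lam : C) : C :=
  Cder alpha q a 0 lam * Sder beta a pi lam
  - Sder alpha a 0 lam * Cder beta q a pi lam.

Definition zero_order (f : C -> C) (mu0 : C) (m : nat) : Prop :=
  exists g : C -> C,
    [/\ forall lam, f lam = (lam - mu0) ^+ m * g lam,
        g mu0 != 0 &
        forall e : R, 0 < e -> exists2 d : R, 0 < d &
          forall lam, `|lam - mu0| < d%:C -> `|g lam - g mu0| < e%:C].

Definition same_spectrum (f g : C -> C) : Prop :=
  forall (mu0 : C) (m : nat), zero_order f mu0 m <-> zero_order g mu0 m.

End Defs.

Definition degenerate_case (k : nat) (alpha beta : bool) : bool :=
  [|| (~~ alpha && ~~ beta), (alpha && ~~ beta && odd k) | (alpha && beta && ~~ odd k)].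
Definition nondegenerate_case (k : nat) (alpha beta : bool) : bool :=
  [|| (~~ alpha && beta), (alpha && ~~ beta && ~~ odd k) | (alpha && beta && odd k)].

(* Main.v *)
(* The characteristic function has the form
     Delta(lam) = M(lam) + \int_0^pi kappa(lam, t) q(t) dt,
   where [M] does not depend on [q] and product-to-sum formulas express [kappa]
   through cosines or sines of [rho (pi - a - t)] and [rho (pi - |a - t|)].

   Equal spectra give equal characteristic functions, without Hadamard
   factorization: (Delta - Delta~) / Delta~ has no poles, and on the boundaries of
   the squares |Re rho|, |Im rho| <= A, for suitable A -> oo, it is O(1 / A), as
   there |kappa| = O(|M| / A). The maximum principle makes it vanish identically.

   Expanding in powers of [lam] then yields, for r = q - q~ and every p of one
   parity, \int ((pi - a - t)^p +- (pi - |a - t|)^p) r(t) dt = 0. As a function with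
   vanishing moments is zero, r (extended by zero) satisfies for almost every y
   in (0, pi)
     r(y - a) +- (r(a - y) + r(a + y)) +- r(2 pi - a - y) = 0.
   At the points j a + t and j a - t, with 0 < t < a fixed, this is a linear system
   for the values r(j a +- t). In the non-degenerate case it has only the zero
   solution. In general it gives r(a - t) = - r(a + t); with q(a - t) = K q(a + t) and
   injectivity of I + K this makes r vanish on (0, 2a), and the system propagates
   this to (0, pi). *)

Require Import Defs.
From HB Require Import structures.
From mathcomp Require Import all_boot all_order all_algebra.
From mathcomp Require Import all_classical all_reals all_analysis.
From mathcomp Require Import measurable_realfun.
From mathcomp Require Import complex ring lra.
Import Order.TTheory GRing.Theory Num.Theory.
Import numFieldNormedType.Exports.
Set Implicit Arguments.
Unset Strict Implicit.
Unset Printing Implicit Defensive.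
Local Open Scope classical_set_scope.
Local Open Scope ring_scope.
Local Open Scope complex_scope.

(** The complex analysis is reduced to power series. An entire function is given by coefficients
    decaying faster than every geometric sequence, and convergence is recorded with the rate
    [M / 2 ^ N], so that division by [z - z0], the finite order of a zero and termwise integration
    become explicit estimates; neither contour integrals nor complex derivatives occur. [zero_order]
    only provides a cofactor continuous at the zero; the growth bound that follows from it is enough
    for dividing. The squares in the [rho]-plane are level sets of a continuous function of [lam].
    Their half-sides are integers or half-integers, placed so that the cosine or sine in [M] is
    large on the vertical sides too. As moments of one parity only are available, a push-forward of
    [r] is made even or odd before the moment theorem is applied. [K] is not assumed linear, so it
    cannot be applied to [r]: the relation [r(a - t) = - r(a + t)] is read as the equality of the
    images under [I + K] of the translates of [q] and [qt]. *)

Local Notation normc := Normc.normc.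

(** * Real-valued modulus on [R[i]] *)

Section ComplexNorm.
Variable R : realType.
Implicit Types z w : R[i].

Lemma normcE z : normc z = Num.sqrt (complex.Re z ^+ 2 + complex.Im z ^+ 2).
Proof. by case: z. Qed.

Lemma normr_normc z : `|z| = (normc z)%:C.
Proof. by rewrite normc_def normcE. Qed.

Lemma normc_ge0 z : 0 <= normc z.
Proof. by rewrite normcE sqrtr_ge0. Qed.

Lemma normcX z n : normc (z ^+ n) = normc z ^+ n.
Proof. by elim: n => [|n IH]; rewrite ?expr0 ?Normc.normc1// !exprS Normc.normcM IH. Qed.

Lemma ler_normcD z w : normc (z + w) <= normc z + normc w.
Proof. exact: le_normcD. Qed.

Lemma normcB z w : normc (z - w) <= normc z + normc w.
Proof. by rewrite -(normcN w); exact: ler_normcD. Qed.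

Lemma normc_subC z w : normc (z - w) = normc (w - z).
Proof. by rewrite -normcN opprB. Qed.

Lemma normc_real (x : R) : normc x%:C = `|x|.
Proof. by rewrite normcE /= expr0n addr0 sqrtr_sqr. Qed.

Lemma normc_eq0 z : (normc z == 0) = (z == 0).
Proof.
by apply/eqP/eqP => [/Normc.eq0_normc//|->]; rewrite Normc.normc0.
Qed.

Lemma normc_gt0 z : (0 < normc z) = (z != 0).
Proof. by rewrite lt0r normc_eq0 normc_ge0 andbT. Qed.

Lemma ler_Re_normc z : `|complex.Re z| <= normc z.
Proof. by rewrite normcE -sqrtr_sqr ler_wsqrtr// lerDl sqr_ge0. Qed.

Lemma ler_Im_normc z : `|complex.Im z| <= normc z.
Proof. by rewrite normcE -sqrtr_sqr ler_wsqrtr// lerDr sqr_ge0. Qed.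

Lemma ler_normc_ReIm z : normc z <= `|complex.Re z| + `|complex.Im z|.
Proof.
rewrite normcE -[leRHS]ger0_norm ?addr_ge0// -sqrtr_sqr ler_wsqrtr//.
rewrite sqrrD !real_normK ?num_real// -addrA lerD2l lerDr.
by rewrite mulrn_wge0// mulr_ge0.
Qed.

Lemma normc_sum (I : Type) (s : seq I) (P : pred I) (F : I -> R[i]) :
  normc (\sum_(i <- s | P i) F i) <= \sum_(i <- s | P i) normc (F i).
Proof.
elim/big_ind2: _ => // [|x1 x2 y1 y2 h1 h2]; first by rewrite Normc.normc0.
by apply: (le_trans (ler_normcD _ _)); exact: lerD.
Qed.

Lemma ler_normcB_dist z w : normc z - normc w <= normc (z - w).
Proof. by rewrite lerBlDr -{1}(subrK w z); exact: ler_normcD. Qed.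

Lemma normc2 : normc (2 : R[i]) = 2.
Proof. by rewrite -(rmorph_nat (real_complex R)) normc_real normr_nat. Qed.

Lemma Re_realM (x : R) z : complex.Re (x%:C * z) = x * complex.Re z.
Proof. by case: z => a b /=; rewrite mul0r subr0. Qed.

Lemma Im_realM (x : R) z : complex.Im (x%:C * z) = x * complex.Im z.
Proof. by case: z => a b /=; rewrite mul0r addr0. Qed.

Lemma creD z w : complex.Re (z + w) = complex.Re z + complex.Re w.
Proof. by case: z w => ? ? []. Qed.

Lemma cimD z w : complex.Im (z + w) = complex.Im z + complex.Im w.
Proof. by case: z w => ? ? []. Qed.

Lemma creN z : complex.Re (- z) = - complex.Re z.
Proof. by case: z. Qed.

Lemma cimN z : complex.Im (- z) = - complex.Im z.
Proof. by case: z. Qed.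

Lemma creM z w : complex.Re (z * w) = complex.Re z * complex.Re w - complex.Im z * complex.Im w.
Proof. by case: z w => ? ? []. Qed.

Lemma cimM z w : complex.Im (z * w) = complex.Re z * complex.Im w + complex.Im z * complex.Re w.
Proof. by case: z w => ? ? []. Qed.

Lemma complex_eq z w :
  complex.Re z = complex.Re w -> complex.Im z = complex.Im w -> z = w.
Proof. by case: z w => ? ? [? ?] /= -> ->. Qed.

End ComplexNorm.

(** * Series converging at a geometric rate *)

Section GeometricSeries.
Variable R : realType.
Implicit Types (a b : nat -> R[i]) (l m : R[i]).

(* Summation with a geometric rate: this is how the Taylor series of an entire
   function converges at every point, its coefficients decaying faster than any
   geometric sequence. *)
Definition gsum a l :=
  exists M : R, forall N, normc (l - \sum_(i < N) a i) <= M / 2 ^+ N.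

(** Archimedean squeeze, from [n < 2 ^ n]. Vanishing and uniqueness claims below are reduced to
    it. *)
Lemma le0_pow2 (x M : R) : (forall N, x <= M / 2 ^+ N) -> x <= 0.
Proof.
move=> h; rewrite leNgt; apply/negP => x0.
have M0 : 0 < M by have := h 0%N; rewrite expr0 divr1; exact: lt_le_trans.
have [n hn] : exists n, M / x < n%:R.
  by exists (Num.bound (M / x)); apply: archi_boundP; rewrite divr_ge0// ltW.
have := h n; rewrite leNgt => /negP; apply.
rewrite ltr_pdivrMr ?exprn_gt0// mulrC -ltr_pdivrMr//.
apply: (lt_le_trans hn); rewrite -natrX ler_nat ltnW//.
exact: ltn_expl.
Qed.

Lemma eq_gsum a b l : a =1 b -> gsum a l -> gsum b l.
Proof.
move=> ab [M h]; exists M => N; under eq_bigr do rewrite -ab; exact: h.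
Qed.

Lemma gsum_unique a l m : gsum a l -> gsum a m -> l = m.
Proof.
move=> [M hM] [M' hM']; apply/eqP; rewrite -subr_eq0 -normc_eq0; apply/eqP.
apply/le_anti; rewrite normc_ge0 andbT.
apply: (@le0_pow2 _ (M + M')) => N.
rewrite mulrDl (_ : l - m = (l - \sum_(i < N) a i) - (m - \sum_(i < N) a i)).
  by apply: (le_trans (normcB _ _)); exact: lerD (hM N) (hM' N).
by rewrite opprB addrA subrK.
Qed.

Lemma gsum0 : gsum (fun=> 0) 0.
Proof. by exists 0 => N; rewrite big1// subr0 Normc.normc0 mul0r. Qed.

Lemma gsumD a b l m : gsum a l -> gsum b m -> gsum (fun n => a n + b n) (l + m).
Proof.
move=> [M hM] [M' hM']; exists (M + M') => N.
rewrite big_split/= opprD addrACA mulrDl.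
by apply: (le_trans (ler_normcD _ _)); exact: lerD (hM N) (hM' N).
Qed.

Lemma gsumZ k a l : gsum a l -> gsum (fun n => k * a n) (k * l).
Proof.
move=> [M hM]; exists (normc k * M) => N.
by rewrite -mulr_sumr -mulrBr Normc.normcM -mulrA ler_wpM2l// normc_ge0.
Qed.

Lemma gsum_shift a l : gsum a l -> gsum (fun n => a n.+1) (l - a 0%N).
Proof.
move=> [M hM]; exists M => N; rewrite -addrA -opprD.
have := hM N.+1; rewrite big_ord_recl/= => /le_trans; apply.
have M0 : 0 <= M.
  by have := hM 0%N; rewrite expr0 divr1; apply: le_trans; exact: normc_ge0.
rewrite ler_wpM2l// lef_pV2 ?posrE ?exprn_gt0// exprS.
have : 0 < 2 ^+ N :> R by rewrite exprn_gt0.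
by lra.
Qed.

(** Telescoping: [M / 2 ^ n] is the difference of two consecutive values of [2 * M / 2 ^ n], so that
    partial sums stay below [2 * M - 2 * M / 2 ^ N]. *)
Let half_pow2_le (M : R) n : - (2 * M / 2 ^+ n) + M / 2 ^+ n <= - (2 * M / (2 * 2 ^+ n)).
Proof.
have : 2 ^+ n != 0 :> R by rewrite expf_neq0.
move: (2 ^+ n) => x x0; rewrite -mulf_div divff// mul1r; lra.
Qed.

Lemma gsum_real (u : nat -> R) (l M : R) :
  (forall n, `|u n| <= M / 2 ^+ n) ->
  series u @ \oo --> l ->
  forall N, `|l - \sum_(i < N) u i| <= 2 * M / 2 ^+ N.
Proof.
move=> hu hl N.
have M0 : 0 <= M.
  by have := hu 0%N; rewrite expr0 divr1; apply: le_trans; exact: normr_ge0.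
have tail k : `|\sum_(i < N + k) u i - \sum_(i < N) u i|
    <= 2 * M / 2 ^+ N - 2 * M / 2 ^+ (N + k).
  elim: k => [|k IH]; first by rewrite addn0 !subrr normr0.
  rewrite addnS big_ord_recr/= addrAC (le_trans (ler_normD _ _))//.
  apply: (le_trans (lerD IH (hu _))); by rewrite exprS -addrA lerD2l half_pow2_le.
have cv : (fun n => `|series u n - \sum_(i < N) u i|) @ \oo -->
    `|l - \sum_(i < N) u i|.
  by apply: cvg_norm; apply: cvgB => //; exact: cvg_cst.
rewrite -(cvg_lim _ cv)//; apply: limr_le; first by apply/cvg_ex; eexists; exact: cv.
near=> n; have Nn : (N <= n)%N by near: n; exact: nbhs_infty_ge.
rewrite /series/= big_mkord -(subnKC Nn); apply: (le_trans (tail _)).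
by rewrite gerBl divr_ge0 ?exprn_ge0// mulr_ge0.
Unshelve. all: by end_near. Qed.

Lemma Re_sum (I : Type) (s : seq I) (P : pred I) (F : I -> R[i]) :
  complex.Re (\sum_(i <- s | P i) F i) = \sum_(i <- s | P i) complex.Re (F i).
Proof. by apply: (big_morph _ (id1 := 0)) => // -[? ?] [? ?]. Qed.

Lemma Im_sum (I : Type) (s : seq I) (P : pred I) (F : I -> R[i]) :
  complex.Im (\sum_(i <- s | P i) F i) = \sum_(i <- s | P i) complex.Im (F i).
Proof. by apply: (big_morph _ (id1 := 0)) => // -[? ?] [? ?]. Qed.

Lemma gsum_ReIm a (l m M : R) : (forall n, normc (a n) <= M / 2 ^+ n) ->
  series (fun n => complex.Re (a n)) @ \oo --> l ->
  series (fun n => complex.Im (a n)) @ \oo --> m ->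
  gsum a (l +i* m).
Proof.
move=> ha hl hm; exists (2 * M + 2 * M) => N.
apply: (le_trans (ler_normc_ReIm _)); rewrite mulrDl lerD//.
  have -> : complex.Re (l +i* m - \sum_(i < N) a i)
     = l - \sum_(i < N) complex.Re (a i) by rewrite -Re_sum; case: (\sum_(i < N) _).
  by apply: (@gsum_real (fun i => complex.Re (a i))) => // n; exact: le_trans (ler_Re_normc _) (ha n).
have -> : complex.Im (l +i* m - \sum_(i < N) a i)
   = m - \sum_(i < N) complex.Im (a i) by rewrite -Im_sum; case: (\sum_(i < N) _).
by apply: (@gsum_real (fun i => complex.Im (a i))) => // n; exact: le_trans (ler_Im_normc _) (ha n).
Qed.

Lemma is_cvg_geometric_bound (u : nat -> R) (M : R) :
  (forall n, `|u n| <= M / 2 ^+ n) -> cvg (series u @ \oo).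
Proof.
move=> hu; apply: normed_cvg.
apply: (@series_le_cvg _ _ (geometric M 2^-1)).
- by move=> n; rewrite normr_ge0.
- by move=> n /=; rewrite /geometric/= exprVn; apply: le_trans (hu n).
- by move=> n /=; rewrite exprVn.
apply: is_cvg_geometric_series; rewrite ger0_norm ?invr_ge0// invf_lt1//.
by rewrite ltr1n.
Qed.

Lemma gsum_exists a (M : R) : (forall n, normc (a n) <= M / 2 ^+ n) ->
  exists l, gsum a l.
Proof.
move=> ha; have ha' := ha; eexists; apply: gsum_ReIm ha' _ _; apply: (@is_cvg_geometric_bound _ M) => n.
- exact: le_trans (ler_Re_normc _) (ha n).
- exact: le_trans (ler_Im_normc _) (ha n).
Qed.

Lemma gsum_bound a l (M : R) : (forall n, normc (a n) <= M / 2 ^+ n) ->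
  gsum a l -> normc l <= 2 * M.
Proof.
move=> ha [M' hl]; rewrite -subr_le0; apply: (@le0_pow2 _ M') => N.
have S : normc (\sum_(i < N) a i) <= 2 * M - 2 * M / 2 ^+ N.
  elim: N => [|N IH]; first by rewrite big_ord0 Normc.normc0 expr0 divr1 subrr.
  rewrite big_ord_recr/= (le_trans (ler_normcD _ _))// (le_trans (lerD IH (ha _)))//.
  by rewrite exprS -addrA lerD2l half_pow2_le.
rewrite lerBlDr; apply: le_trans (lerD (hl N) _); last first.
  apply: (le_trans S); rewrite gerBl divr_ge0 ?exprn_ge0// mulr_ge0//.
  by have := ha 0%N; rewrite expr0 divr1; apply: le_trans; exact: normc_ge0.
by rewrite -{1}(subrK (\sum_(i < N) a i) l); exact: ler_normcD.
Qed.

End GeometricSeries.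

(** * Entire functions given by their power series *)

Section EntireFunctions.
Variable R : realType.
Implicit Types (c d : nat -> R[i]) (f g : R[i] -> R[i]) (z w : R[i]) (r M : R).

(** Cauchy's estimate on the circle of radius [r], here a definition instead of a consequence of an
    integral formula. *)
Definition coef_bound c r M := forall n, normc (c n) * r ^+ n <= M.

Definition rapid c := forall r, 0 < r -> exists M, coef_bound c r M.

Definition power_series c f :=
  rapid c /\ forall z, gsum (fun n => c n * z ^+ n) (f z).

Definition entire f := exists c, power_series c f.

Lemma coef_bound_ge0 c r M : coef_bound c r M -> 0 <= M.
Proof. by move=> /(_ 0%N); rewrite mulr1; apply: le_trans; exact: normc_ge0. Qed.

Lemma coef_boundS c r r' M : 0 < r -> r <= r' -> coef_bound c r' M -> coef_bound c r M.
Proof.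
move=> r0 rr' h n; apply: le_trans (h n); rewrite ler_wpM2l ?normc_ge0//.
by rewrite lerXn2r ?nnegrE ?(ltW r0) ?(ltW (lt_le_trans r0 rr')).
Qed.

(** On the disc of radius [r / 2] the estimate for radius [r] leaves the ratio [1 / 2], which is the
    rate built into [gsum]. *)
Lemma coef_bound_term c r M z n : 0 < r -> normc z <= r / 2 ->
  coef_bound c r M -> normc (c n * z ^+ n) <= M / 2 ^+ n.
Proof.
move=> r0 zr /(_ n) h; rewrite Normc.normcM normcX.
apply: (@le_trans _ _ (normc (c n) * (r / 2) ^+ n)).
  by rewrite ler_wpM2l ?normc_ge0// lerXn2r ?nnegrE ?normc_ge0// divr_ge0// ltW.
by rewrite expr_div_n mulrA ler_wpM2r// invr_ge0 exprn_ge0.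
Qed.

Lemma power_series_bound c f r M z : power_series c f -> 0 < r ->
  coef_bound c r M -> normc z <= r / 2 -> normc (f z) <= 2 * M.
Proof.
move=> [_ hf] r0 hM zr; apply: gsum_bound (hf z) => n; exact: coef_bound_term hM.
Qed.

Lemma power_series_exists c : rapid c -> exists f, power_series c f.
Proof.
move=> hc; suff /choice[f hf] : forall z, exists l, gsum (fun n => c n * z ^+ n) l.
  by exists f.
move=> z; have r0 : 0 < 2 * normc z + 1.
  by rewrite ltr_wpDl// mulr_ge0// normc_ge0.
have [M hM] := hc _ r0; apply: (@gsum_exists _ _ M) => n.
by apply: coef_bound_term hM => //; lra.
Qed.

Lemma power_series_lin c d f g (k h : R[i]) :
  power_series c f -> power_series d g ->
  power_series (fun n => k * c n + h * d n) (fun z => k * f z + h * g z).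
Proof.
move=> [hc hf] [hd hg]; split=> [r r0|z].
  have [M hM] := hc r r0; have [M' hM'] := hd r r0.
  exists (normc k * M + normc h * M') => n.
  apply: (@le_trans _ _ ((normc k * normc (c n) + normc h * normc (d n)) * r ^+ n)).
    rewrite ler_wpM2r ?exprn_ge0 ?(ltW r0)// -!Normc.normcM.
    exact: ler_normcD.
  by rewrite mulrDl -!mulrA lerD// ler_wpM2l ?normc_ge0.
have := gsumD (gsumZ k (hf z)) (gsumZ h (hg z)); apply: eq_gsum => n.
by rewrite mulrDl -!mulrA.
Qed.

Lemma power_series_cst (k : R[i]) :
  power_series (fun n => if n is 0 then k else 0) (fun=> k).
Proof.
split=> [r r0|z].
  by exists (normc k) => -[|n]; rewrite ?mulr1// Normc.normc0 mul0r normc_ge0.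
exists (normc k) => -[|N]; first by rewrite big_ord0 subr0 expr0 divr1.
rewrite big_ord_recl/= mulr1 big1 ?addr0 ?subrr ?Normc.normc0.
  by rewrite divr_ge0 ?normc_ge0 ?exprn_ge0.
by move=> i _; rewrite mul0r.
Qed.

Lemma entire_lin f g (k h : R[i]) : entire f -> entire g ->
  entire (fun z => k * f z + h * g z).
Proof.
by move=> [c hc] [d hd]; eexists; exact: power_series_lin hc hd.
Qed.

Lemma entire_cst k : entire (fun=> k).
Proof. by eexists; exact: power_series_cst. Qed.

Lemma entireB f g : entire f -> entire g -> entire (fun z => f z - g z).
Proof.
move=> hf hg; have := entire_lin 1 (-1) hf hg.
by congr (entire _); apply/funext => z; rewrite mul1r mulN1r.
Qed.

(* Synthetic division: the quotient [f z / (z - z0)] has the coefficients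
   [d_i = \sum_(n > i) c_n z0^(n - 1 - i)]. *)
Lemma power_series_div c f z0 : power_series c f -> f z0 = 0 ->
  exists d g, [/\ power_series d g, forall z, f z = (z - z0) * g z &
    forall r M, 0 < r -> 2 * normc z0 <= r -> coef_bound c r M ->
      coef_bound d r (2 * M / r)].
Proof.
move=> [hc hf] f0.
have term r M i n : 0 < r -> 2 * normc z0 <= r -> coef_bound c r M ->
    normc (c (n + i.+1)%N * z0 ^+ n) <= M / r ^+ i.+1 / 2 ^+ n.
  move=> r0 zr hM.
  have := @coef_bound_term (fun n => c (n + i.+1)%N) r (M / r ^+ i.+1) z0 n r0.
  apply; first by lra.
  move=> m; rewrite ler_pdivlMr ?exprn_gt0// -mulrA -exprD; exact: hM.
have /choice[d hd] : forall i, exists l, gsum (fun n => c (n + i.+1)%N * z0 ^+ n) l.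
  move=> i; have r0 : 0 < 2 * normc z0 + 1.
    by rewrite ltr_wpDl// mulr_ge0// normc_ge0.
  have [M hM] := hc _ r0; apply: gsum_exists => n; apply: term hM => //.
  by rewrite lerDl.
(* The radius is kept and only a factor [2 / r] is lost, so that the estimate can be iterated in
   [entire_order]. *)
have bd r M : 0 < r -> 2 * normc z0 <= r -> coef_bound c r M ->
    coef_bound d r (2 * M / r).
  move=> r0 zr hM i.
  have := gsum_bound (fun n => term r M i n r0 zr hM) (hd i).
  rewrite -ler_pdivlMr ?exprn_gt0// => /le_trans; apply.
  by rewrite exprS invfM !mulrA.
have rd : rapid d.
  move=> r r0; have r1 : 0 < r + 2 * normc z0 by rewrite ltr_wpDr// mulr_ge0// normc_ge0.
  have [M hM] := hc _ r1; eexists; apply: coef_boundS (bd _ _ r1 _ hM) => //.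
    by rewrite lerDl mulr_ge0// normc_ge0.
  by rewrite lerDr ltW.
have [g hg] := power_series_exists rd; exists d, g; split => // z.
(* Horner's relations between [c] and [d]; the first one is where [f z0 = 0] enters. *)
have c0 : c 0%N + z0 * d 0%N = 0.
  have := gsum_shift (hf z0); rewrite f0 mulr1 sub0r => h.
  have h' := gsumZ z0 (hd 0%N).
  have -> : z0 * d 0%N = - c 0%N.
    apply: gsum_unique h' _; apply: eq_gsum h => n.
    by rewrite addn1 exprS mulrCA.
  by rewrite subrr.
have cS i : c i.+1 + z0 * d i.+1 = d i.
  have := gsum_shift (hd i); rewrite mulr1 add0n => h.
  have h' := gsumZ z0 (hd i.+1).
  have -> : z0 * d i.+1 = d i - c i.+1.
    apply: gsum_unique h' _; apply: eq_gsum h => n.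
    by rewrite addSnnS exprS mulrCA.
  by rewrite addrC subrK.
have [_ /(_ z) gz] := hg.
have := gsum_shift (gsumD (hf z) (gsumZ z0 gz)).
rewrite !mulr1 c0 subr0 => h.
have h' := gsumZ z gz.
have : f z + z0 * g z = z * g z.
  apply: gsum_unique h' => //; apply: eq_gsum h => n.
  by rewrite mulrA -mulrDl cS exprS mulrCA.
by move=> e; rewrite mulrBl -e addrK.
Qed.

Lemma entire_div f z0 : entire f -> f z0 = 0 ->
  exists2 g, entire g & forall z, f z = (z - z0) * g z.
Proof.
by move=> [c hc] f0; have [d [g [hd hg _]]] := power_series_div hc f0; exists g => //; exists d.
Qed.

Lemma entire_locally_bounded f z0 : entire f ->
  exists2 K, 0 < K & forall z, normc (z - z0) <= 1 -> normc (f z) <= K.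
Proof.
move=> [c hc]; have r0 : 0 < 2 * normc z0 + 2.
  by rewrite ltr_wpDl// mulr_ge0// normc_ge0.
have [M hM] := hc.1 _ r0; exists (2 * M + 1).
  by rewrite ltr_wpDl// mulr_ge0// (coef_bound_ge0 hM).
move=> z hz; apply: (@le_trans _ _ (2 * M)); last by rewrite lerDl.
apply: (power_series_bound hc r0 hM).
have := ler_normcD (z - z0) z0; rewrite subrK; lra.
Qed.

(** The difference quotient at [z0] is again entire, hence bounded on the unit disc around [z0]. *)
Lemma entire_lipschitz f z0 : entire f ->
  exists2 K, 0 < K & forall z, normc (z - z0) <= 1 ->
    normc (f z - f z0) <= K * normc (z - z0).
Proof.
move=> hf; have hf' := entireB hf (entire_cst (f z0)).
have [|g hg fg] := entire_div (z0 := z0) hf'; first by rewrite subrr.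
have [K K0 hK] := entire_locally_bounded z0 hg; exists K => // z hz.
by rewrite fg Normc.normcM mulrC ler_wpM2r ?normc_ge0// hK.
Qed.

Lemma entire_eq0_at f z0 : entire f -> (forall z, z != z0 -> f z = 0) -> f z0 = 0.
Proof.
move=> hf h; have [K K0 hK] := entire_lipschitz z0 hf.
apply/eqP; rewrite -normc_eq0 eq_le normc_ge0 andbT; apply: (@le0_pow2 _ _ K) => N.
have p0 : 0 < (2 ^- N : R) by rewrite invr_gt0 exprn_gt0.
have nz : normc (z0 + (2 ^- N)%:C - z0) = 2 ^- N.
  by rewrite addrAC subrr add0r normc_real gtr0_norm.
have := hK (z0 + (2 ^- N)%:C); rewrite nz h ?sub0r ?normcN; last first.
  by rewrite -subr_eq0 -normc_eq0 nz gt_eqF.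
by apply; rewrite invf_le1 ?exprn_gt0// exprn_ege1// ler1n.
Qed.

(** If every quotient vanished at [z0], then [f z = (z - z0) ^+ m * g z] for all [m], with [g z]
    bounded by a multiple of [(2 / r) ^+ m]. With [r] at least [4 * normc (z - z0)] this bounds
    [f z] by a multiple of [2 ^- m], so [f] would vanish identically. *)
Lemma entire_order f z0 : entire f -> (exists z, f z != 0) ->
  exists m g, [/\ entire g, forall z, f z = (z - z0) ^+ m * g z & g z0 != 0].
Proof.
move=> [c hc] [z fz]; apply: contrapT => nex.
have step m : exists d g, [/\ power_series d g,
    forall z, f z = (z - z0) ^+ m * g z &
    forall r M, 0 < r -> 2 * normc z0 <= r -> coef_bound c r M ->
      coef_bound d r (M * (2 / r) ^+ m)].
  elim: m => [|m [d [g [hd fg hb]]]].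
    by exists c, f; split => // [w|r M _ _ hM]; rewrite ?expr0 ?mul1r// mulr1.
  have [g0|g0] := eqVneq (g z0) 0; last by case: nex; exists m, g; split => //; exists d.
  have [d' [g' [hd' gg' hb']]] := power_series_div hd g0.
  exists d', g'; split => // [w|r M r0 zr hM].
    by rewrite fg gg' exprSr mulrA.
  have := hb' _ _ r0 zr (hb _ _ r0 zr hM); congr coef_bound.
  by rewrite exprSr; ring.
move/eqP: fz; apply; apply/eqP; rewrite -normc_eq0 eq_le normc_ge0 andbT.
pose r := 4 * (normc z + normc z0 + 1).
have nz := normc_ge0 z; have nz0 := normc_ge0 z0.
have r0 : 0 < r by rewrite /r; lra.
have [M hM] := hc.1 r r0.
apply: (@le0_pow2 _ _ (2 * M)) => m.
have [d [g [hd fg hb]]] := step m.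
have hdm : coef_bound d r (M * (2 / r) ^+ m) by apply: hb => //; rewrite /r; lra.
rewrite fg Normc.normcM normcX.
have gz : normc (g z) <= 2 * (M * (2 / r) ^+ m).
  by apply: power_series_bound hd r0 hdm _; rewrite /r; lra.
apply: (@le_trans _ _ ((r / 4) ^+ m * (2 * (M * (2 / r) ^+ m)))).
  apply: ler_pM; rewrite ?exprn_ge0 ?normc_ge0//.
  rewrite lerXn2r ?nnegrE ?normc_ge0//; first by rewrite divr_ge0// ltW.
  by rewrite (le_trans (normcB _ _))// /r; lra.
have -> : (r / 4) ^+ m * (2 * (M * (2 / r) ^+ m)) = 2 * M * (r / 4 * (2 / r)) ^+ m.
  by rewrite [in RHS]exprMn; move: (_ ^+ m) ((2 / r) ^+ m) => x y; ring.
have -> : r / 4 * (2 / r) = 2^-1 by field; rewrite gt_eqF.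
by rewrite exprVn.
Qed.

(** Needed because the cofactor in [zero_order] is merely continuous at the zero. One factor is
    split off at a time; the bound divides through away from [z0], and continuity extends it to
    [z0]. *)
Lemma entire_divX f z0 m (K e : R) : entire f -> 0 < e ->
  (forall z, normc (z - z0) < e -> normc (f z) <= K * normc (z - z0) ^+ m) ->
  exists2 g, entire g & forall z, f z = (z - z0) ^+ m * g z.
Proof.
elim: m f e K => [|m IH] f e K hf e0 hK.
  by exists f => // z; rewrite expr0 mul1r.
have f0 : f z0 = 0.
  apply/eqP; rewrite -normc_eq0 eq_le normc_ge0 andbT.
  by have := hK z0; rewrite subrr Normc.normc0 exprS mul0r mulr0; apply.
have [f1 hf1 ff1] := entire_div hf f0.
have b1 z : z != z0 -> normc (z - z0) < e -> normc (f1 z) <= K * normc (z - z0) ^+ m.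
  move=> zz0 /hK; rewrite ff1 Normc.normcM exprS mulrCA ler_pM2l//.
  by rewrite normc_gt0 subr_eq0.
have [L L0 hL] := entire_lipschitz z0 hf1.
have K0 : 0 <= K.
  pose z1 := z0 + (e / 2)%:C.
  have n1 : normc (z1 - z0) = e / 2.
    by rewrite /z1 addrAC subrr add0r normc_real gtr0_norm// divr_gt0.
  have := hK z1; rewrite n1 => /(_ _)/(le_trans (normc_ge0 _)) h.
  by have := h ltac:(lra); rewrite pmulr_lge0// exprn_gt0// divr_gt0.
(* [0 ^+ m] is 1 for [m = 0], where the claim only bounds [f1 z0], and 0 otherwise, where it says
   that [f1] vanishes again. Both follow by letting [z1] tend to [z0]. *)
have b0 : normc (f1 z0) <= K * 0 ^+ m.
  rewrite -subr_le0; set mu := Num.min 1 (e / 2).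
  have mu0 : 0 < mu by rewrite lt_min ltr01 divr_gt0.
  apply: (@le0_pow2 _ _ ((L + K) * mu)) => N.
  pose t := mu / 2 ^+ N; pose z1 := z0 + t%:C.
  have t0 : 0 < t by rewrite divr_gt0 ?exprn_gt0.
  have tmu : t <= mu.
    by rewrite /t ler_pdivrMr ?exprn_gt0// ler_peMr ?(ltW mu0)// exprn_ege1// ler1n.
  have t1 : t <= 1 by rewrite (le_trans tmu)// ge_min lexx.
  have te : t < e.
    have : t <= e / 2 by rewrite (le_trans tmu)// ge_min lexx orbT.
    by lra.
  have n1 : normc (z1 - z0) = t.
    by rewrite /z1 addrAC subrr add0r normc_real gtr0_norm.
  have z1z0 : z1 != z0 by rewrite -subr_eq0 -normc_eq0 n1 gt_eqF.
  have h1 : normc (f1 z1) <= K * t ^+ m by rewrite -n1 b1// n1.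
  have h2 : normc (f1 z1 - f1 z0) <= L * t by rewrite -n1 hL// n1.
  have h3 : t ^+ m <= 0 ^+ m + t.
    case: (m) => [|i]; first by rewrite !expr0 lerDl ltW.
    by rewrite expr0n/= add0r exprS ler_piMr ?(ltW t0)// exprn_ile1// ltW.
  have h4 : K * t ^+ m <= K * (0 ^+ m + t) by rewrite ler_wpM2l.
  have := ler_normcD (f1 z1) (f1 z0 - f1 z1).
  rewrite addrC subrK (normc_subC (f1 z0)) -mulrA -/t; lra.
have [|g hg fg] := IH f1 e K hf1 e0.
  move=> z ze; have [->|zz0] := eqVneq z z0; last exact: b1.
  by rewrite subrr Normc.normc0.
by exists g => // z; rewrite ff1 fg exprS mulrA.
Qed.

(** Peel off the constant term and divide by [z]: the shifted series vanishes for [z != 0] by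
    division, and at 0 by continuity. *)
Lemma power_series_eq0 c f : power_series c f -> (forall z, f z = 0) ->
  forall n, c n = 0.
Proof.
move=> hc hf n; elim: n c f hc hf => [|n IH] c f hc hf.
  have [_ /(_ 0)/gsum_shift] := hc; rewrite hf mulr1 sub0r => h.
  apply/eqP; rewrite -oppr_eq0; apply/eqP; apply: gsum_unique h (@eq_gsum _ _ _ _ _ (gsum0 R)).
  by move=> i; rewrite expr0n/= mulr0.
have c0 : c 0%N = 0.
  have [_ /(_ 0)/gsum_shift] := hc; rewrite hf mulr1 sub0r => h.
  apply/eqP; rewrite -oppr_eq0; apply/eqP; apply: gsum_unique h (@eq_gsum _ _ _ _ _ (gsum0 R)).
  by move=> i; rewrite expr0n/= mulr0.
have rc : rapid (fun n => c n.+1).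
  move=> r r0; have [M hM] := hc.1 r r0; exists (M / r) => i.
  by rewrite ler_pdivlMr// -mulrA -exprSr; exact: hM.
have [g hg] := power_series_exists rc.
apply: (IH (fun n => c n.+1) g) => // z.
have gz w : w != 0 -> g w = 0.
  move=> w0; have [_ /(_ w)/gsum_shift] := hc; rewrite hf c0 mul0r subr0 => h.
  have := gsumZ w (hg.2 w) => h'.
  apply: (mulfI w0); rewrite mulr0; apply: gsum_unique h' _.
  by apply: eq_gsum h => i; rewrite exprS mulrCA.
have [->|/gz//] := eqVneq z 0.
by apply: entire_eq0_at => //; exists (fun n => c n.+1).
Qed.

End EntireFunctions.

(** * A maximum principle for quotients of entire functions *)

Section MaximumPrinciple.
Variable R : realType.
Implicit Types (f g u v w : R[i] -> R[i]) (z : R[i]).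

(** The numerator [v z0 * w z - w z0 * v z] of the difference vanishes at [z0] and is Lipschitz
    there, while [v] keeps at least half of its modulus at [z0]. *)
Lemma entire_quotient_continuous w v z0 (e : R) : entire w -> entire v ->
  v z0 != 0 -> 0 < e ->
  exists2 d : R, 0 < d & forall z, normc (z - z0) < d ->
    v z != 0 /\ normc (w z / v z - w z0 / v z0) < e.
Proof.
move=> hw hv v0 e0; have [L L0 hL] := entire_lipschitz z0 hv.
have [H H0 hH] := entire_lipschitz z0 (entire_lin (v z0) (- w z0) hw hv).
have n0 : 0 < normc (v z0) by rewrite normc_gt0.
exists (Num.min 1 (Num.min (normc (v z0) / (2 * L)) (e * normc (v z0) ^+ 2 / (2 * H)))).
  by rewrite !lt_min ltr01 !divr_gt0 ?mulr_gt0// exprn_gt0.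
move=> z; rewrite !lt_min => /and3P[/ltW z1].
rewrite ltr_pdivlMr ?mulr_gt0// ltr_pdivlMr ?mulr_gt0// => z2 z3.
have nv : normc (v z0) / 2 <= normc (v z).
  have := hL z z1; have := ler_normcB_dist (v z0) (v z).
  by rewrite (normc_subC (v z0)); lra.
have vz : v z != 0 by rewrite -normc_gt0; lra.
split => //.
have -> : w z / v z - w z0 / v z0 = (v z0 * w z + - w z0 * v z) / (v z * v z0).
  by field; rewrite v0 vz.
have hz0 : v z0 * w z0 + - w z0 * v z0 = 0 by ring.
have := hH z z1; rewrite hz0 subr0 => h.
rewrite Normc.normcM Normc.normcV Normc.normcM ltr_pdivrMr ?mulr_gt0 ?normc_gt0//.
apply: (le_lt_trans h); have : e * (normc (v z0) / 2 * normc (v z0)) <= e * (normc (v z) * normc (v z0)).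
  by rewrite ler_pM2l// ler_pM2r.
by rewrite expr2 in z3; nra.
Qed.

(* Either the leading term [(z - z0)^j] of the deviation from the value at [z0]
   is absent and the quotient is locally constant, or following a direction in
   which this term is a positive multiple of the value increases the modulus. *)
Lemma quotient_local_max u v z0 : entire u -> entire v -> v z0 != 0 ->
  (exists2 d : R, 0 < d & forall z, normc (z - z0) < d ->
     v z != 0 /\ normc (u z / v z) = normc (u z0 / v z0)) \/
  (forall d : R, 0 < d -> exists z, [/\ normc (z - z0) < d, v z != 0 &
     normc (u z0 / v z0) < normc (u z / v z)]).
Proof.
move=> hu hv v0; pose h z := v z0 * u z + - u z0 * v z.
have hh : entire h := entire_lin (v z0) (- u z0) hu hv.
have [h0|/existsNP[z1 /eqP hz1]] := pselect (forall z, h z = 0).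
  left; have [d d0 hd] := entire_quotient_continuous hu hv v0 ltr01.
  exists d => // z /hd[vz _]; split => //; congr normc.
  apply: (mulfI v0); apply: (mulIf vz); rewrite -!mulrA [_^-1 * v z]mulrC mulfV// mulr1.
  by have /eqP := h0 z; rewrite /h mulNr subr_eq0 => /eqP ->; field.
right => d d0.
have [j [w [hw hE w0]]] := entire_order z0 hh (ex_intro _ z1 hz1).
have j0 : (0 < j)%N.
  case: j hE => // hE; move: (hE z0); rewrite /h mulNr mulrC addrN mul1r => /esym/eqP.
  by rewrite (negbTE w0).
pose A := u z0 / v z0; pose b := w z0 / v z0 / v z0.
have b0 : b != 0 by rewrite !mulf_neq0// invr_neq0.
(* A [j]-th root of [A / b] turns the leading term into a positive multiple of [A], so that the
   moduli add up exactly; for [A = 0] every direction does. *)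
have [zeta zeta0 [B0 hB]] : exists2 zeta, zeta != 0 & zeta ^+ j * b != 0 /\
    forall t : R, 0 <= t ->
    normc (A + t%:C * (zeta ^+ j * b)) = normc A + t * normc (zeta ^+ j * b).
  have [A0|A0] := eqVneq A 0.
    exists 1; first exact: oner_neq0.
    rewrite expr1n mul1r; split => // t t0.
    by rewrite A0 add0r Normc.normc0 add0r Normc.normcM normc_real ger0_norm.
  exists (j.-root (A / b)).
    by rewrite rootC_eq0// mulf_neq0// invr_neq0.
  rewrite rootCK// divfK//; split => // t t0.
  rewrite -{1}[A]mul1r -mulrDl Normc.normcM -(rmorphD (real_complex R) 1 t) normc_real.
  by rewrite ger0_norm ?addr_ge0// mulrDl mul1r.
have nz0 : 0 < normc zeta by rewrite normc_gt0.
have nv0 : 0 < normc (v z0) by rewrite normc_gt0.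
have nb0 : 0 < normc b by rewrite normc_gt0.
(* This tolerance keeps the remainder [eta / v z0] below half of [normc b], so that it cannot cancel
   the gain. *)
have e0 : 0 < normc b * normc (v z0) / 2 by rewrite divr_gt0 ?mulr_gt0.
have [d' d'0 hd'] := entire_quotient_continuous hw hv v0 e0.
pose t := Num.min d d' / (2 * normc zeta).
have dd : 0 < Num.min d d' by rewrite lt_min d0.
have t0 : 0 < t by rewrite divr_gt0 ?mulr_gt0.
have nt : normc (z0 + t%:C * zeta - z0) = Num.min d d' / 2.
  rewrite addrAC subrr add0r Normc.normcM normc_real gtr0_norm// /t.
  by field; rewrite gt_eqF.
exists (z0 + t%:C * zeta); set z := z0 + _.
have zd : normc (z - z0) < Num.min d d' by rewrite nt; lra.
move: (zd); rewrite lt_min => /andP[zd1 zd2].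
have [vz] := hd' z zd2.
set eta := w z / v z - _ => heta; split => //.
have -> : u z / v z = A + (t ^+ j)%:C * (zeta ^+ j * b) + (t ^+ j)%:C * zeta ^+ j * (eta / v z0).
  have zz0 : z - z0 = t%:C * zeta by rewrite /z addrAC subrr add0r.
  have := hE z; rewrite zz0 exprMn /h => e.
  have -> : u z / v z = A + (v z0 * u z - u z0 * v z) / (v z * v z0).
    by rewrite /A; field; rewrite v0 vz.
  rewrite -mulNr e rmorphXn /eta /b; field; by rewrite v0 vz.
rewrite -/A; have := hB _ (ltW (exprn_gt0 j t0)) => hB'.
have hs : normc ((t ^+ j)%:C * zeta ^+ j * (eta / v z0)) < t ^+ j * normc (zeta ^+ j * b).
  rewrite -mulrA Normc.normcM normc_real gtr0_norm ?exprn_gt0// ltr_pM2l ?exprn_gt0//.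
  rewrite (Normc.normcM _ (eta / _)) (Normc.normcM _ b).
  rewrite ltr_pM2l ?normc_gt0 ?expf_neq0// Normc.normcM Normc.normcV ltr_pdivrMr//.
  by apply: (lt_trans heta); rewrite ltr_pdivrMr// ltr_pMr ?mulr_gt0// ltr1n.
have := ler_normcB_dist (A + (t ^+ j)%:C * (zeta ^+ j * b))
   (- ((t ^+ j)%:C * zeta ^+ j * (eta / v z0))).
by rewrite opprK normcN; lra.
Qed.

(* With [z = rho ^+ 2], this is [2 * max (Re rho ^+ 2) (Im rho ^+ 2)]. *)
Definition gauge z : R := normc z + `|complex.Re z|.

Lemma gauge_continuous z z0 : `|gauge z - gauge z0| <= 2 * normc (z - z0).
Proof.
rewrite /gauge opprD addrACA (le_trans (ler_normD _ _))// mulr_natl mulr2n lerD//.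
  rewrite ler_norml ler_normcB_dist andbT lerNl opprB normc_subC.
  exact: ler_normcB_dist.
apply: (le_trans (ler_dist_dist _ _)).
have -> : complex.Re z - complex.Re z0 = complex.Re (z - z0) by case: z z0 => ? ? [].
exact: ler_Re_normc.
Qed.

(* [f] and [g] with a common factor [(z - z0)^m] removed, so that [f / g] becomes
   [d.1.2 / d.2], which is defined near [z0]. *)
Definition decomposed f g z0 (d : nat * (R[i] -> R[i]) * (R[i] -> R[i])) :=
  [/\ entire d.1.2, entire d.2, forall z, f z = (z - z0) ^+ d.1.1 * d.1.2 z,
      forall z, g z = (z - z0) ^+ d.1.1 * d.2 z & d.2 z0 != 0].

(** Extreme values are taken over [R * R], where the sublevel set of [gauge] is a closed part of a
    product of two segments. *)
Let complex_of_pair (p : R * R) : R[i] := p.1 +i* p.2.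

Let continuous_of_pair (G : R[i] -> R) :
  (forall z0 e, 0 < e -> exists2 d, 0 < d &
    forall z, normc (z - z0) < d -> `|G z - G z0| < e) ->
  continuous (G \o complex_of_pair).
Proof.
move=> hG p; apply/cvgrPdist_lt => e e0.
have [d d0 hd] := hG (complex_of_pair p) e e0.
exists (ball p.1 (d / 2), ball p.2 (d / 2)) => /=.
  by split; apply: nbhsx_ballx; rewrite divr_gt0.
move=> q [/= h1 h2]; rewrite distrC; apply: hd.
apply: (le_lt_trans (ler_normc_ReIm _)); rewrite /complex_of_pair /=.
by move: h1 h2; rewrite /ball/= distrC => h1; rewrite distrC => h2; lra.
Qed.

(* Among the points maximizing the modulus of the quotient, one of largest gauge
   must lie on the boundary. *)
Lemma quotient_max_principle f g (B e : R) : 0 < B ->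
  (forall z0, exists d, decomposed f g z0 d) ->
  (forall z, gauge z = B -> g z != 0 /\ normc (f z) <= e * normc (g z)) ->
  forall z, gauge z <= B -> normc (f z) <= e * normc (g z).
Proof.
move=> B0 /choice[D hD] hB.
pose U z := (D z).1.2 z; pose V z := (D z).2 z; pose Q z := normc (U z / V z).
(* [Q z] is defined through the decomposition at [z] itself. The one at [z0] gives the same value
   when its denominator is nonzero at [z], since this forces the common factor at [z] to have order
   0. *)
have Qloc z0 z : (D z0).2 z != 0 -> Q z = normc ((D z0).1.2 z / (D z0).2 z).
  have [-> //|zz0] := eqVneq z z0.
  move=> vz; have [_ _ f1 g1 v1] := hD z0; have [_ _ f2 g2 v2] := hD z.
  have p0 : (z - z0) ^+ (D z0).1.1 != 0 by rewrite expf_neq0// subr_eq0.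
  have := g1 z; have := f1 z; have := g2 z; have := f2 z.
  rewrite /Q /U /V subrr; case: ((D z).1.1) => [|m]; last first.
    rewrite exprS !mul0r => _ -> _ /esym/eqP.
    by rewrite mulf_eq0 (negbTE p0) (negbTE vz).
  by rewrite !mul1r => -> -> -> ->; congr normc; rewrite -mulf_div divff// mul1r.
have Qcont z0 d : 0 < d -> exists2 d', 0 < d' &
    forall z, normc (z - z0) < d' -> `|Q z - Q z0| < d.
  move=> d0; have [hu hv _ _ v1] := hD z0.
  have [d' d'0 hd'] := entire_quotient_continuous hu hv v1 d0.
  exists d' => // z /hd'[vz]; rewrite (Qloc _ _ vz) /Q /U /V.
  apply: le_lt_trans; rewrite ler_norml ler_normcB_dist andbT lerNl opprB normc_subC.
  exact: ler_normcB_dist.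
have Gcont z0 d : 0 < d -> exists2 d', 0 < d' &
    forall z, normc (z - z0) < d' -> `|gauge z - gauge z0| < d.
  move=> d0; exists (d / 2); first by rewrite divr_gt0.
  by move=> z hz; apply: (le_lt_trans (gauge_continuous _ _)); lra.
pose cG := continuous_of_pair Gcont; pose cQ := continuous_of_pair Qcont.
pose K : set (R * R) := [set p | gauge (complex_of_pair p) <= B].
have cK : compact K.
  apply: (@subclosed_compact _ _ (`[- B, B] `*` `[- B, B])).
  - exact: (preimage_closed (fun p _ => cG p) (@closed_le _ B)).
  - by apply: compact_setX; exact: segment_compact.
  - move=> [x y]; rewrite /K /gauge /= => h.
    have := ler_Re_normc (x +i* y); have := ler_Im_normc (x +i* y) => /= h1 h2.
    have := normr_ge0 x; rewrite !in_itv/= -!ler_norml /=; move: h.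
    by rewrite /complex_of_pair /= => h h3; split; lra.
have K0 : K !=set0.
  by exists (0, 0); rewrite /K/= /gauge /complex_of_pair complexr0 normc_real /= normr0 addr0 ltW.
have [p pK pmax] := compact_EVT_max K0 cK (continuous_subspaceT cQ).
set M := Q (complex_of_pair p).
pose K2 := K `&` [set q | M <= Q (complex_of_pair q)].
have cK2 : compact K2.
  apply: compact_closedI => //.
  exact: (preimage_closed (fun p _ => cQ p) (@closed_ge _ M)).
have K20 : K2 !=set0 by exists p; split; [exact: set_mem|rewrite /=].
have [q /set_mem[qK qM] qmax] := compact_EVT_max K20 cK2 (continuous_subspaceT cG).
have KP z : gauge z <= B -> K (complex.Re z, complex.Im z).
  by rewrite /K /complex_of_pair /=; case: z.
have RI z : complex_of_pair (complex.Re z, complex.Im z) = z by case: z.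
have QM z : gauge z <= B -> Q z <= M.
  by move=> /KP /mem_set/(pmax _) /=; rewrite RI.
have Me : M <= e.
  set z1 := complex_of_pair q.
  have [hz1|hz1] := eqVneq (gauge z1) B.
    have [g0 hfg] := hB _ hz1; apply: (le_trans qM).
    have [_ _ f2 g2 v2] := hD z1.
    rewrite /Q -/z1 Normc.normcM Normc.normcV ler_pdivrMr ?normc_gt0//.
    move: g0 hfg; rewrite f2 g2 subrr; case: ((D z1).1.1) => [|m].
      by rewrite !mul1r.
    by rewrite exprS !mul0r eqxx.
  have {}hz1 : gauge z1 < B by rewrite lt_neqAle hz1.
  have [hu hv _ _ v1] := hD z1.
  have near1 z : normc (z - z1) < (B - gauge z1) / 2 -> gauge z <= B.
    by move=> hz; have := gauge_continuous z z1; rewrite ler_norml => /andP[_]; lra.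
  have d0 : 0 < (B - gauge z1) / 2 by rewrite divr_gt0// subr_gt0.
  (* At an interior point a strictly larger modulus contradicts the maximality of [M]. If the
     modulus is locally constant, all nearby points are maximizers, and one of them has a larger
     gauge, against the choice of [q]. *)
  have [[d dp hd]|/(_ _ d0)[z [hz vz]]] := quotient_local_max hu hv v1; last first.
    rewrite -(Qloc _ _ vz) -/(Q z1) => h.
    by have := QM z (near1 _ hz); rewrite leNgt (le_lt_trans qM)//.
  pose m := Num.min d ((B - gauge z1) / 2).
  have m0 : 0 < m by rewrite lt_min dp.
  (* [gauge] is positively homogeneous, so it grows along the ray through [z1], and from 0 along the
     real axis. *)
  have [z [zm zg]] : exists z, normc (z - z1) < m /\ gauge z1 < gauge z.
    have [z10|z10] := eqVneq z1 0.
      exists (m / 2)%:C; rewrite z10 subr0 /gauge normc_real /= expr0n addr0 sqrtr0 normr0 addr0.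
      by rewrite gtr0_norm ?divr_gt0//; split; lra.
    pose t := m / (2 * normc z1).
    have n0 : 0 < normc z1 by rewrite normc_gt0.
    have t0 : 0 < t by rewrite divr_gt0 ?mulr_gt0.
    exists ((1 + t)%:C * z1); split.
      rewrite rmorphD mulrDl mul1r addrAC subrr add0r Normc.normcM normc_real gtr0_norm//.
      by rewrite (_ : t * normc z1 = m / 2); [lra|rewrite /t; field; rewrite gt_eqF].
    rewrite /gauge Normc.normcM normc_real Re_realM.
    have t1 : 0 < 1 + t by rewrite addr_gt0.
    by rewrite normrM gtr0_norm// -mulrDr ltr_pMl ?ltrDl// ltr_wpDr.
  have zd : normc (z - z1) < d by apply: (lt_le_trans zm); rewrite ge_min lexx.
  have [vz Qz] := hd z zd.
  have zB : gauge z <= B by apply: near1; apply: (lt_le_trans zm); rewrite ge_min lexx orbT.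
  have : K2 (complex.Re z, complex.Im z).
    split; first exact: KP.
    by rewrite /= RI (Qloc _ _ vz) Qz.
  by move=> /mem_set/qmax /=; rewrite RI leNgt zg.
move=> z zB; have [_ _ f2 g2 v2] := hD z.
rewrite f2 g2 subrr; case: ((D z).1.1) => [|m].
  rewrite !mul1r -ler_pdivrMr ?normc_gt0// -Normc.normcV -Normc.normcM.
  exact: le_trans (QM _ zB) Me.
by rewrite exprS !mul0r Normc.normc0 mulr0.
Qed.

End MaximumPrinciple.

(** * Entire functions with the same zeros *)

Section SameSpectrum.
Variable R : realType.
Implicit Types (f g : R[i] -> R[i]) (z : R[i]).

Lemma zero_order_bigO f z0 m : zero_order f z0 m ->
  exists K e : R, 0 < e /\ forall z, normc (z - z0) < e ->
    normc (f z) <= K * normc (z - z0) ^+ m.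
Proof.
move=> [g [fg _ hg]]; have [d d0 hd] := hg 1 ltr01.
exists (normc (g z0) + 1), d; split => // z zd.
have := hd z; rewrite !normr_normc !ltcR => /(_ zd) h.
rewrite fg Normc.normcM normcX mulrC ler_wpM2r ?exprn_ge0 ?normc_ge0//.
by have := ler_normcB_dist (g z) (g z0); lra.
Qed.

Lemma entire_zero_order f g z0 m : entire g -> g z0 != 0 ->
  (forall z, f z = (z - z0) ^+ m * g z) -> zero_order f z0 m.
Proof.
move=> hg g0 fg; exists g; split => // e e0.
have [L L0 hL] := entire_lipschitz z0 hg.
exists (Num.min 1 (e / L)); first by rewrite lt_min ltr01 divr_gt0.
move=> z; rewrite !normr_normc !ltcR lt_min => /andP[/ltW/hL z1].
by rewrite ltr_pdivlMr// mulrC; exact: le_lt_trans.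
Qed.

Lemma entire_same_spectrum_eq f g : entire f -> entire g -> same_spectrum f g ->
  (forall e B0 : R, 0 < e -> exists B, [/\ 0 < B, B0 <= B & forall z, gauge z = B ->
     g z != 0 /\ normc (f z - g z) <= e * normc (g z)]) ->
  forall z, f z = g z.
Proof.
move=> hf hg hfg hB.
have gn0 : exists z, g z != 0.
  have [B [B0 _ h]] := hB 1 0 ltr01; exists (B / 2)%:C.
  by apply: (h _ _).1; rewrite /gauge normc_real /= gtr0_norm ?divr_gt0//; lra.
(* Equality of the orders enters here: the factor [(z - z0) ^+ m] of [g] also divides [f], hence
   [f - g], and what remains of [g] is nonzero at [z0]. *)
have hD z0 : exists d, decomposed (fun z => f z - g z) g z0 d.
  have [m [v [hv gv v0]]] := entire_order z0 hg gn0.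
  have [K [e [e0 hK]]] := zero_order_bigO ((hfg z0 m).2 (entire_zero_order hv v0 gv)).
  have [u hu fu] := entire_divX hf e0 hK.
  exists (m, fun z => u z - v z, v); split => //=; first exact: entireB.
  by move=> z; rewrite fu gv mulrBr.
move=> z; apply/eqP; rewrite -subr_eq0 -normc_eq0 eq_le normc_ge0 andbT.
apply: (@le0_pow2 _ _ (normc (g z))) => N.
have p0 : 0 < (2 ^- N : R) by rewrite invr_gt0 exprn_gt0.
(* A contour enclosing [z], with tolerance [2 ^- N] for an arbitrary [N]. *)
have [B [B0 hz h]] := hB _ (gauge z) p0.
by rewrite mulrC; exact: (quotient_max_principle B0 hD h).
Qed.

End SameSpectrum.

(** * Complex exponential and trigonometric functions *)

Section CauchyProduct.
Variable R : realType.
Implicit Types a b : nat -> R[i].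

Lemma leSn_pow2 n : (n.+1%:R : R) <= 2 ^+ n.
Proof. by rewrite -natrX ler_nat; exact: ltn_expl. Qed.

(** The rate 8 leaves room for counting terms: the [n.+1] products in a Cauchy coefficient reduce it
    to 4, and the [N] coefficients beyond the truncation reduce it to 2, the rate asked for by
    [gsum]. *)
Lemma gsum_mul a b l m (M M' : R) :
  (forall n, normc (a n) <= M / 8 ^+ n) -> (forall n, normc (b n) <= M' / 8 ^+ n) ->
  gsum a l -> gsum b m ->
  gsum (fun n => \sum_(i < n.+1) a i * b (n - i)%N) (l * m).
Proof.
move=> ha hb la mb.
have M0 : 0 <= M by have := ha 0%N; rewrite divr1; apply: le_trans; exact: normc_ge0.
have M'0 : 0 <= M' by have := hb 0%N; rewrite divr1; apply: le_trans; exact: normc_ge0.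
have pow28 n : (2 : R) ^+ n <= 8 ^+ n by rewrite lerXn2r ?nnegrE// ler_nat.
have le82 (K : R) n : 0 <= K -> K / 8 ^+ n <= K / 2 ^+ n.
  by move=> K0; rewrite ler_wpM2l// lef_pV2 ?posrE ?exprn_gt0.
have ha2 n := le_trans (ha n) (le82 _ n M0).
have hb2 n := le_trans (hb n) (le82 _ n M'0).
have nl := gsum_bound ha2 la; have nm := gsum_bound hb2 mb.
have [Ma hMa] := la; have [Mb hMb] := mb.
exists (Ma * (2 * M' + Mb) + 2 * M * Mb + M * M') => N.
(* Truncations as polynomials: [A * B] at 1 is the sum of its coefficients, the first [N] of which
   are those of the Cauchy product; the others, at most [N], form the tail. *)
pose A : {poly R[i]} := \poly_(i < N) a i; pose B : {poly R[i]} := \poly_(i < N) b i.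
have A1 : A.[1] = \sum_(i < N) a i.
  by rewrite (horner_coef_wide _ (size_poly _ _)); apply: eq_bigr => i _;
    rewrite coef_poly ltn_ord expr1n mulr1.
have B1 : B.[1] = \sum_(i < N) b i.
  by rewrite (horner_coef_wide _ (size_poly _ _)); apply: eq_bigr => i _;
    rewrite coef_poly ltn_ord expr1n mulr1.
have sAB : (size (A * B)%R <= N + N)%N.
  apply: (leq_trans (size_polyMleq _ _)); apply: (leq_trans (leq_pred _)).
  by apply: leq_add; exact: size_poly.
have AB : A.[1] * B.[1] = \sum_(n < N) \sum_(i < n.+1) a i * b (n - i)%N
   + \sum_(n < N) (A * B)`_(N + n).
  rewrite -hornerM (horner_coef_wide _ sAB) big_split_ord /=; congr (_ + _).
    apply: eq_bigr => n _; rewrite expr1n mulr1 coefM; apply: eq_bigr => i _.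
    rewrite !coef_poly (leq_ltn_trans _ (ltn_ord n)) ?leq_ord//.
    by rewrite (leq_ltn_trans _ (ltn_ord n)) ?leq_subr.
  by apply: eq_bigr => n _; rewrite expr1n mulr1.
have coefb n : normc ((A * B)`_n) <= M * M' / 4 ^+ n.
  rewrite coefM (le_trans (normc_sum _ _ _))//.
  apply: (@le_trans _ _ (\sum_(i < n.+1) M * M' / 8 ^+ n)).
    apply: ler_sum => i _; rewrite Normc.normcM.
    have hA : normc A`_i <= M / 8 ^+ i.
      by rewrite coef_poly; case: ifP => _ //; rewrite Normc.normc0 divr_ge0 ?exprn_ge0.
    have hB : normc B`_(n - i) <= M' / 8 ^+ (n - i).
      by rewrite coef_poly; case: ifP => _ //; rewrite Normc.normc0 divr_ge0 ?exprn_ge0.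
    apply: (le_trans (ler_pM (normc_ge0 _) (normc_ge0 _) hA hB)).
    by rewrite mulf_div -exprD subnKC// leq_ord.
  rewrite sumr_const card_ord -[X in X <= _]mulr_natr -[X in X <= _]mulrA ler_wpM2l ?mulr_ge0//.
  rewrite mulrC ler_pdivrMr ?exprn_gt0//.
  have -> : (8 : R) ^+ n = 4 ^+ n * 2 ^+ n by rewrite -exprMn -natrM.
  by rewrite mulrA mulVf ?expf_neq0// mul1r leSn_pow2.
have tail : normc (\sum_(n < N) (A * B)`_(N + n)) <= M * M' / 2 ^+ N.
  rewrite (le_trans (normc_sum _ _ _))//.
  apply: (@le_trans _ _ (\sum_(i < N) M * M' / 4 ^+ N)).
    apply: ler_sum => i _; apply: (le_trans (coefb _)).
    rewrite ler_wpM2l ?mulr_ge0// lef_pV2 ?posrE ?exprn_gt0//.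
    by rewrite exprD ler_peMr ?exprn_ge0// exprn_ege1// ler1n.
  rewrite sumr_const card_ord -[X in X <= _]mulr_natr -[X in X <= _]mulrA ler_wpM2l ?mulr_ge0//.
  rewrite mulrC ler_pdivrMr ?exprn_gt0//.
  have -> : (4 : R) ^+ N = 2 ^+ N * 2 ^+ N by rewrite -exprMn -natrM.
  rewrite mulrA mulVf ?expf_neq0// mul1r (le_trans _ (leSn_pow2 N))// ler_nat.
  exact: leqnSn.
have Bb : normc B.[1] <= 2 * M' + Mb.
  have := hMb N; rewrite -B1 => h.
  have : Mb / 2 ^+ N <= Mb.
    have Mb0 : 0 <= Mb by have := hMb 0%N; rewrite divr1; apply: le_trans; exact: normc_ge0.
    by rewrite ler_pdivrMr ?exprn_gt0// ler_peMr// exprn_ege1// ler1n.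
  have := ler_normcB_dist B.[1] m; rewrite (normc_subC B.[1]); lra.
have -> : l * m - \sum_(n < N) \sum_(i < n.+1) a i * b (n - i)%N =
   (l - A.[1]) * B.[1] + l * (m - B.[1]) + \sum_(n < N) (A * B)`_(N + n).
  by move/eqP: AB; rewrite addrC -subr_eq => /eqP <-; ring.
apply: (le_trans (ler_normcD _ _)); rewrite [X in _ <= X]mulrDl lerD//.
apply: (le_trans (ler_normcD _ _)); rewrite [X in _ <= X]mulrDl lerD// Normc.normcM.
  have := hMa N; rewrite -A1 mulrAC => h.
  by apply: ler_pM => //; exact: normc_ge0.
by have := hMb N; rewrite -B1 -mulrA => h; apply: ler_pM => //; exact: normc_ge0.
Qed.

End CauchyProduct.

Section ComplexExponential.
Variable R : realType.
Implicit Types z w : R[i].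

Lemma cexpD z w : cexp (z + w) = cexp z * cexp w.
Proof.
case: z w => [a b] [c d]; rewrite /cexp /= expRD cosD sinD.
by apply: complex_eq; rewrite /=; ring.
Qed.

Lemma normc_cexp z : normc (cexp z) = expR (complex.Re z).
Proof.
rewrite /cexp Normc.normcM normc_real normcE /= cos2Dsin2 sqrtr1 mulr1.
by rewrite ger0_norm// expR_ge0.
Qed.

Definition exp_term z n : R[i] := z ^+ n / n`!%:R.

Lemma natr_complex n : (n%:R : R[i]) = (n%:R)%:C.
Proof. by rewrite rmorph_nat. Qed.

Lemma normc_natr n : normc (n%:R : R[i]) = n%:R.
Proof. by rewrite natr_complex normc_real normr_nat. Qed.

Lemma expR_ge_term (x : R) n : 0 <= x -> x ^+ n / n`!%:R <= expR x.
Proof.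
move=> x0; case: n => [|n].
  by rewrite expr0 divr1 -expR0 ler_expR.
by apply: le_trans (expR_ge1Dxn n x0); rewrite lerDr.
Qed.

(** A single term of the series of [exp (r * normc z)] is at most the sum. The rate [r] is free,
    since Cauchy products require 8. *)
Lemma normc_exp_term z n (r : R) : 0 < r ->
  normc (exp_term z n) <= expR (r * normc z) / r ^+ n.
Proof.
move=> r0; rewrite Normc.normcM normcX Normc.normcV normc_natr ler_pdivlMr ?exprn_gt0//.
by rewrite mulrAC -exprMn [normc z * r]mulrC expR_ge_term// mulr_ge0 ?normc_ge0// ltW.
Qed.

Lemma exp_termD z w n :
  exp_term (z + w) n = \sum_(i < n.+1) exp_term z i * exp_term w (n - i)%N.
Proof.
rewrite /exp_term addrC exprDn_comm; last exact: mulrC.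
rewrite mulr_suml; apply: eq_bigr => i _.
rewrite -mulr_natr -(bin_fact (leq_ord i)) !natrM.
have f0 j : (j`!%:R : R[i]) != 0 by rewrite pnatr_eq0 -lt0n fact_gt0.
have c0 : ('C(n, i)%:R : R[i]) != 0.
  by rewrite pnatr_eq0 -lt0n bin_gt0 leq_ord.
by field; rewrite !f0 c0.
Qed.

Lemma exp_term_real (x : R) n : exp_term x%:C n = (exp_coeff x n)%:C.
Proof. by rewrite /exp_term /exp_coeff /= natr_complex -fmorphV -rmorphXn -rmorphM. Qed.

Lemma exp_term_imag (y : R) n : exp_term (0 +i* y) n = cos_coeff y n +i* sin_coeff y n.
Proof.
rewrite /exp_term /cos_coeff /sin_coeff /=.
have -> : (0 +i* y) ^+ n = (y ^+ n)%:C * 'i ^+ n.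
  rewrite rmorphXn -exprMn; congr (_ ^+ n); apply: complex_eq => /=; ring.
rewrite natr_complex -fmorphV mulrAC -rmorphM.
have -> : 'i ^+ n = ((~~ odd n)%:R * (-1) ^+ n./2) +i* ((odd n)%:R * (-1) ^+ n.-1./2) :> R[i].
  rewrite -{1}(odd_double_half n) exprD -mul2n exprM sqr_i.
  have -> : (-1 : R[i]) ^+ n./2 = ((-1) ^+ n./2)%:C by rewrite rmorphXn rmorphN1.
  case: (boolP (odd n)) => on /=; last first.
    by rewrite expr0 !mul1r mul0r complexr0.
  have -> : n.-1./2 = n./2 by rewrite -{1}(odd_double_half n) on /= doubleK.
  by rewrite expr1; apply: complex_eq => /=; ring.
apply: complex_eq; rewrite ?Re_realM ?Im_realM /= -?exprnP; ring.
Qed.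

(** [cexp] is defined through real functions; its Taylor series is the Cauchy product of the series
    of [exp (Re z)] and of [cos (Im z) + i sin (Im z)], merged by the binomial theorem. *)
Lemma gsum_cexp z : gsum (exp_term z) (cexp z).
Proof.
have b8 w n := normc_exp_term w n (ltr0n R 8).
have b2 w n := normc_exp_term w n (ltr0n R 2).
have gx : gsum (exp_term (complex.Re z)%:C) (expR (complex.Re z))%:C.
  apply: (gsum_ReIm (b2 _)).
    have -> : (fun n => complex.Re (exp_term (complex.Re z)%:C n)) = exp_coeff (complex.Re z).
      by apply/funext => n; rewrite exp_term_real.
    exact: is_cvg_series_exp_coeff.
  have -> : (fun n => complex.Im (exp_term (complex.Re z)%:C n)) = fun=> 0.
    by apply/funext => n; rewrite exp_term_real.
  by rewrite /series /=; under eq_fun do rewrite big1//; exact: cvg_cst.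
have gy : gsum (exp_term (0 +i* complex.Im z)) (cos (complex.Im z) +i* sin (complex.Im z)).
  apply: (gsum_ReIm (b2 _)).
    have -> : (fun n => complex.Re (exp_term (0 +i* complex.Im z) n)) = cos_coeff (complex.Im z).
      by apply/funext => n; rewrite exp_term_imag.
    by rewrite cos.unlock; exact: is_cvg_series_cos_coeff.
  have -> : (fun n => complex.Im (exp_term (0 +i* complex.Im z) n)) = sin_coeff (complex.Im z).
    by apply/funext => n; rewrite exp_term_imag.
  by rewrite sin.unlock; exact: is_cvg_series_sin_coeff.
have := gsum_mul (b8 _) (b8 _) gx gy; apply: eq_gsum => n; rewrite -exp_termD.
by congr (exp_term _ n); case: z {gx gy} => x y; apply: complex_eq; rewrite /= ?addr0 ?add0r.
Qed.

End ComplexExponential.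

(** * Product formulas, Taylor series and growth of [cosl] and [sinl] *)

Section ComplexTrigonometry.
Variable R : realType.
Implicit Types (z w lam : R[i]) (s t : R).

Lemma gsum_even (a : nat -> R[i]) l : gsum a l -> (forall n, a n.*2.+1 = 0) ->
  gsum (fun n => a n.*2) l.
Proof.
move=> [M hM] a0; exists M => N.
have -> : \sum_(i < N) a i.*2 = \sum_(i < N.*2) a i.
  elim: N => [|N IH]; first by rewrite !big_ord0.
  by rewrite big_ord_recr IH doubleS !big_ord_recr/= a0 addr0.
apply: (le_trans (hM _)).
have M0 : 0 <= M by have := hM 0%N; rewrite divr1; apply: le_trans; exact: normc_ge0.
rewrite ler_wpM2l// lef_pV2 ?posrE ?exprn_gt0// ler_weXn2l ?ler1n//.
by rewrite -addnn leq_addr.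
Qed.

Lemma gsum_odd (a : nat -> R[i]) l : gsum a l -> (forall n, a n.*2 = 0) ->
  gsum (fun n => a n.*2.+1) l.
Proof.
move=> /gsum_shift h a0; have := a0 0%N; rewrite double0 => a00.
by move: h; rewrite a00 subr0 => /gsum_even; apply => n; rewrite -doubleS.
Qed.

Lemma csinE z : csin z = - 'i / 2 * (cexp ('i * z) - cexp (- ('i * z))).
Proof.
have i2 : 'i * 'i = -1 :> R[i] by rewrite -expr2 sqr_i.
have i0 : 'i != 0 :> R[i] by rewrite eq_complex /= oner_eq0 andbF.
by rewrite /csin mulrC; congr (_ * _); apply: (mulIf i0);
   rewrite invfM -mulrA mulVf// mulr1 mulrAC mulNr i2 opprK mul1r.
Qed.

Lemma cexpM_i z w : [/\ cexp ('i * (z + w)) = cexp ('i * z) * cexp ('i * w),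
  cexp (- ('i * (z + w))) = cexp (- ('i * z)) * cexp (- ('i * w)),
  cexp ('i * (z - w)) = cexp ('i * z) * cexp (- ('i * w)) &
  cexp (- ('i * (z - w))) = cexp (- ('i * z)) * cexp ('i * w)].
Proof.
by split; rewrite -cexpD; congr cexp; ring.
Qed.

Lemma ccos_ccos z w : ccos z * ccos w = (ccos (z + w) + ccos (z - w)) / 2.
Proof.
by rewrite /ccos; have [-> -> -> ->] := cexpM_i z w; field.
Qed.

Lemma csin_csin z w : csin z * csin w = (ccos (z - w) - ccos (z + w)) / 2.
Proof.
rewrite !csinE /ccos; have [-> -> -> ->] := cexpM_i z w.
rewrite mulrACA (_ : - 'i / 2 * (- 'i / 2) = - 4^-1); first by field.
by rewrite mulrACA mulrNN -expr2 sqr_i; field.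
Qed.

Lemma csin_ccos z w : csin z * ccos w = (csin (z + w) + csin (z - w)) / 2.
Proof.
by rewrite !csinE /ccos; have [-> -> -> ->] := cexpM_i z w; field.
Qed.

Lemma ccos0 : ccos (0 : R[i]) = 1.
Proof.
have e0 : cexp 0 = 1 :> R[i] by rewrite /cexp /= expR0 cos0 sin0; apply: complex_eq => /=; ring.
by rewrite /ccos mulr0 oppr0 e0; field.
Qed.

Lemma ccosN z : ccos (- z) = ccos z.
Proof. by rewrite /ccos mulrN opprK addrC. Qed.

Lemma csinN z : csin (- z) = - csin z.
Proof. by rewrite !csinE mulrN opprK; ring. Qed.

Lemma coslN lam s : cosl lam (- s) = cosl lam s.
Proof. by rewrite /cosl rmorphN mulrN ccosN. Qed.

Lemma sinlN lam s : sinl lam (- s) = - sinl lam s.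
Proof. by rewrite /sinl rmorphN mulrN csinN mulNr; case: ifP. Qed.

Lemma cosl_cosl lam s t :
  cosl lam s * cosl lam t = (cosl lam (s + t) + cosl lam (s - t)) / 2.
Proof. by rewrite /cosl ccos_ccos rmorphD rmorphB mulrDr mulrBr. Qed.

Lemma sqrtC2 lam : sqrtC lam * sqrtC lam = lam.
Proof. by rewrite -expr2 sqrtCK. Qed.

(** The factor [lam] absorbs the two divisions by [rho], so that the formula includes [lam = 0]. *)
Lemma sinl_sinl lam s t :
  lam * (sinl lam s * sinl lam t) = (cosl lam (s - t) - cosl lam (s + t)) / 2.
Proof.
rewrite /sinl /cosl; case: eqVneq => [->|l0].
  by rewrite mul0r sqrtC0 !mul0r ccos0 subrr mul0r.
have r0 : sqrtC lam != 0 by rewrite sqrtC_eq0.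
rewrite rmorphB mulrBr rmorphD mulrDr -csin_csin -{1}(sqrtC2 lam).
by field.
Qed.

Lemma sinl_cosl lam s t :
  sinl lam s * cosl lam t = (sinl lam (s + t) + sinl lam (s - t)) / 2.
Proof.
rewrite /sinl /cosl; case: eqVneq => [->|l0].
  by rewrite sqrtC0 !mul0r ccos0 mulr1 rmorphD rmorphB; field.
have r0 : sqrtC lam != 0 by rewrite sqrtC_eq0.
by rewrite mulrAC csin_ccos rmorphD rmorphB mulrDr mulrBr; field.
Qed.

(** Taylor coefficients of [cosl lam s] and [sinl lam s] in powers of [lam = rho ^+ 2], as functions
    of [s]. *)
Definition cos_mono n s : R := (-1) ^+ n * s ^+ n.*2 / n.*2`!%:R.
Definition sin_mono n s : R := (-1) ^+ n * s ^+ n.*2.+1 / n.*2.+1`!%:R.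

Lemma real_mono (m k : nat) s : (((-1) ^+ m * s ^+ k / k`!%:R)%:C : R[i]) =
   (-1) ^+ m * s%:C ^+ k / k`!%:R.
Proof.
by rewrite !rmorphM fmorphV rmorph_nat !rmorphXn rmorphN1.
Qed.

Lemma exp_term_even z n : exp_term ('i * z) n.*2 = (-1) ^+ n * z ^+ n.*2 / n.*2`!%:R.
Proof. by rewrite /exp_term exprMn -{1}mul2n exprM sqr_i. Qed.

Lemma exp_termN z n : exp_term (- z) n = (-1) ^+ n * exp_term z n.
Proof. by rewrite /exp_term (exprNn z) mulrA. Qed.

Lemma gsum_cosl lam s :
  gsum (fun n => (cos_mono n s)%:C * lam ^+ n) (cosl lam s).
Proof.
set z := sqrtC lam * s%:C.
have h := gsumZ 2^-1 (gsumD (gsum_cexp ('i * z)) (gsum_cexp (- ('i * z)))).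
rewrite /cosl /ccos mulrC; apply: eq_gsum (gsum_even h _) => [n|n].
  rewrite exp_termN -signr_odd odd_double expr0 mul1r exp_term_even.
  rewrite /z exprMn -[in _ ^+ n.*2 * _]mul2n exprM sqrtCK real_mono mul2n.
  by field; rewrite pnatr_eq0 -lt0n fact_gt0.
by rewrite exp_termN -signr_odd /= odd_double expr1 mulN1r subrr mulr0.
Qed.

Lemma gsum_sinl lam s :
  gsum (fun n => (sin_mono n s)%:C * lam ^+ n) (sinl lam s).
Proof.
rewrite /sinl; case: eqVneq => [->|l0].
  apply: eq_gsum ((power_series_cst s%:C).2 0) => -[|n].
    by rewrite /sin_mono double0 !mulr1 expr0 mul1r expr1 divr1.
  by rewrite mul0r expr0n/= mulr0.
have r0 : sqrtC lam != 0 by rewrite sqrtC_eq0.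
set z := sqrtC lam * s%:C.
have h := gsumZ (- 'i / 2 / sqrtC lam)
  (gsumD (gsum_cexp ('i * z)) (gsumZ (-1) (gsum_cexp (- ('i * z))))).
have -> : csin z / sqrtC lam = - 'i / 2 / sqrtC lam * (cexp ('i * z) + -1 * cexp (- ('i * z))).
  by rewrite csinE mulN1r mulrAC.
apply: eq_gsum (gsum_odd h _) => [n|n].
  have -> : exp_term (- ('i * z)) n.*2.+1 = - exp_term ('i * z) n.*2.+1.
    by rewrite exp_termN -signr_odd /= odd_double expr1 mulN1r.
  rewrite mulN1r opprK.
  rewrite /exp_term exprMn !exprS mulrACA.
  have -> : 'i ^+ n.*2 = (-1) ^+ n :> R[i] by rewrite -mul2n exprM sqr_i.
  rewrite /z (exprMn n.*2) -[in _ ^+ n.*2 * _]mul2n exprM sqrtCK real_mono mul2n exprS.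
  have i2 : - 'i * 'i = 1 :> R[i] by rewrite mulNr -expr2 sqr_i opprK.
  rewrite -[RHS]mul1r -[X in _ = X * _]i2.
  by field; rewrite r0 pnatr_eq0 -lt0n fact_gt0.
by rewrite exp_termN -signr_odd odd_double expr0 mul1r mulN1r subrr mulr0.
Qed.

Lemma Re_iM z : complex.Re ('i * z) = - complex.Im z.
Proof. by rewrite creM /= mul0r mul1r sub0r. Qed.

Lemma Im_iM z : complex.Im ('i * z) = complex.Re z.
Proof. by rewrite cimM /= mul0r mul1r add0r. Qed.

Lemma expR_normP (y : R) : [/\ expR y <= expR `|y|, expR (- y) <= expR `|y| &
   expR `|y| + expR (- `|y|) = expR y + expR (- y)].
Proof.
rewrite !ler_expR ler_norm -normrN ler_norm; split => //.
rewrite normrN; have [y0|y0] := lerP 0 y; first by rewrite ger0_norm.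
by rewrite ltr0_norm// opprK addrC.
Qed.

Lemma normc_half z : normc (z / 2) = normc z / 2.
Proof. by rewrite Normc.normcM Normc.normcV normc2. Qed.

Lemma normc_i : normc ('i : R[i]) = 1.
Proof. by rewrite normcE /= expr0n add0r expr1n sqrtr1. Qed.

Lemma normc_csinE z : normc (csin z) = normc (cexp ('i * z) - cexp (- ('i * z))) / 2.
Proof.
by rewrite csinE mulrAC normc_half Normc.normcM normcN normc_i mul1r.
Qed.

Lemma normc_ccos_le z : normc (ccos z) <= expR `|complex.Im z|.
Proof.
rewrite /ccos normc_half; have := ler_normcD (cexp ('i * z)) (cexp (- ('i * z))).
rewrite !normc_cexp creN Re_iM opprK; have [h1 h2 _] := expR_normP (complex.Im z).
lra.
Qed.

Lemma normc_csin_le z : normc (csin z) <= expR `|complex.Im z|.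
Proof.
rewrite normc_csinE; have := normcB (cexp ('i * z)) (cexp (- ('i * z))).
rewrite !normc_cexp creN Re_iM opprK; have [h1 h2 _] := expR_normP (complex.Im z).
lra.
Qed.

Let expR_gap (y : R) : 1 <= `|y| -> expR (- `|y|) <= expR `|y| / 2.
Proof.
move=> y1; rewrite expRN; have := expR_ge1Dx `|y| => h.
rewrite -(@ler_pM2l _ (expR `|y|)) ?expR_gt0// divff ?gt_eqF ?expR_gt0//.
by nra.
Qed.

Let gap_sum z (P : R[i]) : 1 <= `|complex.Im z| ->
  P = cexp (- ('i * z)) \/ P = - cexp (- ('i * z)) ->
  expR `|complex.Im z| / 2 <= normc (cexp ('i * z) + P).
Proof.
move=> y1 hP; have nP : normc P = expR (complex.Im z).
  by case: hP => ->; rewrite ?normcN normc_cexp creN Re_iM opprK.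
have nE : normc (cexp ('i * z)) = expR (- complex.Im z) by rewrite normc_cexp Re_iM.
have h1 := ler_normcB_dist (cexp ('i * z)) (- P).
have h2 := ler_normcB_dist P (- cexp ('i * z)).
rewrite !opprK !normcN nP nE in h1 h2; rewrite [P + _]addrC in h2.
have := expR_gap y1; have [y0|y0] := lerP 0 (complex.Im z).
  by rewrite ger0_norm//; lra.
by rewrite ltr0_norm// opprK; lra.
Qed.

(** For [|Im z| >= 1] one of the two exponentials dominates. If [cos (Re z) = 0], they are purely
    imaginary with opposite signs, so their moduli add up in the difference. *)
Lemma normc_csin_ge z : 1 <= `|complex.Im z| \/ cos (complex.Re z) = 0 ->
  expR `|complex.Im z| / 4 <= normc (csin z).
Proof.
rewrite normc_csinE => -[y1|c0].
  by have := gap_sum y1 (or_intror erefl); lra.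
have -> : cexp ('i * z) - cexp (- ('i * z)) =
   (expR (complex.Im z) + expR (- complex.Im z))%:C * (0 +i* sin (complex.Re z)).
  rewrite /cexp !creN !cimN !Re_iM !Im_iM opprK cosN sinN c0.
  by apply: complex_eq; rewrite ?(creD, cimD, creN, cimN, Re_realM, Im_realM)/=; ring.
rewrite Normc.normcM normc_real normcE /= expr0n add0r sin2cos2 c0 expr0n subr0 sqrtr1 mulr1.
rewrite (ger0_norm (addr_ge0 (expR_ge0 _) (expR_ge0 _))); have [_ _ <-] := expR_normP (complex.Im z).
have := expR_ge0 (- `|complex.Im z|); have := expR_ge0 `|complex.Im z|; lra.
Qed.

Lemma normc_ccos_ge z : 1 <= `|complex.Im z| \/ sin (complex.Re z) = 0 ->
  expR `|complex.Im z| / 4 <= normc (ccos z).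
Proof.
rewrite /ccos normc_half => -[y1|c0].
  by have := gap_sum y1 (or_introl erefl); lra.
have -> : cexp ('i * z) + cexp (- ('i * z)) =
   (expR (complex.Im z) + expR (- complex.Im z))%:C * (cos (complex.Re z))%:C.
  rewrite /cexp !creN !cimN !Re_iM !Im_iM opprK cosN sinN c0.
  by apply: complex_eq; rewrite ?(creD, cimD, creN, cimN, Re_realM, Im_realM)/=; ring.
rewrite Normc.normcM !normc_real (sin0cos1 c0) mulr1.
rewrite (ger0_norm (addr_ge0 (expR_ge0 _) (expR_ge0 _))); have [_ _ <-] := expR_normP (complex.Im z).
have := expR_ge0 (- `|complex.Im z|); have := expR_ge0 `|complex.Im z|; lra.
Qed.

Lemma Im_realMr z s : complex.Im (z * s%:C) = complex.Im z * s.
Proof. by rewrite mulrC Im_realM mulrC. Qed.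

Lemma Re_realMr z s : complex.Re (z * s%:C) = complex.Re z * s.
Proof. by rewrite mulrC Re_realM mulrC. Qed.

(** The majorant of [cosl lam s] and of [rho * sinl lam s]. Being multiplicative in [s], it compares
    the products in the kernel with the main part at [pi]. *)
Definition growth lam s := expR (`|complex.Im (sqrtC lam)| * s).

Lemma growthD lam s t : growth lam (s + t) = growth lam s * growth lam t.
Proof. by rewrite /growth mulrDr expRD. Qed.

Lemma le_growth lam s t : s <= t -> growth lam s <= growth lam t.
Proof. by move=> st; rewrite ler_expR ler_wpM2l. Qed.

Lemma growth_gt0 lam s : 0 < growth lam s.
Proof. exact: expR_gt0. Qed.

Lemma normc_cosl_le lam s : 0 <= s -> normc (cosl lam s) <= growth lam s.
Proof.
move=> s0; apply: (le_trans (normc_ccos_le _)).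
by rewrite Im_realMr normrM (ger0_norm s0).
Qed.

Lemma normc_sinl_le lam s : lam != 0 -> 0 <= s ->
  normc (sinl lam s) * normc (sqrtC lam) <= growth lam s.
Proof.
move=> l0 s0; have r0 : sqrtC lam != 0 by rewrite sqrtC_eq0.
rewrite /sinl (negbTE l0) -Normc.normcM divfK//.
by apply: (le_trans (normc_csin_le _)); rewrite Im_realMr normrM (ger0_norm s0).
Qed.

Lemma normc_cosl_ge lam s : 0 <= s ->
  1 <= `|complex.Im (sqrtC lam)| * s \/ sin (complex.Re (sqrtC lam) * s) = 0 ->
  growth lam s / 4 <= normc (cosl lam s).
Proof.
move=> s0 h; have := @normc_ccos_ge (sqrtC lam * s%:C).
by rewrite Im_realMr Re_realMr normrM (ger0_norm s0); apply.
Qed.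

Lemma normc_sinl_ge lam s : lam != 0 -> 0 <= s ->
  1 <= `|complex.Im (sqrtC lam)| * s \/ cos (complex.Re (sqrtC lam) * s) = 0 ->
  growth lam s / 4 <= normc (sinl lam s) * normc (sqrtC lam).
Proof.
move=> l0 s0 h; have r0 : sqrtC lam != 0 by rewrite sqrtC_eq0.
rewrite /sinl (negbTE l0) -Normc.normcM divfK//.
have := @normc_csin_ge (sqrtC lam * s%:C).
by rewrite Im_realMr Re_realMr normrM (ger0_norm s0); apply.
Qed.

Lemma gauge_sqrtC lam (A : R) : 0 < A -> gauge lam = 2 * A ^+ 2 ->
  A <= normc (sqrtC lam) /\
  (`|complex.Im (sqrtC lam)| = A \/ `|complex.Re (sqrtC lam)| = A).
Proof.
move=> A0; rewrite /gauge -{1 2}(sqrtCK lam) normcX.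
set r := sqrtC lam; have -> : complex.Re (r ^+ 2) = complex.Re r ^+ 2 - complex.Im r ^+ 2.
  by rewrite expr2 creM -!expr2.
have nr : normc r ^+ 2 = complex.Re r ^+ 2 + complex.Im r ^+ 2.
  by rewrite normcE sqr_sqrtr// addr_ge0 ?sqr_ge0.
rewrite nr => h.
have main (x : R) : x ^+ 2 = A ^+ 2 -> `|x| = A.
  by move=> e; apply/eqP; rewrite -(@eqrXn2 _ 2)// ?ltW// real_normK ?num_real// e.
have h' : `|complex.Im r| = A \/ `|complex.Re r| = A.
  have [p|p] := lerP 0 (complex.Re r ^+ 2 - complex.Im r ^+ 2).
    by right; apply: main; move: h; rewrite (ger0_norm p); lra.
  by left; apply: main; move: h; rewrite (ltr0_norm p); lra.
split => //; case: h' => <-; [exact: ler_Im_normc|exact: ler_Re_normc].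
Qed.

Lemma sin_natpi n : sin (n%:R * pi : R) = 0.
Proof.
by rewrite mulr_natl -[pi *+ n]add0r (alternatingn (@sinDpi R)) sin0 mulr0.
Qed.

Lemma cos_half_natpi n : cos ((n%:R + 2^-1) * pi : R) = 0.
Proof.
rewrite mulrDl mulr_natl addrC (alternatingn (@cosDpi R)) mulrC.
by rewrite [_ * pi]mulrC cos_pihalf mul0r.
Qed.

(** On the sides with [|Im rho|] constant one exponential dominates; on those with [|Re rho|]
    constant the half-integer makes [cos (pi * Re rho)] vanish. For [cosl] integers play this
    role. *)
Lemma sinl_contour (n : nat) lam : gauge lam = 2 * (n.+1%:R + 2^-1) ^+ 2 ->
  n.+1%:R <= normc (sqrtC lam) /\
  growth lam pi / 4 <= normc (sinl lam pi) * normc (sqrtC lam).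
Proof.
have A0 : 0 < n.+1%:R + 2^-1 :> R by rewrite addr_gt0.
move=> /(gauge_sqrtC A0)[h1 h2].
have h3 : n.+1%:R <= normc (sqrtC lam) by apply: le_trans h1; rewrite lerDl.
split => //; apply: normc_sinl_ge; rewrite ?pi_ge0//.
  by rewrite -(sqrtC_eq0) -normc_gt0; apply: lt_le_trans h3.
case: h2 => h2; [left|right].
  rewrite h2; apply: (@le_trans _ _ (1 * pi)); first by have := pi_ge2 R; lra.
  by rewrite ler_wpM2r ?pi_ge0// ler_wpDr// ler1n.
by rewrite -(ger0_norm (pi_ge0 R)) -cos_norm normrM normr_id h2 ger0_norm ?pi_ge0// cos_half_natpi.
Qed.

Lemma cosl_contour (n : nat) lam : gauge lam = 2 * n.+1%:R ^+ 2 ->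
  n.+1%:R <= normc (sqrtC lam) /\ growth lam pi / 4 <= normc (cosl lam pi).
Proof.
move=> /(gauge_sqrtC (ltr0Sn R n))[h1 h2]; split => //.
apply: normc_cosl_ge; rewrite ?pi_ge0//.
case: h2 => h2; [left|right].
  rewrite h2; apply: (@le_trans _ _ (1 * pi)); first by have := pi_ge2 R; lra.
  by rewrite ler_wpM2r ?pi_ge0// ler1n.
case: (ler0P (complex.Re (sqrtC lam))) h2 => _ h2; last by rewrite h2 sin_natpi.
by apply: oppr_inj; rewrite -sinN -mulNr h2 sin_natpi oppr0.
Qed.

End ComplexTrigonometry.

(** * Integrals of complex-valued functions *)

Section ComplexIntegral.
Variable R : realType.
Local Notation mu := (@lebesgue_measure R).
Local Notation measurableR D := (measurable (D : set (measurableTypeR R))).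
Local Notation measurable_funR D f := (@measurable_fun _ _ (measurableTypeR R) R D f).
Implicit Types (D : set R) (f g k : R -> R[i]) (h : R -> R).

Definition cmeasurable D f := measurable_funR D (fun x => complex.Re (f x)) /\
  measurable_funR D (fun x => complex.Im (f x)).

Definition cintegrable D f := mu.-integrable D (EFin \o (fun x => complex.Re (f x))) /\
  mu.-integrable D (EFin \o (fun x => complex.Im (f x))).

Lemma integrable_bounded_mul D h (g : R -> R) (c : R) : measurableR D ->
  measurable_funR D h -> (forall x, D x -> `|h x| <= c) ->
  mu.-integrable D (EFin \o g) -> mu.-integrable D (EFin \o (fun x => h x * g x)).
Proof.
move=> mD mh hc ig; apply: (eq_integrable mD _ _ _ (integrableMr mD mh _ ig)) => //.
by exists c; split; [exact: num_real|move=> r rc x Dx /=; exact: le_trans (hc x Dx) (ltW rc)].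
Qed.

Lemma integrable_realD D (g h : R -> R) : measurableR D ->
  mu.-integrable D (EFin \o g) -> mu.-integrable D (EFin \o h) ->
  mu.-integrable D (EFin \o (fun x => g x + h x)).
Proof. by move=> mD ig ih; apply: (eq_integrable mD _ _ _ (integrableD mD ig ih)). Qed.

Lemma integrable_realB D (g h : R -> R) : measurableR D ->
  mu.-integrable D (EFin \o g) -> mu.-integrable D (EFin \o h) ->
  mu.-integrable D (EFin \o (fun x => g x - h x)).
Proof. by move=> mD ig ih; apply: (eq_integrable mD _ _ _ (integrableB mD ig ih)). Qed.

Lemma integrable_realZ D (g : R -> R) (c : R) : measurableR D ->
  mu.-integrable D (EFin \o g) -> mu.-integrable D (EFin \o (fun x => c * g x)).
Proof. by move=> mD ig; apply: (eq_integrable mD _ _ _ (integrableZl mD c ig)). Qed.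

Lemma cintegrableM D k f (c : R) : measurableR D -> cmeasurable D k ->
  (forall x, D x -> normc (k x) <= c) -> cintegrable D f ->
  cintegrable D (fun x => k x * f x).
Proof.
move=> mD [mR mI] kc [fR fI].
have cR x : D x -> `|complex.Re (k x)| <= c.
  by move=> /kc; apply: le_trans; exact: ler_Re_normc.
have cI x : D x -> `|complex.Im (k x)| <= c.
  by move=> /kc; apply: le_trans; exact: ler_Im_normc.
split.
  under [X in EFin \o X]eq_fun do rewrite creM.
  by apply: integrable_realB => //; apply: (@integrable_bounded_mul _ _ _ c).
under [X in EFin \o X]eq_fun do rewrite cimM.
by apply: integrable_realD => //; apply: (@integrable_bounded_mul _ _ _ c).
Qed.

Lemma cintegrableD D f g : measurableR D -> cintegrable D f -> cintegrable D g ->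
  cintegrable D (fun x => f x + g x).
Proof.
move=> mD [fR fI] [gR gI]; split.
  by under [X in EFin \o X]eq_fun do rewrite creD; exact: integrable_realD.
by under [X in EFin \o X]eq_fun do rewrite cimD; exact: integrable_realD.
Qed.

Lemma cintegrable0 D : measurableR D -> cintegrable D (fun=> 0).
Proof. by move=> mD; split; exact: integrable0. Qed.

Lemma cmeasurable_cst D (c : R[i]) : cmeasurable D (fun=> c).
Proof. by split; exact: measurable_cst. Qed.

Lemma cintegrableZ D f (c : R[i]) : measurableR D -> cintegrable D f ->
  cintegrable D (fun x => c * f x).
Proof. by move=> mD; exact: (cintegrableM mD (cmeasurable_cst D c) (fun _ _ => lexx _)). Qed.

Lemma cintegrableB D f g : measurableR D -> cintegrable D f -> cintegrable D g ->
  cintegrable D (fun x => f x - g x).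
Proof.
move=> mD hf hg; have := cintegrableD mD hf (cintegrableZ (-1) mD hg).
by congr cintegrable; apply/funext => x; rewrite mulN1r.
Qed.

Lemma cintegrableS D D' f : measurableR D -> measurableR D' -> D' `<=` D ->
  cintegrable D f -> cintegrable D' f.
Proof. by move=> mD mD' DD' [fR fI]; split; apply: (integrableS mD). Qed.

Lemma eq_cintegral D f g : (forall x, D x -> f x = g x) ->
  cintegral D f = cintegral D g.
Proof.
move=> fg; rewrite /cintegral; congr (_ +i* _); apply: eq_Rintegral => x;
  by rewrite inE => /fg ->.
Qed.

Lemma eq_cintegrable D f g : measurableR D -> (forall x, D x -> f x = g x) ->
  cintegrable D f -> cintegrable D g.
Proof.
move=> mD fg [fR fI]; split.
  by apply: (eq_integrable mD _ _ _ fR) => x; rewrite inE => /fg /= ->.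
by apply: (eq_integrable mD _ _ _ fI) => x; rewrite inE => /fg /= ->.
Qed.

Lemma cintegralD D f g : measurableR D -> cintegrable D f -> cintegrable D g ->
  cintegral D (fun x => f x + g x) = cintegral D f + cintegral D g.
Proof.
move=> mD [fR fI] [gR gI]; rewrite /cintegral; apply: complex_eq; rewrite /=.
  by under eq_Rintegral do rewrite creD; rewrite RintegralD.
by under eq_Rintegral do rewrite cimD; rewrite RintegralD.
Qed.

Lemma cintegralZ D f (c : R[i]) : measurableR D -> cintegrable D f ->
  cintegral D (fun x => c * f x) = c * cintegral D f.
Proof.
move=> mD [fR fI]; rewrite /cintegral; apply: complex_eq.
  rewrite creM /=; under eq_Rintegral do rewrite creM.
  by rewrite RintegralB ?RintegralZl//; exact: integrable_realZ.
rewrite cimM /=; under eq_Rintegral do rewrite cimM.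
by rewrite RintegralD ?RintegralZl//; exact: integrable_realZ.
Qed.

Lemma cintegralB D f g : measurableR D -> cintegrable D f -> cintegrable D g ->
  cintegral D (fun x => f x - g x) = cintegral D f - cintegral D g.
Proof.
move=> mD hf hg; under eq_cintegral do rewrite -mulN1r.
by rewrite cintegralD// ?cintegralZ// ?mulN1r//; exact: cintegrableZ.
Qed.

Lemma cintegral_sum D (F : nat -> R -> R[i]) N : measurableR D ->
  (forall n, cintegrable D (F n)) ->
  cintegrable D (fun x => \sum_(n < N) F n x) /\
  cintegral D (fun x => \sum_(n < N) F n x) = \sum_(n < N) cintegral D (F n).
Proof.
move=> mD hF; elim: N => [|N [IH1 IH2]].
  have -> : (fun x => \sum_(n < 0) F n x) = fun=> 0 by apply/funext => x; rewrite big_ord0.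
  split; first exact: cintegrable0.
  rewrite big_ord0 /cintegral /=.
  by apply: complex_eq; rewrite /= /Rintegral integral0.
have -> : (fun x => \sum_(n < N.+1) F n x) = (fun x => \sum_(n < N) F n x + F N x).
  by apply/funext => x; rewrite big_ord_recr.
by split; [exact: cintegrableD|rewrite cintegralD// big_ord_recr IH2].
Qed.

(** [|Re| + |Im|] instead of the modulus: its integrability is immediate from the two parts.
    Bounding the two parts of an integral separately costs the factor 2 in [normc_cintegral_le]. *)
Definition L1norm D f : R := \int[mu]_(x in D) (`|complex.Re (f x)| + `|complex.Im (f x)|).

Lemma L1norm_ge0 D f : 0 <= L1norm D f.
Proof. by apply: Rintegral_ge0 => x _; rewrite addr_ge0. Qed.

Lemma normc_cintegral_le D k f (c : R) : measurableR D -> cintegrable D f ->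
  cintegrable D (fun x => k x * f x) ->
  (forall x, D x -> normc (k x) <= c) ->
  normc (cintegral D (fun x => k x * f x)) <= 2 * (c * L1norm D f).
Proof.
move=> mD [fR fI] [kfR kfI] kc.
have iL : mu.-integrable D (EFin \o (fun x => c * (`|complex.Re (f x)| + `|complex.Im (f x)|))).
  apply: (integrable_realZ c mD); apply: integrable_realD => //.
    exact: (integrable_norm fR).
  exact: (integrable_norm fI).
have bd h : mu.-integrable D (EFin \o h) -> (forall x, D x -> `|h x| <= normc (k x * f x)) ->
    `|\int[mu]_(x in D) h x| <= c * L1norm D f.
  move=> ih hh; apply: (le_trans (le_normr_Rintegral mD ih)).
  rewrite /L1norm -RintegralZl//; last first.
    by apply: integrable_realD => //; [exact: (integrable_norm fR)|exact: (integrable_norm fI)].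
  apply: le_Rintegral => //; first exact: (integrable_norm ih).
  move=> x Dx; apply: (le_trans (hh x Dx)); rewrite Normc.normcM.
  by apply: ler_pM (normc_ge0 _) (normc_ge0 _) (kc x Dx) (ler_normc_ReIm _).
apply: (le_trans (ler_normc_ReIm _)); rewrite mulr_natl mulr2n.
by apply: lerD; apply: bd => // x _; [exact: ler_Re_normc|exact: ler_Im_normc].
Qed.

Lemma gsum_cmeasurable D (a : nat -> R -> R[i]) f :
  (forall n, cmeasurable D (a n)) -> (forall x, D x -> gsum (a^~ x) (f x)) ->
  cmeasurable D f.
Proof.
move=> ma af.
have cv (P : R[i] -> R) : (forall z, `|P z| <= normc z) ->
    (forall z w, P (z - w) = P z - P w) -> forall x, D x ->
    (fun N => P (\sum_(n < N) a n x)) @ \oo --> P (f x).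
  move=> Pn PB x Dx; have [M hM] := af x Dx.
  apply/cvgrPdist_le => e e0; near=> N.
  rewrite -PB (le_trans (Pn _))// (le_trans (hM N))//.
  rewrite ler_pdivrMr ?exprn_gt0// mulrC -ler_pdivrMr//.
  rewrite (@le_trans _ _ N%:R)//; last by rewrite -natrX ler_nat ltnW// ltn_expl.
  near: N; exact: nbhs_infty_ger.
split.
  apply: (measurable_fun_cvg (h := fun N x => complex.Re (\sum_(n < N) a n x))).
    move=> N; under eq_fun do rewrite Re_sum; apply: measurable_sum => n.
    by have [] := ma n.
  by apply: cv => [z|z w]; [exact: ler_Re_normc|rewrite creD creN].
apply: (measurable_fun_cvg (h := fun N x => complex.Im (\sum_(n < N) a n x))).
  move=> N; under eq_fun do rewrite Im_sum; apply: measurable_sum => n.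
  by have [] := ma n.
by apply: cv => [z|z w]; [exact: ler_Im_normc|rewrite cimD cimN].
Unshelve. all: by end_near. Qed.

(** The constant in [gsum] is existential. This one is explicit, hence uniform for a family of
    series with a common bound. *)
Lemma gsum_tail (a : nat -> R[i]) l (M : R) : (forall n, normc (a n) <= M / 2 ^+ n) ->
  gsum a l -> forall N, normc (l - \sum_(i < N) a i) <= 2 * (M / 2 ^+ N).
Proof.
move=> ha hl N.
have : gsum (fun n => a (N + n)%N) (l - \sum_(i < N) a i).
  elim: N => [|N IH]; first by rewrite big_ord0 subr0; exact: eq_gsum hl.
  rewrite big_ord_recr opprD addrA; have := gsum_shift IH; rewrite addn0.
  by apply: eq_gsum => n; rewrite addnS addSn.
by apply: gsum_bound => n; rewrite -mulrA -invfM -exprD.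
Qed.

(** Termwise integration without a limit theorem: the tails are bounded geometrically and uniformly
    on [D], so the integral of a tail times [f] is at most a constant times [2 ^- N]. The full
    product is integrable because [K z] is bounded, and measurable as a limit of partial sums. *)
Lemma power_series_cintegral D (k : nat -> R -> R) (K : R[i] -> R -> R[i]) f :
  measurableR D -> (forall n, measurable_funR D (k n)) ->
  (forall r : R, 0 < r -> exists M, forall n x, D x -> `|k n x| * r ^+ n <= M) ->
  (forall z x, D x -> gsum (fun n => (k n x)%:C * z ^+ n) (K z x)) ->
  cintegrable D f ->
  (forall z, cintegrable D (fun x => K z x * f x)) /\
  power_series (fun n => cintegral D (fun x => (k n x)%:C * f x))
    (fun z => cintegral D (fun x => K z x * f x)).
Proof.
move=> mD mk hk hK hf.
have mkc z n : cmeasurable D (fun x => (k n x)%:C * z ^+ n).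
  split.
    by under eq_fun do rewrite Re_realM; apply: measurable_funM => //; exact: measurable_cst.
  by under eq_fun do rewrite Im_realM; apply: measurable_funM => //; exact: measurable_cst.
have term z : exists2 M : R, 0 <= M & forall n x, D x -> normc ((k n x)%:C * z ^+ n) <= M / 2 ^+ n.
  have r0 : 0 < 2 * normc z + 1 by rewrite ltr_wpDl// mulr_ge0// normc_ge0.
  have [M hM] := hk _ r0; exists (Num.max M 0); first by rewrite le_max lexx orbT.
  move=> n x Dx; rewrite Normc.normcM normc_real normcX ler_pdivlMr ?exprn_gt0// -mulrA -exprMn.
  rewrite le_max; apply/orP; left; apply: le_trans (hM n x Dx).
  by rewrite ler_wpM2l// lerXn2r ?nnegrE ?mulr_ge0 ?normc_ge0// ?(ltW r0)// mulrC lerDl.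
have iK z : cintegrable D (fun x => K z x * f x).
  have [M M0 hM] := term z.
  apply: (@cintegrableM _ _ _ (2 * M)) => //.
    exact: (gsum_cmeasurable (mkc z) (hK z)).
  by move=> x Dx; apply: gsum_bound (hK z x Dx) => n; exact: hM.
have ik n : cintegrable D (fun x => (k n x)%:C * f x).
  have [M hM] := hk 1 ltr01; apply: (@cintegrableM _ _ _ M) => //.
    by split; [exact: mk|exact: (measurable_cst (0 : R))].
  by move=> x Dx; rewrite normc_real; have := hM n x Dx; rewrite expr1n mulr1.
split => //; split => [r r0|z].
  have [M hM] := hk r r0; exists (2 * (M * L1norm D f)) => n.
  rewrite -ler_pdivlMr ?exprn_gt0//.
  have -> : 2 * (M * L1norm D f) / r ^+ n = 2 * (M / r ^+ n * L1norm D f) by ring.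
  apply: normc_cintegral_le => // x Dx.
  by rewrite normc_real ler_pdivlMr ?exprn_gt0// hM.
have [M M0 hM] := term z; exists (4 * (M * L1norm D f)) => N.
have iS := cintegral_sum N mD (fun n => cintegrableZ (z ^+ n) mD (ik n)).
have -> : \sum_(i < N) cintegral D (fun x => (k i x)%:C * f x) * z ^+ i =
    cintegral D (fun x => \sum_(n < N) z ^+ n * ((k n x)%:C * f x)).
  by rewrite iS.2; apply: eq_bigr => n _; rewrite cintegralZ// mulrC.
rewrite -cintegralB//; last exact: iS.1.
have e x : K z x * f x - \sum_(n < N) z ^+ n * ((k n x)%:C * f x) =
    (K z x - \sum_(n < N) (k n x)%:C * z ^+ n) * f x.
  by rewrite mulrBl mulr_suml; congr (_ - _); apply: eq_bigr => n _; ring.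
under eq_cintegral do rewrite e.
have -> : 4 * (M * L1norm D f) / 2 ^+ N = 2 * (2 * (M / 2 ^+ N) * L1norm D f) by ring.
apply: normc_cintegral_le => //.
  apply: (eq_cintegrable mD (fun x _ => e x)); apply: cintegrableB => //; exact: iS.1.
by move=> x Dx; exact: gsum_tail (fun n => hM n x Dx) (hK z x Dx) N.
Qed.

(** Pointwise [|x| <= 1 + (x ^+ 2 + y ^+ 2)], and the finite measure makes the constant
    integrable. *)
Lemma L2c_cintegrable D f : measurableR D -> (mu D < +oo)%E -> L2c D f -> cintegrable D f.
Proof.
move=> mD muD [mR mI i2].
have i1 : mu.-integrable D (EFin \o (fun x => 1 + (complex.Re (f x) ^+ 2 + complex.Im (f x) ^+ 2))).
  apply: integrable_realD => //; apply: measurable_bounded_integrable => //.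
  by exists 1; split; [exact: num_real|move=> r r1 x Dx /=; rewrite normr1 ltW].
have le1 (x y : R) : `|x| <= 1 + (x ^+ 2 + y ^+ 2).
  have := sqr_ge0 (`|x| - 1); have := sqr_ge0 y.
  by rewrite -(real_normK (num_real x)) !expr2; nra.
have n1 (x y : R) : `|1 + (x ^+ 2 + y ^+ 2)| = 1 + (x ^+ 2 + y ^+ 2).
  by rewrite ger0_norm// !addr_ge0 ?sqr_ge0.
split; apply: (le_integrable mD _ _ i1).
- exact/measurable_EFinP.
- by move=> x Dx /=; rewrite lee_fin n1.
- exact/measurable_EFinP.
- by move=> x Dx /=; rewrite lee_fin n1 [X in 1 + X]addrC.
Qed.

End ComplexIntegral.

(** * The characteristic function *)

Section CharacteristicFunction.
Variable R : realType.
Local Notation mu := (@lebesgue_measure R).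
Local Notation measurableR D := (measurable (D : set (measurableTypeR R))).
Local Notation measurable_funR D f := (@measurable_fun _ _ (measurableTypeR R) R D f).
Implicit Types (q f : R -> R[i]) (lam : R[i]) (a t s x y : R) (alpha beta : bool).

Lemma measurable_oo x y : measurableR `]x, y[.
Proof. exact: measurable_itv. Qed.
#[local] Hint Resolve measurable_oo : core.

Lemma cintegral_bndoo x y f (b0 b1 : bool) : cintegrable `]x, y[ f ->
  cintegral [set` Interval (BSide b0 x) (BSide b1 y)] f = cintegral `]x, y[ f.
Proof.
move=> [fR fI]; rewrite /cintegral; congr (_ +i* _); congr fine;
  apply: integral_itv_bndoo; exact: (measurable_int mu).
Qed.

Lemma cintegral_split x y s f : x < s <= y -> cintegrable `]x, y[ f ->
  cintegral `]x, y[ f = cintegral `]x, s[ f + cintegral `]s, y[ f.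
Proof.
move=> /andP[xs sy] hf.
have s1 : `]x, s[ `<=` `]x, y[ by apply: subset_itvl; rewrite bnd_simp.
have s2 : `]s, y[ `<=` `]x, y[ by apply: subset_itvr; rewrite bnd_simp ltW.
have h1 := cintegrableS (measurable_oo _ _) (measurable_oo _ _) s1 hf.
have h2 := cintegrableS (measurable_oo _ _) (measurable_oo _ _) s2 hf.
rewrite -(cintegral_bndoo true false h2).
have [sy'|ys] := ltP s y; last first.
  have sE : s = y by apply/le_anti; rewrite sy ys.
  rewrite sE (cintegral_bndoo true false); last by rewrite -{1}sE.
  by rewrite set_itvoo0 /cintegral !Rintegral_set0 complexr0 addr0.
rewrite (cintegral_bndoo true false h2) -(cintegral_bndoo true true h2).
have U : `]x, y[%classic = `]x, s[ `|` `[s, y[ :> set R.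
  by rewrite -itv_bndbnd_setU// bnd_simp ltW.
have dj : [disjoint `]x, s[%classic & `[s, y[%classic : set R].
  apply/disj_setPS => z [] /=; rewrite !in_itv/= => /andP[_ zs] /andP[/(lt_le_trans zs)].
  by rewrite ltxx.
have [fR fI] := hf; rewrite /cintegral U; apply: complex_eq => /=.
  by rewrite Rintegral_setU//; rewrite -U.
by rewrite Rintegral_setU//; rewrite -U.
Qed.

Lemma measurable_mono n (D : set R) (g : R -> R) : measurable_funR D g ->
  measurable_funR D (fun t => cos_mono n (g t)) /\
  measurable_funR D (fun t => sin_mono n (g t)).
Proof.
move=> mg; have mM (c d : R) j : measurable_funR D (fun t => c * g t ^+ j / d).
  apply: measurable_funM; last exact: measurable_cst.
  by apply: measurable_funM; [exact: measurable_cst|exact: measurable_funX].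
by split; exact: mM.
Qed.

(** With [rho = max 1 r] and [n <= j] the left side is at most [(rho * pi) ^ j / j!], a term of the
    series of [exp (rho * pi)]. [power_series_cintegral] asks for such a bound, independent of [n]
    and [s]. *)
Lemma mono_bound s r (n j : nat) : `|s| <= pi -> 0 < r -> (n <= j)%N ->
  `|(-1) ^+ n * s ^+ j / j`!%:R| * r ^+ n <= expR (Num.max 1 r * pi).
Proof.
move=> sp r0 nj; rewrite normrM normrM normrX normrN1 expr1n mul1r normfV normr_nat normrX.
set rho := Num.max 1 r; have rho1 : 1 <= rho by rewrite le_max lexx.
have rho0 : 0 < rho by apply: lt_le_trans rho1.
apply: (@le_trans _ _ ((rho * pi) ^+ j / j`!%:R)); last first.
  by apply: expR_ge_term; rewrite mulr_ge0 ?pi_ge0 ?ltW.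
rewrite mulrAC ler_wpM2r// exprMn mulrC; apply: ler_pM => //; rewrite ?exprn_ge0 ?(ltW r0)//.
  apply: (@le_trans _ _ (rho ^+ n)).
    by rewrite lerXn2r ?nnegrE ?(ltW r0) ?(ltW rho0)// le_max lexx orbT.
  exact: ler_weXn2l.
by rewrite lerXn2r ?nnegrE ?pi_ge0.
Qed.

Lemma cos_mono_bound s r n : `|s| <= pi -> 0 < r ->
  `|cos_mono n s| * r ^+ n <= expR (Num.max 1 r * pi).
Proof. by move=> sp r0; apply: mono_bound => //; rewrite -addnn leq_addr. Qed.

Lemma sin_mono_bound s r n : `|s| <= pi -> 0 < r ->
  `|sin_mono n s| * r ^+ n <= expR (Num.max 1 r * pi).
Proof.
by move=> sp r0; apply: mono_bound => //; rewrite -addnn ltnW// ltnS leq_addr.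
Qed.

Lemma cos_monoS_bound s r n : `|s| <= pi -> 0 < r ->
  `|cos_mono n.+1 s| * r ^+ n <= expR (Num.max 1 r * pi).
Proof.
move=> sp r0; have := @mono_bound s r n n.+1.*2 sp r0.
rewrite /cos_mono exprS mulN1r mulNr mulNr normrN; apply.
by rewrite doubleS -addnn ltnW// ltnW// !ltnS leq_addr.
Qed.

Lemma cintegrable_cosl_sinl x y (b : R) f lam :
  (forall t, x < t < y -> `|b - t| <= pi) -> cintegrable `]x, y[ f ->
  cintegrable `]x, y[ (fun t => cosl lam (b - t) * f t) /\
  cintegrable `]x, y[ (fun t => sinl lam (b - t) * f t).
Proof.
move=> hb hf.
have mg : measurable_funR (`]x, y[%classic : set R) (fun t => b - t).
  by apply: measurable_funB; [exact: measurable_cst|exact: measurable_id].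
split.
  have [|r r0|z t _||h _] := @power_series_cintegral R `]x, y[
    (fun n t => cos_mono n (b - t)) (fun z t => cosl z (b - t)) f (measurable_oo _ _).
  - by move=> n; have [] := measurable_mono n mg.
  - exists (expR (Num.max 1 r * pi)) => n t; rewrite /= in_itv/= => /hb bt.
    exact: cos_mono_bound.
  - exact: gsum_cosl.
  - by [].
  - exact: h.
have [|r r0|z t _||h _] := @power_series_cintegral R `]x, y[
  (fun n t => sin_mono n (b - t)) (fun z t => sinl z (b - t)) f (measurable_oo _ _).
- by move=> n; have [] := measurable_mono n mg.
- exists (expR (Num.max 1 r * pi)) => n t; rewrite /= in_itv/= => /hb bt.
  exact: sin_mono_bound.
- exact: gsum_sinl.
- by [].
- exact: h.
Qed.

(** The factor of [q t] in [Delta]. For [t < a] it comes from [C] at 0, whose integral runs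
    backwards from [a] to 0, and for [t > a] from [C] at [pi], which [Delta] subtracts; hence the
    common sign. *)
Definition kernel alpha beta a lam t : R[i] :=
  - (if t < a
     then Sder beta a pi lam * (if alpha then cosl lam (0 - t) else sinl lam (0 - t))
     else Sder alpha a 0 lam * (if beta then cosl lam (pi - t) else sinl lam (pi - t))).

(** The characteristic function for [q = 0], after the addition formulas have removed [a]. *)
Definition main_part alpha beta lam : R[i] :=
  if alpha then (if beta then lam * sinl lam pi else - cosl lam pi)
  else (if beta then cosl lam pi else sinl lam pi).

Lemma sinlD lam s t :
  sinl lam (s + t) = sinl lam s * cosl lam t + cosl lam s * sinl lam t.
Proof.
rewrite [cosl _ _ * _]mulrC !sinl_cosl [t + s]addrC -(opprB s t) sinlN; by field.
Qed.

Lemma coslD lam s t :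
  cosl lam (s + t) = cosl lam s * cosl lam t - lam * (sinl lam s * sinl lam t).
Proof. by rewrite sinl_sinl cosl_cosl; field. Qed.

Lemma main_partE alpha beta a lam :
  (if alpha then - lam * sinl lam (0 - a) else cosl lam (0 - a)) * Sder beta a pi lam
  - Sder alpha a 0 lam * (if beta then - lam * sinl lam (pi - a) else cosl lam (pi - a))
  = main_part alpha beta lam.
Proof.
have pE : pi = a + (pi - a) :> R by rewrite addrC subrK.
have sE : sinl lam pi = sinl lam a * cosl lam (pi - a) + cosl lam a * sinl lam (pi - a).
  by rewrite {1}pE sinlD.
have cE : cosl lam pi = cosl lam a * cosl lam (pi - a) - lam * (sinl lam a * sinl lam (pi - a)).
  by rewrite {1}pE coslD.
rewrite /main_part /Sder /Sf /Sd !sub0r !sinlN !coslN.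
by case: alpha; case: beta => /=; rewrite ?sE ?cE; ring.
Qed.

Lemma Delta_kernel alpha beta q a lam : 0 < a <= pi ->
  cintegrable `]0, pi[ q ->
  cintegrable `]0, pi[ (fun t => kernel alpha beta a lam t * q t) ->
  Delta q a alpha beta lam = main_part alpha beta lam
    + cintegral `]0, pi[ (fun t => kernel alpha beta a lam t * q t).
Proof.
move=> /andP[a0 api] hq hk.
have s1 : (`]0, a[%classic : set R) `<=` `]0, pi[ by apply: subset_itvl; rewrite bnd_simp.
have s2 : (`]a, pi[%classic : set R) `<=` `]0, pi[ by apply: subset_itvr; rewrite bnd_simp ltW.
have hq1 := cintegrableS (measurable_oo _ _) (measurable_oo _ _) s1 hq.
have hq2 := cintegrableS (measurable_oo _ _) (measurable_oo _ _) s2 hq.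
have b1 t : 0 < t < a -> `|0 - t| <= pi.
  by move=> /andP[t0 ta]; rewrite sub0r normrN gtr0_norm// ltW// (lt_le_trans ta).
have b2 t : a < t < pi -> `|pi - t| <= pi.
  by move=> /andP[at_ tp]; rewrite ler_norml; apply/andP; split; lra.
have [c1 d1] := cintegrable_cosl_sinl lam b1 hq1.
have [c2 d2] := cintegrable_cosl_sinl lam b2 hq2.
pose F0 t := (if alpha then cosl lam (0 - t) else sinl lam (0 - t)) * q t.
pose F1 t := (if beta then cosl lam (pi - t) else sinl lam (pi - t)) * q t.
have i0 : cintegrable `]0, a[ F0 by rewrite /F0; case: (alpha).
have i1 : cintegrable `]a, pi[ F1 by rewrite /F1; case: (beta).
have -> : Delta q a alpha beta lam =
   ((if alpha then - lam * sinl lam (0 - a) else cosl lam (0 - a)) - cintegral `]0, a[ F0)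
     * Sder beta a pi lam
   - Sder alpha a 0 lam *
     ((if beta then - lam * sinl lam (pi - a) else cosl lam (pi - a)) + cintegral `]a, pi[ F1).
  rewrite /Delta -(cintegral_bndoo true false i0) -(cintegral_bndoo true false i1) /F0 /F1.
  rewrite /Cder /Cd /Cf /oint leNgt a0 /= api.
  by case: (alpha); case: (beta).
rewrite -(main_partE alpha beta a) (cintegral_split (s := a) _ hk) ?a0//.
have -> : cintegral `]0, a[ (fun t => kernel alpha beta a lam t * q t) =
    - Sder beta a pi lam * cintegral `]0, a[ F0.
  rewrite -cintegralZ//; apply: eq_cintegral => t /=; rewrite in_itv/= => /andP[_ ta].
  by rewrite /kernel ta /F0; ring.
have -> : cintegral `]a, pi[ (fun t => kernel alpha beta a lam t * q t) =
    - Sder alpha a 0 lam * cintegral `]a, pi[ F1.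
  rewrite -cintegralZ//; apply: eq_cintegral => t /=; rewrite in_itv/= => /andP[ta _].
  have tF : (t < a) = false by apply/negbTE; rewrite -leNgt ltW.
  by rewrite /kernel tF /F1; ring.
ring.
Qed.

(** Taylor coefficients of [kernel] in [lam], in the form given by the product-to-sum formulas. *)
Definition kernel_coef alpha beta a n t : R :=
  if alpha then
    if beta then - ((cos_mono n (pi - a - t) + cos_mono n (pi - `|a - t|)) / 2)
    else - ((sin_mono n (pi - a - t) + sin_mono n (pi - `|a - t|)) / 2)
  else
    if beta then (sin_mono n (pi - `|a - t|) - sin_mono n (pi - a - t)) / 2
    else (cos_mono n.+1 (pi - a - t) - cos_mono n.+1 (pi - `|a - t|)) / 2.

(* For [alpha = beta = 0] the factor [lam] is kept, since [1 / lam] would be a junk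
   value at [lam = 0]; it shifts the cosine coefficients by one in [kernel_coef]. *)
Lemma kernelE alpha beta a lam t :
  let A := pi - a - t in let B := pi - `|a - t| in
  if alpha then
    if beta then kernel alpha beta a lam t = - ((cosl lam A + cosl lam B) / 2)
    else kernel alpha beta a lam t = - ((sinl lam A + sinl lam B) / 2)
  else
    if beta then kernel alpha beta a lam t = (sinl lam B - sinl lam A) / 2
    else lam * kernel alpha beta a lam t = (cosl lam A - cosl lam B) / 2.
Proof.
rewrite /kernel /Sder /Sf /Sd !sub0r; case: ltP => ta.
  rewrite (gtr0_norm (_ : 0 < a - t)) ?subr_gt0// (_ : pi - (a - t) = pi - a + t); last by ring.
  case: alpha; case: beta => /=; rewrite ?sinlN ?coslN ?mulrN ?opprK.
  - by rewrite cosl_cosl; congr (- _); field.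
  - by rewrite sinl_cosl; congr (- _); field.
  - rewrite mulrC sinl_cosl [t + _]addrC -(opprB (pi - a) t) sinlN; by field.
  - by rewrite sinl_sinl.
rewrite ler0_norm ?subr_le0// (_ : pi - - (a - t) = pi - t + a); last by ring.
have -> : pi - a - t = pi - t - a by rewrite addrAC.
case: alpha; case: beta => /=; rewrite ?sinlN ?coslN ?mulNr ?mulrN ?opprK.
- by rewrite mulrC cosl_cosl; congr (- _); field.
- by rewrite mulrC sinl_cosl; congr (- _); field.
- rewrite sinl_cosl [a + _]addrC -(opprB (pi - t) a) sinlN; by field.
- by rewrite [sinl _ a * _]mulrC sinl_sinl.
Qed.

Let avgC x y : ((x + y) / 2)%:C = (x%:C + y%:C) / 2 :> R[i].
Proof. by rewrite rmorphM rmorphD fmorphV rmorph_nat. Qed.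

Let avgCN x y : (- ((x + y) / 2))%:C = - ((x%:C + y%:C) / 2) :> R[i].
Proof. by rewrite -avgC rmorphN. Qed.

Let avgCB x y : ((x - y) / 2)%:C = (x%:C - y%:C) / 2 :> R[i].
Proof. by rewrite rmorphM rmorphB fmorphV rmorph_nat. Qed.

Let cos_mono1 s : cos_mono 1 s = - (s ^+ 2 / 2).
Proof. by rewrite /cos_mono expr1 mulN1r mulNr. Qed.

Lemma gsum_kernel alpha beta a lam t :
  gsum (fun n => (kernel_coef alpha beta a n t)%:C * lam ^+ n) (kernel alpha beta a lam t).
Proof.
rewrite /kernel_coef; have := kernelE alpha beta a lam t => /=.
set A := pi - a - t; set B := pi - `|a - t|.
case: alpha; case: beta => h; rewrite ?h.
- have := gsumZ (- 2^-1) (gsumD (gsum_cosl lam A) (gsum_cosl lam B)).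
  rewrite mulNr mulrC; apply: eq_gsum => n.
  by rewrite avgCN; ring.
- have := gsumZ (- 2^-1) (gsumD (gsum_sinl lam A) (gsum_sinl lam B)).
  rewrite mulNr mulrC; apply: eq_gsum => n.
  by rewrite avgCN; ring.
- have := gsumZ (2^-1) (gsumD (gsum_sinl lam B) (gsumZ (-1) (gsum_sinl lam A))).
  rewrite mulN1r mulrC; apply: eq_gsum => n.
  by rewrite avgCB; ring.
(* At [lam = 0] only the zeroth coefficient counts, and it is compared with a product of two linear
   values of [sinl]. Elsewhere the constant terms of the two cosine series cancel, and dividing by
   [lam] shifts the indices. *)
have [l0|l0] := eqVneq lam 0.
  rewrite l0; apply: eq_gsum ((power_series_cst (kernel false false a 0 t)).2 0) => -[|n]; last first.
    by rewrite mul0r expr0n/= mulr0.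
  rewrite !expr0 !mulr1 /kernel /Sder /Sf /= /sinl eqxx !cos_mono1 !sub0r.
  rewrite -!(rmorphM, rmorphN) /A /B -complexr0.
  case: ltP => ta; rewrite -!(rmorphM, rmorphN) /=; congr (_%:C).
    by rewrite (gtr0_norm (_ : 0 < a - t)) ?subr_gt0//; field.
  by rewrite ler0_norm ?subr_le0//; field.
have -> : kernel false false a lam t = lam^-1 * ((cosl lam A - cosl lam B) / 2).
  by rewrite -h mulKf.
have := gsumZ (lam^-1 / 2) (gsum_shift (gsumD (gsum_cosl lam A) (gsumZ (-1) (gsum_cosl lam B)))).
have -> : lam^-1 / 2 * (cosl lam A + -1 * cosl lam B -
    ((cos_mono 0 A)%:C * lam ^+ 0 + -1 * ((cos_mono 0 B)%:C * lam ^+ 0))) =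
    lam^-1 * ((cosl lam A - cosl lam B) / 2).
  by rewrite /cos_mono !expr0; ring.
apply: eq_gsum => n; rewrite avgCB exprS.
by field.
Qed.

Section Kernel.
Variables (alpha beta : bool) (a : R).
Hypothesis (a0 : 0 < a) (api : a <= pi).

Let in0pi t : (`]0, pi[%classic : set R) t -> `|pi - a - t| <= pi /\ `|pi - `|a - t| | <= pi.
Proof.
rewrite /= in_itv/= => /andP[t0 tp].
have ap := api; have a1 := a0.
split; first by rewrite ler_norml; apply/andP; split; lra.
by have [h|h] := lerP 0 (a - t); [rewrite (ger0_norm h)|rewrite (ltr0_norm h)];
  rewrite ler_norml; apply/andP; split; lra.
Qed.

Lemma measurable_kernel_coef n : measurable_funR (`]0, pi[%classic : set R) (kernel_coef alpha beta a n).
Proof.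
have mA : measurable_funR (`]0, pi[%classic : set R) (fun t => pi - a - t).
  by apply: measurable_funB; [exact: measurable_cst|exact: measurable_id].
have mB : measurable_funR (`]0, pi[%classic : set R) (fun t => pi - `|a - t|).
  apply: measurable_funB; first exact: measurable_cst.
  apply: (@measurableT_comp _ _ _ _ _ _ (@Num.Def.normr _ R)); first exact: normr_measurable.
  by apply: measurable_funB; [exact: measurable_cst|exact: measurable_id].
have [cA sA] := measurable_mono n mA; have [cB sB] := measurable_mono n mB.
have [cA' _] := measurable_mono n.+1 mA; have [cB' _] := measurable_mono n.+1 mB.
rewrite /kernel_coef; case: (alpha); case: (beta).
- apply: measurableT_comp; first exact: oppr_measurable.
  by apply: measurable_funM; [exact: measurable_funD|exact: measurable_cst].
- apply: measurableT_comp; first exact: oppr_measurable.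
  by apply: measurable_funM; [exact: measurable_funD|exact: measurable_cst].
- by apply: measurable_funM; [exact: measurable_funB|exact: measurable_cst].
- by apply: measurable_funM; [exact: measurable_funB|exact: measurable_cst].
Qed.

Lemma kernel_coef_bound r : 0 < r ->
  exists M, forall n t, (`]0, pi[%classic : set R) t -> `|kernel_coef alpha beta a n t| * r ^+ n <= M.
Proof.
move=> r0; exists (expR (Num.max 1 r * pi)) => n t /in0pi[hA hB].
have avgD (x y : R) : `|(x + y) / 2| * r ^+ n <= (`|x| * r ^+ n + `|y| * r ^+ n) / 2.
  rewrite normrM (ger0_norm (_ : 0 <= 2^-1))// -mulrDl mulrAC ler_wpM2r//.
  by rewrite ler_wpM2r ?exprn_ge0 ?(ltW r0)// ler_normD.
have avgB (x y : R) : `|(x - y) / 2| * r ^+ n <= (`|x| * r ^+ n + `|y| * r ^+ n) / 2.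
  by rewrite -(normrN y).
rewrite /kernel_coef; case: (alpha); case: (beta); rewrite ?normrN.
- apply: (le_trans (avgD _ _)).
  by have := cos_mono_bound n hA r0; have := cos_mono_bound n hB r0; lra.
- apply: (le_trans (avgD _ _)).
  by have := sin_mono_bound n hA r0; have := sin_mono_bound n hB r0; lra.
- apply: (le_trans (avgB _ _)).
  by have := sin_mono_bound n hA r0; have := sin_mono_bound n hB r0; lra.
- apply: (le_trans (avgB _ _)).
  by have := cos_monoS_bound n hA r0; have := cos_monoS_bound n hB r0; lra.
Qed.

Lemma kernel_cintegral f : cintegrable `]0, pi[ f ->
  (forall lam, cintegrable `]0, pi[ (fun t => kernel alpha beta a lam t * f t)) /\
  power_series (fun n => cintegral `]0, pi[ (fun t => (kernel_coef alpha beta a n t)%:C * f t))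
    (fun lam => cintegral `]0, pi[ (fun t => kernel alpha beta a lam t * f t)).
Proof.
apply: power_series_cintegral => //.
- exact: measurable_kernel_coef.
- exact: kernel_coef_bound.
- by move=> z t _; exact: gsum_kernel.
Qed.

Lemma entire_cosl : entire (fun z : R[i] => cosl z pi).
Proof.
exists (fun n => (cos_mono n pi)%:C); split => [r r0|z]; last exact: gsum_cosl.
exists (expR (Num.max 1 r * pi)) => n; rewrite normc_real.
by apply: cos_mono_bound => //; rewrite ger0_norm ?pi_ge0.
Qed.

Lemma entire_sinl : entire (fun z : R[i] => sinl z pi).
Proof.
exists (fun n => (sin_mono n pi)%:C); split => [r r0|z]; last exact: gsum_sinl.
exists (expR (Num.max 1 r * pi)) => n; rewrite normc_real.
by apply: sin_mono_bound => //; rewrite ger0_norm ?pi_ge0.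
Qed.

Lemma entire_mulz g : entire g -> entire (fun z : R[i] => z * g z).
Proof.
move=> [c [rc hc]]; exists (fun n => if n is m.+1 then c m else 0); split => [r r0|z].
  have [M hM] := rc r r0; exists (M * r) => -[|n].
    rewrite Normc.normc0 mul0r mulr_ge0 ?(ltW r0)//; exact: coef_bound_ge0 hM.
  by rewrite exprSr mulrA ler_wpM2r ?(ltW r0).
have [M hM] := gsumZ z (hc z); exists (normc (z * g z) + 2 * M) => -[|N].
  rewrite big_ord0 subr0 divr1 lerDl mulr_ge0//.
  by have := hM 0%N; rewrite divr1; apply: le_trans; exact: normc_ge0.
rewrite big_ord_recl/= mul0r add0r.
under eq_bigr do rewrite exprS mulrCA.
apply: (le_trans (hM N)); rewrite exprS invfM mulrA ler_wpM2r ?invr_ge0 ?exprn_ge0//.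
by rewrite mulrDl mulrAC mulfV// mul1r lerDr divr_ge0 ?normc_ge0.
Qed.

Lemma entire_main_part : entire (main_part alpha beta : R[i] -> R[i]).
Proof.
rewrite /main_part; case: (alpha); case: (beta).
- exact/entire_mulz/entire_sinl.
- have := entireB (entire_cst 0) entire_cosl.
  by congr entire; apply/funext => z; rewrite sub0r.
- exact: entire_cosl.
- exact: entire_sinl.
Qed.

Lemma DeltaE q : cintegrable `]0, pi[ q ->
  forall lam, Delta q a alpha beta lam = main_part alpha beta lam
    + cintegral `]0, pi[ (fun t => kernel alpha beta a lam t * q t).
Proof.
move=> hq lam; apply: Delta_kernel => //; first by rewrite a0 api.
exact: (kernel_cintegral hq).1.
Qed.

Lemma entire_Delta q : cintegrable `]0, pi[ q -> entire (Delta q a alpha beta).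
Proof.
move=> hq.
have hI : entire (fun lam => cintegral `]0, pi[ (fun t => kernel alpha beta a lam t * q t)).
  by eexists; exact: (kernel_cintegral hq).2.
have := entire_lin 1 1 entire_main_part hI.
by congr entire; apply/funext => z; rewrite !mul1r -DeltaE.
Qed.

(** The gauge level of the square of half-side [n + 3/2] or [n + 1], according to whether
    [main_part] involves [sinl] or [cosl]. *)
Definition contour n : R :=
  2 * (if alpha == beta then n.+1%:R + 2^-1 else n.+1%:R) ^+ 2.

(* On the contours the kernel is smaller than the main part by a factor of
   order [1 / |rho|]: this is the only asymptotic information needed. *)
Lemma kernel_contour n lam : gauge lam = contour n ->
  [/\ n.+1%:R <= normc (sqrtC lam), 0 < normc (main_part alpha beta lam) &
   forall t, (`]0, pi[%classic : set R) t ->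
     normc (kernel alpha beta a lam t) <= 4 / n.+1%:R * normc (main_part alpha beta lam)].
Proof.
move=> hg; have [hn hm] : n.+1%:R <= normc (sqrtC lam) /\
   if alpha == beta then growth lam pi / 4 <= normc (sinl lam pi) * normc (sqrtC lam)
   else growth lam pi / 4 <= normc (cosl lam pi).
  move: hg; rewrite /contour; case: (alpha == beta); [exact: sinl_contour|exact: cosl_contour].
have r0 : 0 < normc (sqrtC lam) by apply: lt_le_trans hn.
have l0 : lam != 0 by rewrite -sqrtC_eq0 -normc_gt0.
have G0 := growth_gt0 lam pi.
have nl : normc lam = normc (sqrtC lam) * normc (sqrtC lam) by rewrite -Normc.normcM sqrtC2.
have cs s : 0 <= s -> normc (sinl lam s) <= growth lam s / normc (sqrtC lam).
  by move=> s0; rewrite ler_pdivlMr//; exact: normc_sinl_le.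
set rho := normc (sqrtC lam) in hn hm r0 nl cs *.
(* Each factor is a cosine, or a sine divided by [rho] when its index [alpha] or [beta] is false.
   The two arguments add up to at most [pi]. *)
have ker t : (`]0, pi[%classic : set R) t ->
   normc (kernel alpha beta a lam t) <= growth lam pi *
     (if alpha then 1 else rho^-1) * (if beta then 1 else rho^-1).
  rewrite /= in_itv/= => /andP[t0 tp]; rewrite /kernel normcN.
  have co (b : bool) s : 0 <= s ->
    normc (if b then cosl lam s else sinl lam s) <= growth lam s * (if b then 1 else rho^-1).
    by move=> s0; case: b; [rewrite mulr1; exact: normc_cosl_le|exact: cs].
  have w0 (b : bool) : 0 <= (if b then 1 else rho^-1).
    by case: b => //; rewrite invr_ge0 ltW.
  have SderE b x : Sder b a x lam = if b then cosl lam (x - a) else sinl lam (x - a) by case: b.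
  rewrite !SderE; case: ltP => ta; rewrite Normc.normcM.
    have -> : normc (if alpha then cosl lam (0 - t) else sinl lam (0 - t)) =
        normc (if alpha then cosl lam t else sinl lam t).
      by rewrite sub0r coslN sinlN; case: alpha; rewrite ?normcN.
    apply: (le_trans (ler_pM (normc_ge0 _) (normc_ge0 _) (co beta (pi - a) _) (co alpha t _))).
    - by rewrite subr_ge0.
    - exact: ltW.
    rewrite mulrACA -growthD [X in _ * X]mulrC mulrA ler_wpM2r// ler_wpM2r//.
    by apply: le_growth; lra.
  have -> : normc (if alpha then cosl lam (0 - a) else sinl lam (0 - a)) =
      normc (if alpha then cosl lam a else sinl lam a).
    by rewrite sub0r coslN sinlN; case: alpha; rewrite ?normcN.
  apply: (le_trans (ler_pM (normc_ge0 _) (normc_ge0 _) (co alpha a _) (co beta (pi - t) _))).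
  - exact: ltW.
  - by rewrite subr_ge0 ltW.
  rewrite mulrACA -growthD mulrA ler_wpM2r// ler_wpM2r//.
  by apply: le_growth; lra.
(* In all four cases the main part carries exactly one power of [rho] more than the kernel. *)
have mainG : growth lam pi * (if alpha then 1 else rho^-1) * (if beta then 1 else rho^-1)
    <= 4 / rho * normc (main_part alpha beta lam).
  have ri0 : 0 < rho^-1 by rewrite invr_gt0.
  move: hm; rewrite /main_part; case: (alpha); case: (beta) => hm0; rewrite ?mulr1.
  - have hm : growth lam pi / 4 <= normc (sinl lam pi) * rho := hm0.
    rewrite Normc.normcM nl (_ : 4 / rho * _ = 4 * (normc (sinl lam pi) * rho)); first by lra.
    by field; rewrite gt_eqF.
  - have hm : growth lam pi / 4 <= normc (cosl lam pi) := hm0.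
    rewrite normcN (_ : 4 / rho * _ = 4 * normc (cosl lam pi) * rho^-1); last by ring.
    by rewrite ler_wpM2r ?(ltW ri0)//; lra.
  - have hm : growth lam pi / 4 <= normc (cosl lam pi) := hm0.
    rewrite (_ : 4 / rho * _ = 4 * normc (cosl lam pi) * rho^-1); last by ring.
    by rewrite ler_wpM2r ?(ltW ri0)//; lra.
  - have hm : growth lam pi / 4 <= normc (sinl lam pi) * rho := hm0.
    rewrite (_ : 4 / rho * _ = 4 * (normc (sinl lam pi) * rho) * rho^-1 * rho^-1).
      by rewrite !ler_wpM2r ?(ltW ri0)//; lra.
    by field; rewrite gt_eqF.
split => //.
  have : 0 < 4 / rho * normc (main_part alpha beta lam).
    apply: lt_le_trans mainG.
    by case: (alpha); case: (beta); rewrite ?mulr1 ?mulr_gt0 ?invr_gt0.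
  by rewrite pmulr_rgt0// divr_gt0.
move=> t /ker/le_trans; apply; apply: (le_trans mainG).
by rewrite ler_wpM2r ?normc_ge0// ler_wpM2l// lef_pV2 ?posrE.
Qed.

Lemma same_spectrum_Delta_eq q qt : cintegrable `]0, pi[ q -> cintegrable `]0, pi[ qt ->
  same_spectrum (Delta q a alpha beta) (Delta qt a alpha beta) ->
  forall lam, Delta q a alpha beta lam = Delta qt a alpha beta lam.
Proof.
move=> hq hqt hs.
apply: (@entire_same_spectrum_eq _ (Delta q a alpha beta) (Delta qt a alpha beta)) => //;
  [exact: entire_Delta|exact: entire_Delta|].
move=> e B0 e0; have hd := cintegrableB (measurable_oo _ _) hq hqt.
set L := L1norm `]0, pi[ qt; set L' := L1norm `]0, pi[ (fun t => q t - qt t).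
have L0 : 0 <= L := L1norm_ge0 _ _; have L'0 : 0 <= L' := L1norm_ge0 _ _.
(* The integrals are at most [8 / N.+1 * M] times [L] and [L']; they have to stay below [M / 2] and
   [e * M / 2], hence the constants 16. The term [|B0|] pushes the contour beyond [B0]. *)
pose N := Num.bound (16 * L + 16 * L' / e + `|B0|).
have hN : 16 * L + 16 * L' / e + `|B0| < N.+1%:R.
  apply: (@lt_trans _ _ N%:R); last by rewrite ltr_nat.
  by apply: archi_boundP; rewrite !addr_ge0 ?divr_ge0 ?mulr_ge0// ltW.
have e1 : 0 <= 16 * L' / e by rewrite divr_ge0 ?mulr_ge0// ltW.
have N0 : 0 < N.+1%:R :> R by [].
have N1 : 1 <= N.+1%:R :> R by rewrite ler1n.
exists (contour N); split.
- by rewrite /contour mulr_gt0// exprn_gt0//; case: ifP => _; lra.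
- have b1 : B0 <= N.+1%:R by have := ler_norm B0; lra.
  apply: (le_trans b1); rewrite /contour expr2; case: ifP => _; nra.
move=> lam /kernel_contour[_ M0 hk].
rewrite !DeltaE// opprD addrACA subrr add0r.
have iq := (kernel_cintegral hq).1 lam; have iqt := (kernel_cintegral hqt).1 lam.
have id := (kernel_cintegral hd).1 lam.
rewrite -cintegralB//.
have -> : cintegral `]0, pi[
     (fun t => kernel alpha beta a lam t * q t - kernel alpha beta a lam t * qt t) =
   cintegral `]0, pi[ (fun t => kernel alpha beta a lam t * (q t - qt t)).
  by apply: eq_cintegral => t _; rewrite mulrBr.
have bd := normc_cintegral_le (measurable_oo _ _) hd id hk.
have bqt := normc_cintegral_le (measurable_oo _ _) hqt iqt hk.
rewrite -/L' -/L in bd bqt.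
set M := normc (main_part alpha beta lam) in M0 bd bqt hk *.
set I := cintegral _ _ in bqt *; set J := cintegral _ _ in bd *.
have x1 : 16 * L / N.+1%:R <= 1 by rewrite ler_pdivrMr// mul1r; have := normr_ge0 B0; lra.
have x2 : 16 * L' / N.+1%:R <= e.
  rewrite ler_pdivrMr// [e * _]mulrC -ler_pdivrMr//; have := normr_ge0 B0; lra.
have lowm : M / 2 <= normc (main_part alpha beta lam + I).
  have := ler_normcB_dist (main_part alpha beta lam) (- I); rewrite opprK normcN -/M.
  have : 2 * (4 / N.+1%:R * M * L) = 16 * L / N.+1%:R * (M / 2) by field; rewrite addrC natr1 gt_eqF.
  have : 16 * L / N.+1%:R * (M / 2) <= 1 * (M / 2) by rewrite ler_wpM2r// divr_ge0// ltW.
  move=> h1 h2; move: bqt; rewrite h2; move: (_ / _ * _) h1 => y h1; lra.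
split; first by rewrite -normc_gt0; apply: lt_le_trans lowm; rewrite divr_gt0.
apply: (le_trans bd).
have -> : 2 * (4 / N.+1%:R * M * L') = 16 * L' / N.+1%:R * (M / 2) by field; rewrite addrC natr1 gt_eqF.
by apply: ler_pM => //; rewrite divr_ge0 ?mulr_ge0 ?(ltW M0).
Qed.

Lemma same_spectrum_kernel_coef q qt : cintegrable `]0, pi[ q -> cintegrable `]0, pi[ qt ->
  same_spectrum (Delta q a alpha beta) (Delta qt a alpha beta) ->
  forall n, cintegral `]0, pi[ (fun t => (kernel_coef alpha beta a n t)%:C * (q t - qt t)) = 0.
Proof.
move=> hq hqt hs; have hd := cintegrableB (measurable_oo _ _) hq hqt.
apply: (power_series_eq0 (kernel_cintegral hd).2) => lam.
have := same_spectrum_Delta_eq hq hqt hs lam; rewrite !DeltaE// => /addrI.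
have iq := (kernel_cintegral hq).1 lam; have iqt := (kernel_cintegral hqt).1 lam.
move/eqP; rewrite -subr_eq0 -cintegralB// => /eqP <-.
by apply: eq_cintegral => t _; rewrite mulrBr.
Qed.

End Kernel.

End CharacteristicFunction.

(** * Reflections and vanishing moments *)

Section Reflection.
Variable R : realType.
Local Notation mu := (@lebesgue_measure R).
Local Notation T := (measurableTypeR R).
Implicit Types (f g : R -> R) (a b c x : R).

Definition reflect b : T -> T := fun x : R => b - x.

Lemma measurable_reflect b : measurable_fun setT (reflect b).
Proof. by apply: measurable_funB; [exact: measurable_cst|exact: measurable_id]. Qed.

HB.instance Definition _ b := isMeasurableFun.Build _ _ T T (reflect b) (measurable_reflect b).

Lemma reflect_preimage_ocitv b x y : reflect b @^-1` `]x, y] = `[b - y, b - x[%classic.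
Proof.
apply/seteqP; split => z; rewrite /reflect /= !in_itv/=; lra.
Qed.

Lemma lebesgue_measure_reflect b (A : set T) : measurable A ->
  mu (reflect b @^-1` A) = mu A.
Proof.
move=> mA; apply/esym; apply: (lebesgue_measure_unique (mu := pushforward mu (reflect b))) => //.
move=> _ [[x y] _ <-].
rewrite [RHS](_ : _ = mu `[b - y, b - x[%classic); last first.
  by congr (mu _); exact: reflect_preimage_ocitv.
rewrite !lebesgue_measure_itv/= !lte_fin.
have -> : (b - y < b - x) = (x < y) by apply/idP/idP; lra.
by case: ifP => // _; rewrite -!EFinB; congr EFin; ring.
Qed.

Lemma ae_imp (P Q : R -> Prop) : (forall x, P x -> Q x) ->
  {ae mu, forall x, P x} -> {ae mu, forall x, Q x}.
Proof. by move=> PQ; apply: (@filterS _ _ (ae_filter_ringOfSetsType mu)). Qed.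

Lemma ae_and (P Q : R -> Prop) : {ae mu, forall x, P x} -> {ae mu, forall x, Q x} ->
  {ae mu, forall x, P x /\ Q x}.
Proof. by apply: (@filterS2 _ _ (ae_filter_ringOfSetsType mu)). Qed.

Lemma ae_reflect b (P : R -> Prop) :
  {ae mu, forall x, P x} -> {ae mu, forall x, P (b - x)}.
Proof.
move=> [A [mA A0 hA]]; exists (reflect b @^-1` A); split => //.
- by rewrite -[X in measurable X]setTI; exact: measurable_reflect.
- by rewrite lebesgue_measure_reflect.
- by move=> x hx; apply: hA.
Qed.

(** A translation is a composition of two reflections; [translate_moment] transports integrals in
    the same way. *)
Lemma ae_translate b (P : R -> Prop) :
  {ae mu, forall x, P x} -> {ae mu, forall x, P (b + x)}.
Proof.
move=> /(ae_reflect b)/(ae_reflect 0); apply: ae_imp => x /=.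
by rewrite sub0r opprK.
Qed.

Definition Rintegrable f := mu.-integrable setT (EFin \o f).

Lemma integrable_reflect b f : Rintegrable f ->
  Rintegrable (fun x => f (b - x)) /\
  \int[mu]_(x in setT) f (b - x) = \int[mu]_(x in setT) f x.
Proof.
move=> hf; have mf : measurable_fun (setT : set T) (EFin \o f) := measurable_int mu hf.
have mE e : (\int[pushforward mu (reflect b)]_(x in setT) e x = \int[mu]_(x in setT) e x)%E.
  by apply: eq_measure_integral => A mA _; exact: lebesgue_measure_reflect.
have hfb : Rintegrable (fun x => f (b - x)).
  apply/integrableP; split.
    by apply: (measurableT_comp (f := EFin \o f)) => //; exact: measurable_reflect.
  have mabs : measurable_fun (setT : set T) (fun x => `|(f x)%:E|%E) by exact: measurableT_comp.
  have := ge0_integral_pushforward (measurable_reflect b) mu measurableT mabs (fun y _ => abse_ge0 _).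
  by rewrite mE => <-; have /integrableP[] := hf.
split => //; rewrite /Rintegral; congr fine.
have := integral_pushforward (measurable_reflect b) (mu := mu) mf hfb measurableT.
by rewrite mE => ->.
Qed.

Lemma RintegrableD f g : Rintegrable f -> Rintegrable g ->
  Rintegrable (fun x => f x + g x) /\
  \int[mu]_(x in setT) (f x + g x) = \int[mu]_(x in setT) f x + \int[mu]_(x in setT) g x.
Proof. by move=> hf hg; split; [exact: integrable_realD|rewrite RintegralD]. Qed.

Lemma RintegrableZ c f : Rintegrable f ->
  Rintegrable (fun x => c * f x) /\
  \int[mu]_(x in setT) (c * f x) = c * \int[mu]_(x in setT) f x.
Proof. by move=> hf; split; [exact: integrable_realZ|rewrite RintegralZl]. Qed.

Lemma Rintegrable_bounded_mul (D : set T) (h f : R -> R) c : measurable D ->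
  measurable_fun (setT : set T) h -> (forall x, D x -> `|h x| <= c) ->
  (forall x, ~ D x -> f x = 0) -> Rintegrable f -> Rintegrable (fun x => h x * f x).
Proof.
move=> mD mh hc f0 hf.
have E : (fun x => h x * f x) = (fun x => (h \_ D) x * f x).
  apply/funext => x; rewrite patchE; case: ifPn => // /negP hx.
  by rewrite f0 ?mulr0// => Dx; apply: hx; exact: mem_set.
rewrite E; apply: (@integrable_bounded_mul _ _ _ _ (Num.max c 0)) => //.
  by apply/(measurable_restrictT _ mD); exact: measurable_funS mh.
move=> x _; rewrite patchE le_max; case: ifPn => [/set_mem/hc ->//|_].
by rewrite normr0 lexx orbT.
Qed.

End Reflection.

Section Moments.
Variable R : realType.
Local Notation mu := (@lebesgue_measure R).
Local Notation T := (measurableTypeR R).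

Lemma bernoulli_le (y : R) m : 0 <= y <= 1 -> 1 - m%:R * y <= (1 - y) ^+ m.
Proof.
move=> /andP[y0 y1]; elim: m => [|m IH]; first by rewrite mul0r subr0 expr0.
rewrite exprSr -natr1; have m0 : 0 <= m%:R :> R by [].
apply: (@le_trans _ _ ((1 - m%:R * y) * (1 - y))); last first.
  by rewrite ler_wpM2r// subr_ge0.
by nra.
Qed.

Lemma bernoulli_inv (y : R) m : 0 <= y <= 1 -> (1 - y) ^+ m * (m%:R * y) <= 1.
Proof.
move=> /andP[y0 y1].
have h : m%:R * y <= (1 + y) ^+ m.
  apply: (@le_trans _ _ (1 + m%:R * y)); first by rewrite lerDr.
  elim: m => [|m IH]; first by rewrite mul0r addr0 expr0.
  rewrite exprSr -natr1; have m0 : 0 <= m%:R :> R by [].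
  apply: (@le_trans _ _ ((1 + m%:R * y) * (1 + y))); last by rewrite ler_wpM2r// addr_ge0.
  by nra.
apply: (@le_trans _ _ ((1 - y) ^+ m * (1 + y) ^+ m)).
  by rewrite ler_wpM2l// exprn_ge0// subr_ge0.
rewrite -exprMn exprn_ile1//; last by nra.
by rewrite mulr_ge0 ?subr_ge0// addr_ge0.
Qed.

(* The threshold functions of the elementary proof of the Stone-Weierstrass
   theorem. *)
Lemma cvg_threshold (s : R) : 0 <= s <= 1 -> s != 2^-1 ->
  (fun n => (1 - s ^+ n) ^+ (2 ^ n)) @ \oo --> (if s < 2^-1 then 1 else 0 : R).
Proof.
move=> /andP[s0 s1] s2.
have sn n : 0 <= s ^+ n <= 1 by rewrite exprn_ge0//= exprn_ile1.
have bd n : 0 <= 1 - s ^+ n <= 1.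
  by have /andP[h1 h2] := sn n; rewrite subr_ge0 h2 gerBl.
have pE n : (2 ^ n)%:R * s ^+ n = (2 * s) ^+ n :> R by rewrite natrX exprMn.
case: ltP => h.
  apply: (@squeeze_cvgr _ _ _ _ (fun n => 1 - (2 * s) ^+ n) (fun=> 1)).
  - near=> n; have /andP[h1 h2] := bd n; rewrite exprn_ile1// andbT.
    by rewrite -pE; exact: bernoulli_le.
  - rewrite -[X in _ --> X]subr0; apply: cvgB; first exact: cvg_cst.
    by apply: cvg_expr; rewrite ger0_norm ?mulr_ge0//; lra.
  - exact: cvg_cst.
have {}h : 2^-1 < s by rewrite lt_neqAle eq_sym s2.
have s20 : 0 < 2 * s by lra.
apply: (@squeeze_cvgr _ _ _ _ (fun=> 0) (fun n => (2 * s)^-1 ^+ n)).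
- near=> n; have /andP[h1 h2] := bd n; rewrite exprn_ge0//=.
  by rewrite exprVn -[leRHS]mul1r ler_pdivlMr ?exprn_gt0// -pE; exact: bernoulli_inv.
- exact: cvg_cst.
- by apply: cvg_expr; rewrite ger0_norm ?invr_ge0 ?ltW// invf_lt1//; lra.
Unshelve. all: by end_near. Qed.

Variables (V : R -> R) (L : R).
Hypotheses (L0 : 0 < L) (iV : Rintegrable V) (V0 : forall x, L < `|x| -> V x = 0).
Hypothesis moments0 : forall n, \int[mu]_(x in setT) (x ^+ n * V x) = 0.

Let measurable_exp n : measurable_fun (setT : set T) (fun x : R => x ^+ n).
Proof. exact: exprn_measurable. Qed.

Let integrable_mono n : Rintegrable (fun x => x ^+ n * V x).
Proof.
apply: (@Rintegrable_bounded_mul _ `[- L, L]%classic _ _ (L ^+ n)) => //.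
- move=> x; rewrite /= in_itv/= -ler_norml => hx.
  by rewrite normrX lerXn2r ?nnegrE ?(ltW L0).
- by move=> x; rewrite /= in_itv/= -ler_norml => /negP; rewrite -ltNge => /V0.
Qed.

Lemma polynomial_moments0 (p : {poly R}) :
  Rintegrable (fun x => p.[x] * V x) /\ \int[mu]_(x in setT) (p.[x] * V x) = 0.
Proof.
suff h : forall N, Rintegrable (fun x => \sum_(i < N) p`_i * (x ^+ i * V x)) /\
   \int[mu]_(x in setT) (\sum_(i < N) p`_i * (x ^+ i * V x)) = 0.
  have E : (fun x => p.[x] * V x) = (fun x => \sum_(i < size p) p`_i * (x ^+ i * V x)).
    by apply/funext => x; rewrite horner_coef mulr_suml; apply: eq_bigr => i _; rewrite mulrA.
  by rewrite E; exact: h.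
elim=> [|N [IH1 IH2]].
  have -> : (fun x : R => \sum_(i < 0) p`_i * (x ^+ i * V x)) = fun=> 0.
    by apply/funext => x; rewrite big_ord0.
  split; first exact: integrable0.
  by rewrite /Rintegral integral0.
have -> : (fun x => \sum_(i < N.+1) p`_i * (x ^+ i * V x)) =
    (fun x => \sum_(i < N) p`_i * (x ^+ i * V x) + p`_N * (x ^+ N * V x)).
  by apply/funext => x; rewrite big_ord_recr.
have [i1 i2] := RintegrableZ p`_N (integrable_mono N).
have [j1 j2] := RintegrableD IH1 i1; split => //.
by rewrite j2 IH2 i2 moments0 mulr0 addr0.
Qed.

(** The polynomials [(1 - s ^+ n) ^+ (2 ^ n)], with [s] affine, stay in [[0, 1]] on the support of
    [V] and converge there, except at [c], to the indicator of [x < c]. Their integrals against [V]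
    vanish, and dominated convergence passes to the limit. *)
Lemma integral_half_line0 (c : R) : `|c| <= 2 * L ->
  \int[mu]_(x in `]-oo, c]) V x = 0.
Proof.
rewrite ler_norml => /andP[c1 c2].
have L0' := L0; have L8 : 0 < 8 * L by lra.
(* On the support [|x - c| <= 3 * L], so this slope keeps [s] within [[0, 1]]; the threshold value
   1/2 is taken exactly at [c]. *)
pose S : {poly R} := (2^-1)%:P + ((8 * L)^-1)%:P * ('X - c%:P).
pose P n : {poly R} := (1 - S ^+ n) ^+ (2 ^ n).
pose s x := 2^-1 + (8 * L)^-1 * (x - c).
have PE n x : (P n).[x] = (1 - s x ^+ n) ^+ (2 ^ n).
  by rewrite /P horner_exp hornerD hornerN horner_exp /S /s !hornerE.
have s01 x : `|x| <= L -> 0 <= s x <= 1.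
  rewrite ler_norml => /andP[x1 x2]; rewrite /s.
  have : - 2^-1 <= (8 * L)^-1 * (x - c) <= 2^-1.
    by rewrite mulrC ler_pdivlMr// ler_pdivrMr//; lra.
  by move=> /andP[h1 h2]; apply/andP; split; lra.
have sc x : (s x < 2^-1) = (x < c).
  rewrite /s -subr_gt0 opprD addrA subrr sub0r -mulrN pmulr_rgt0 ?invr_gt0//.
  by rewrite opprB subr_gt0.
pose F n x := ((P n).[x] * V x)%:E; pose G x := (if x < c then V x else 0)%:E.
have mV : measurable_fun (setT : set T) V by apply/measurable_EFinP; exact: (measurable_int mu iV).
have mG : measurable_fun (setT : set T) (fun x => if x < c then V x else 0).
  apply: measurable_fun_ifT => //.
  by apply: measurable_fun_ltr; [exact: measurable_id|exact: measurable_cst].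
have VP n x : `|(P n).[x] * V x| <= `|V x|.
  have [xL|/V0 ->] := lerP `|x| L; last by rewrite mulr0.
  rewrite normrM ler_piMl// PE; have /andP[h1 h2] := s01 x xL.
  have /andP[h3 h4] : 0 <= 1 - s x ^+ n <= 1.
    by rewrite subr_ge0 exprn_ile1//= gerBl exprn_ge0.
  by rewrite ger0_norm ?exprn_ge0// exprn_ile1.
have [] := @dominated_convergence _ T R mu setT measurableT F G (fun x => `|V x|%:E).
- by move=> n; exact: (measurable_int mu (polynomial_moments0 (P n)).1).
- exact/measurable_EFinP.
- exists [set c]; split => //; first exact: lebesgue_measure_set1.
  move=> x /= hx; apply: contrapT => xc; apply: hx => _.
  apply: cvg_EFin; first exact: nearW.
  rewrite (_ : fine \o _ = fun n => (P n).[x] * V x)//.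
  have [xL|xL] := lerP `|x| L; last first.
    have -> : (fun n => (P n).[x] * V x) = fun=> 0 by apply/funext => n; rewrite V0// mulr0.
    by rewrite /G V0// if_same; exact: cvg_cst.
  have -> : (if x < c then V x else 0) = (if s x < 2^-1 then 1 else 0) * V x.
    by rewrite sc; case: ifP; rewrite ?mul1r ?mul0r.
  apply: cvgMl; under eq_fun do rewrite PE.
  apply: cvg_threshold; first exact: s01.
  apply/eqP => h; apply: xc; apply/eqP; rewrite -subr_eq0.
  move/eqP: h; rewrite /s -subr_eq0 addrAC subrr add0r mulf_eq0 invr_eq0.
  by rewrite (gt_eqF L8).
- exact: (integrable_norm iV).
- by apply: aeW => x n _ /=; rewrite lee_fin VP.
move=> iG _; rewrite (_ : [sequence _]_n = fun=> 0%E); last first.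
  apply/funext => n /=; have [h1 h2] := polynomial_moments0 (P n).
  by rewrite -[LHS]fineK; [congr EFin; exact: h2|exact: integrable_fin_num].
move=> /cvg_lim => /(_ (@ereal_hausdorff R)); rewrite lim_cst// => hG.
have iGo : mu.-integrable `]-oo, c[ (EFin \o V) by apply: integrableS iV.
rewrite -Rintegral_itv_bndo_bndc// Rintegral_mkcond /Rintegral.
rewrite (_ : (fun x => _) = G) -?hG//; apply/funext => x; rewrite /G patchE.
congr EFin; case: ifPn => [/set_mem|/negP h] /=; first by rewrite in_itv/= => ->.
by case: ifPn => // xc; case: h; apply/mem_set; rewrite /= in_itv.
Qed.

(** By Lebesgue differentiation [V] is almost everywhere the derivative of its primitive. That one
    vanishes on [[- 2 * L, 2 * L]], a neighbourhood of every point of [[- L, L]], endpoints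
    included. *)
Lemma moments0_ae_eq0 : {ae mu, forall x, V x = 0}.
Proof.
have loc : locally_integrable [set: R] V.
  by apply: open_integrable_locally; [exact: openT|exact: iV].
have iy y : mu.-integrable `]-oo, y] (EFin \o V) by apply: integrableS iV.
have L0' := L0; have := FTC1Ny iy loc; apply: ae_imp => x [_ dF].
have [xL|xL] := lerP `|x| L; last exact: V0.
rewrite -dF derive1E /derive; apply/cvg_lim; first exact: norm_hausdorff.
apply: cvg_near_cst.
have x2 : `|x| < 2 * L by apply: (le_lt_trans xL); lra.
have hd : 0 < (2 * L - `|x|) / 2 by rewrite divr_gt0// subr_gt0.
near=> h.
rewrite /= !integral_half_line0 ?subrr ?scaler0 ?(ltW x2)//.
rewrite (le_trans (ler_normD _ _))//.
have : `|h| < (2 * L - `|x|) / 2 by near: h; exact: dnbhs0_lt.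
by rewrite [h *: 1]mulr1; lra.
Unshelve. all: by end_near. Qed.

End Moments.

(** * Reflection relations for the difference of the potentials *)

Section FunctionalRelation.
Variable R : realType.
Local Notation mu := (@lebesgue_measure R).
Local Notation T := (measurableTypeR R).
Local Notation I := (`]0, pi[%classic : set R).

Definition ext (r : R -> R) : R -> R := r \_ I.

Lemma extE r x : ext r x = if 0 < x < pi then r x else 0.
Proof.
rewrite /ext patchE; congr (if _ then _ else _).
by apply/idP/idP => [/set_mem|h]; rewrite ?inE /= in_itv.
Qed.

Lemma ext_out r x : x <= 0 \/ pi <= x -> ext r x = 0.
Proof.
by rewrite extE => -[h|h]; case: ifP => // /andP[h1 h2]; move: h; rewrite leNgt ?h1 ?h2.
Qed.

Lemma Rintegrable_ext r : mu.-integrable I (EFin \o r) -> Rintegrable (ext r).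
Proof.
move=> h; rewrite /Rintegrable /ext -restrict_EFin.
by apply/(integrable_mkcond _ _).1 => //; exact: measurable_oo.
Qed.

Variables (alpha beta : bool) (a : R) (r : R -> R).
Hypotheses (a0 : 0 < a) (api : a <= pi) (ir : mu.-integrable I (EFin \o r)).
Hypothesis coef0 : forall n, \int[mu]_(t in I) (kernel_coef alpha beta a n t * r t) = 0.

(** [sgna] is the relative sign of the two terms of [kernel_coef], and [sgnab] is [(-1) ^+ p] for
    the powers [p] occurring in it. *)
Definition sgna : R := if alpha then 1 else -1.
Definition sgnab : R := (-1) ^+ (alpha != beta).

Local Notation r0 := (ext r).

Let iext := Rintegrable_ext ir.

Let measurable_lin (u v : R) p : measurable_fun (setT : set T) (fun t : R => (u + v * t) ^+ p).
Proof.
apply: measurable_funX; apply: measurable_funD; first exact: measurable_cst.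
by apply: measurable_funM; [exact: measurable_cst|exact: measurable_id].
Qed.

Let Rintegrable_lin f (u v : R) p : Rintegrable f -> (forall t, ~ (0 < t < pi) -> f t = 0) ->
  Rintegrable (fun t => (u + v * t) ^+ p * f t).
Proof.
move=> hf f0; apply: (@Rintegrable_bounded_mul _ I _ _ ((`|u| + `|v| * pi) ^+ p)) => //.
move=> t; rewrite /= in_itv/= => /andP[t0 tp]; rewrite normrX lerXn2r ?nnegrE//.
    by rewrite addr_ge0// mulr_ge0// pi_ge0.
  rewrite (le_trans (ler_normD _ _))// lerD2l normrM ler_wpM2l//.
  by rewrite ger0_norm ltW.
Qed.

(** The two sides of [a], on which [|a - t|] has different affine expressions. *)
Definition r1 t : R := if t < a then r0 t else 0.
Definition r2 t : R := if t < a then 0 else r0 t.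

Let r1_out t : ~ (0 < t < a) -> r1 t = 0.
Proof.
rewrite /r1; case: ifP => // ta h; apply: ext_out; left; rewrite leNgt.
by apply/negP => t0; apply: h; rewrite t0.
Qed.

Let r2_out t : ~ (a <= t < pi) -> r2 t = 0.
Proof.
rewrite /r2; case: ifP => // /negbT; rewrite -leNgt => ta h.
by apply: ext_out; right; rewrite leNgt; apply/negP => t0; apply: h; rewrite ta.
Qed.

Let r0_out t : ~ (0 < t < pi) -> r0 t = 0.
Proof. by rewrite extE; case: ifP. Qed.

Let out_r1 t : ~ (0 < t < pi) -> r1 t = 0.
Proof.
by move=> h; apply: r1_out => /andP[t0 ta]; apply: h; rewrite t0 (lt_le_trans ta).
Qed.

Let out_r2 t : ~ (0 < t < pi) -> r2 t = 0.
Proof.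
by move=> h; apply: r2_out => /andP[ta tp]; apply: h; rewrite tp (lt_le_trans a0).
Qed.

Let i12 : Rintegrable r1 /\ Rintegrable r2.
Proof.
have ml : measurable_fun (setT : set T) (fun t : R => if t < a then 1 else 0 : R).
  apply: measurable_fun_ifT => //.
  by apply: measurable_fun_ltr; [exact: measurable_id|exact: measurable_cst].
have mg : measurable_fun (setT : set T) (fun t : R => if t < a then 0 else 1 : R).
  apply: measurable_fun_ifT => //.
  by apply: measurable_fun_ltr; [exact: measurable_id|exact: measurable_cst].
have e1 : r1 = (fun t => (if t < a then 1 else 0) * r0 t).
  by apply/funext => t; rewrite /r1; case: ifP; rewrite ?mul1r ?mul0r.
have e2 : r2 = (fun t => (if t < a then 0 else 1) * r0 t).
  by apply/funext => t; rewrite /r2; case: ifP; rewrite ?mul1r ?mul0r.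
by split; [rewrite e1|rewrite e2]; apply: (@integrable_bounded_mul _ _ _ _ 1) => //;
   move=> t _; case: ifP; rewrite ?normr1 ?normr0.
Qed.

Lemma kernel_coef_pow p : odd p = (alpha != beta) ->
  \int[mu]_(t in setT) (((pi - a - t) ^+ p + sgna * (pi - `|a - t|) ^+ p) * r0 t) = 0.
Proof.
move=> op; set X := fun t => (pi - a - t) ^+ p + sgna * (pi - `|a - t|) ^+ p.
have iX : Rintegrable (fun t => X t * r0 t).
  have mX : measurable_fun (setT : set T) X.
    apply: measurable_funD; last apply: measurable_funM; first last.
    - apply: measurable_funX; apply: measurable_funB; first exact: measurable_cst.
      apply: (@measurableT_comp _ _ _ _ _ _ (@Num.Def.normr _ R)); first exact: normr_measurable.
      by apply: measurable_funB; [exact: measurable_cst|exact: measurable_id].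
    - exact: measurable_cst.
    - by apply: measurable_funX; apply: measurable_funB; [exact: measurable_cst|exact: measurable_id].
  apply: (@Rintegrable_bounded_mul _ I _ _ (pi ^+ p + 1 * pi ^+ p)) => //.
  move=> t; rewrite /= in_itv/= => /andP[t0 tp].
  have hA : `|pi - a - t| <= pi.
    by have := a0; have := api; move=> ? ?; rewrite ler_norml; apply/andP; split; lra.
  have hB : `|pi - `|a - t| | <= pi.
    have := a0; have := api; move=> ? ?.
    by have [h|h] := lerP 0 (a - t); [rewrite (ger0_norm h)|rewrite (ltr0_norm h)];
      rewrite ler_norml; apply/andP; split; lra.
  have ns : `|sgna| = 1 by rewrite /sgna; case: (alpha); rewrite ?normrN1 ?normr1.
  rewrite (le_trans (ler_normD _ _))// lerD//; last rewrite normrM ns ler_wpM2l//.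
    by rewrite normrX lerXn2r ?nnegrE ?pi_ge0.
  by rewrite normrX lerXn2r ?nnegrE ?pi_ge0.
have key n (k : R) : k != 0 -> (forall t, kernel_coef alpha beta a n t = k * X t) ->
    \int[mu]_(t in setT) (X t * r0 t) = 0.
  move=> k0 hk; have := coef0 n; rewrite Rintegral_mkcond.
  have -> : (fun t => kernel_coef alpha beta a n t * r t) \_ I = (fun t => k * (X t * r0 t)).
    apply/funext => t; rewrite /ext !patchE; case: ifP => _; last by rewrite !mulr0.
    by rewrite hk mulrA.
  by rewrite (RintegrableZ k iX).2 => /eqP; rewrite mulf_eq0 (negbTE k0) => /eqP.
have k0 j m : (-1) ^+ j / m`!%:R / 2 != 0 :> R.
  by rewrite !mulf_neq0 ?invr_neq0 ?signr_eq0// pnatr_eq0 -lt0n fact_gt0.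
have pE := odd_double_half p; move: op; rewrite /X /sgna.
move: key; rewrite /kernel_coef /X /sgna; case: (alpha); case: (beta) => key /= op.
- have {}pE : p./2.*2 = p by rewrite -[RHS]pE op.
  apply: (key p./2 (- ((-1) ^+ p./2 / p`!%:R / 2))); first by rewrite oppr_eq0.
  by move=> t; rewrite /cos_mono pE; ring.
- have {}pE : p./2.*2.+1 = p by rewrite -[RHS]pE op.
  apply: (key p./2 (- ((-1) ^+ p./2 / p`!%:R / 2))); first by rewrite oppr_eq0.
  by move=> t; rewrite /sin_mono pE; ring.
- have {}pE : p./2.*2.+1 = p by rewrite -[RHS]pE op.
  apply: (key p./2 (- ((-1) ^+ p./2 / p`!%:R / 2))); first by rewrite oppr_eq0.
  by move=> t; rewrite /sin_mono pE; ring.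
have {}pE : p./2.*2 = p by rewrite -[RHS]pE op.
(* For [alpha = beta = 0] the coefficients start with the second power, but for [p = 0] the
   integrand is zero anyway. *)
case E : p./2 => [|n].
  have p0 : p = 0%N by rewrite -pE E.
  have -> : (fun t => ((pi - a - t) ^+ p + -1 * (pi - `|a - t|) ^+ p) * r0 t) = fun=> 0.
    by apply/funext => t; rewrite p0 !expr0 mulN1r subrr mul0r.
  by rewrite /Rintegral integral0.
apply: (key n ((-1) ^+ p./2 / p`!%:R / 2)) => // t.
by rewrite /cos_mono -E pE; ring.
Qed.

(* The push-forward of [r] under [t |-> pi - a - t] plus [sgna] times that under
   [t |-> pi - |a - t|], split at [t = a]. Since only its moments of one parity are
   known to vanish, it has to be symmetrized. *)
Definition W x : R := r0 (pi - a - x) + sgna * (r1 (x - (pi - a)) + r2 (pi + a - x)).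

Let reflect_moment (b : R) f p : Rintegrable f -> (forall t, ~ (0 < t < pi) -> f t = 0) ->
  Rintegrable (fun x => x ^+ p * f (b - x)) /\
  \int[mu]_(x in setT) (x ^+ p * f (b - x)) = \int[mu]_(x in setT) ((b - x) ^+ p * f x).
Proof.
move=> hf f0; have := integrable_reflect b (Rintegrable_lin b (-1) p hf f0).
have -> : (fun x => (b + -1 * (b - x)) ^+ p * f (b - x)) = (fun x => x ^+ p * f (b - x)).
  by apply/funext => x; rewrite mulN1r subKr.
suff -> : (fun x => (b + -1 * x) ^+ p * f x) = (fun x => (b - x) ^+ p * f x) by [].
by apply/funext => x; rewrite mulN1r.
Qed.

Let translate_moment (b : R) f p : Rintegrable f -> (forall t, ~ (0 < t < pi) -> f t = 0) ->
  Rintegrable (fun x => x ^+ p * f (x - b)) /\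
  \int[mu]_(x in setT) (x ^+ p * f (x - b)) = \int[mu]_(x in setT) ((b + x) ^+ p * f x).
Proof.
move=> hf f0; have [h1 h2] := integrable_reflect 0 (Rintegrable_lin b 1 p hf f0).
have [h3 h4] := integrable_reflect b h1.
move: h3 h4; rewrite h2.
have -> : (fun x => (b + 1 * (0 - (b - x))) ^+ p * f (0 - (b - x))) = (fun x => x ^+ p * f (x - b)).
  by apply/funext => x; congr (_ ^+ p * f _); ring.
suff -> : (fun x => (b + 1 * x) ^+ p * f x) = (fun x => (b + x) ^+ p * f x) by [].
by apply/funext => x; rewrite mul1r.
Qed.

Let W_moment p : Rintegrable (fun x => x ^+ p * W x) /\
  \int[mu]_(x in setT) (x ^+ p * W x) =
  \int[mu]_(t in setT) (((pi - a - t) ^+ p + sgna * (pi - `|a - t|) ^+ p) * r0 t).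
Proof.
have [i1 i2] := i12.
have [h0 e0] := reflect_moment (pi - a) p iext r0_out.
have [h1 e1] := translate_moment (pi - a) p i1 out_r1.
have [h2 e2] := reflect_moment (pi + a) p i2 out_r2.
have j0 := Rintegrable_lin (pi - a) (-1) p iext r0_out.
have j1 := Rintegrable_lin (pi - a) 1 p i1 out_r1.
have j2 := Rintegrable_lin (pi + a) (-1) p i2 out_r2.
have [h12 e12] := RintegrableD h1 h2; have [hs es] := RintegrableZ sgna h12.
have [hW eW] := RintegrableD h0 hs.
have [j12 f12] := RintegrableD j1 j2; have [js fs] := RintegrableZ sgna j12.
have [jW fW] := RintegrableD j0 js.
have E x : x ^+ p * r0 (pi - a - x) + sgna * (x ^+ p * r1 (x - (pi - a)) + x ^+ p * r2 (pi + a - x))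
  = x ^+ p * W x by rewrite /W; ring.
have E' t : (pi - a + -1 * t) ^+ p * r0 t +
     sgna * ((pi - a + 1 * t) ^+ p * r1 t + (pi + a + -1 * t) ^+ p * r2 t)
   = ((pi - a - t) ^+ p + sgna * (pi - `|a - t|) ^+ p) * r0 t.
  rewrite mulN1r mul1r /r1 /r2; case: ltP => ta.
    by rewrite (gtr0_norm (_ : 0 < a - t)) ?subr_gt0// (_ : pi - (a - t) = pi - a + t); ring.
  by rewrite ler0_norm ?subr_le0// (_ : pi - - (a - t) = pi + a - t); ring.
split; first by move: hW; under eq_fun do rewrite E.
transitivity (\int[mu]_(x in setT) (x ^+ p * r0 (pi - a - x) +
   sgna * (x ^+ p * r1 (x - (pi - a)) + x ^+ p * r2 (pi + a - x)))).
  by under [RHS]eq_Rintegral do rewrite E.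
under [RHS]eq_Rintegral do rewrite -E'.
rewrite eW es e12 fW fs f12 e0 e1 e2; congr (_ + sgna * (_ + _)).
- by apply: eq_Rintegral => x _; rewrite mulN1r.
- by apply: eq_Rintegral => x _; rewrite mul1r.
- by apply: eq_Rintegral => x _; rewrite mulN1r.
Qed.

(** The moments of [W (- x)] are those of [W] times [(-1) ^+ n]. For the parity of [kernel_coef_pow]
    both terms vanish; for the other one [sgnab * (-1) ^+ n = -1] and they cancel. *)
Lemma folded_ae_eq0 : {ae mu, forall x, W x + sgnab * W (- x) = 0}.
Proof.
have iW : Rintegrable W.
  by have := (W_moment 0).1; under eq_fun do rewrite mul1r.
have iW' : Rintegrable (fun x => W (- x)).
  by have := (integrable_reflect 0 iW).1; under eq_fun do rewrite sub0r.
have [isW _] := RintegrableZ sgnab iW'; have [iV _] := RintegrableD iW isW.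
have W0 x : pi < `|x| -> W x = 0.
  move=> h; have := a0; have := api => ap a1.
  have hx : pi < x \/ x < - pi.
    have [x0|x0] := lerP 0 x; move: h; first by rewrite (ger0_norm x0); left.
    by rewrite (ltr0_norm x0); right; lra.
  have e0 : r0 (pi - a - x) = 0 by apply: r0_out => /andP[]; case: hx; lra.
  have e1 : r1 (x - (pi - a)) = 0 by apply: r1_out => /andP[]; case: hx; lra.
  have e2 : r2 (pi + a - x) = 0 by apply: r2_out => /andP[]; case: hx; lra.
  by rewrite /W e0 e1 e2 addr0 mulr0 addr0.
apply: (@moments0_ae_eq0 _ _ pi) => //; first exact: pi_gt0.
  by move=> x h; rewrite !W0 ?normrN// mulr0 addr0.
move=> n; have [iN eN] := W_moment n.
have [iR eR] := integrable_reflect 0 iN; have [iR' eR'] := RintegrableZ ((-1) ^+ n) iR.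
move: iR' eR'; rewrite eR.
have -> : (fun x => (-1) ^+ n * ((0 - x) ^+ n * W (0 - x))) = (fun x => x ^+ n * W (- x)).
  by apply/funext => x; rewrite sub0r (exprNn x) !mulrA -expr2 sqrr_sign mul1r.
move=> iR' eR'.
have [iS eS] := RintegrableZ sgnab iR'; have [_ eD] := RintegrableD iN iS.
transitivity (\int[mu]_(x in setT) (x ^+ n * W x + sgnab * (x ^+ n * W (- x)))).
  by apply: eq_Rintegral => x _; ring.
rewrite eD eS eR'; have [on|on] := eqVneq (odd n) (alpha != beta).
  by rewrite eN kernel_coef_pow// !mulr0 addr0.
have -> : (-1) ^+ n = - sgnab :> R.
  rewrite /sgnab -(signr_odd _ n); move: on; case: (odd n); case: (alpha != beta) => //= _;
    by rewrite ?expr0 ?expr1 ?opprK.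
by rewrite mulNr mulrN mulrA -expr2 sqrr_sign mul1r subrr.
Qed.

Lemma functional_relation : {ae mu, forall y, 0 < y < pi ->
  r0 (y - a) + sgna * (r0 (a - y) + r0 (a + y)) + sgnab * r0 (2 * pi - a - y) = 0}.
Proof.
have := ae_reflect pi folded_ae_eq0; apply: ae_imp => y + /andP[y0 yp].
have := a0; have := api => ap a1.
rewrite /W (_ : pi - a - (pi - y) = y - a); last by ring.
rewrite (_ : pi - y - (pi - a) = a - y); last by ring.
rewrite (_ : pi + a - (pi - y) = a + y); last by ring.
rewrite (_ : pi - a - - (pi - y) = 2 * pi - a - y); last by ring.
(* Of the six terms at [x = pi - y], the two in [W (- x)] coming from [r1] and [r2] have arguments
   outside [(0, pi)]. *)
rewrite (r1_out (t := - (pi - y) - _)); last by move=> /andP[]; lra.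
rewrite (r2_out (t := pi + a - - _)); last by move=> /andP[]; lra.
have -> : r1 (a - y) = r0 (a - y) by rewrite /r1 ltrBlDr ltrDl y0.
have -> : r2 (a + y) = r0 (a + y) by rewrite /r2 ltNge lerDl (ltW y0).
by rewrite addr0 mulr0 addr0.
Qed.

End FunctionalRelation.

(** * Linear algebra of the reflection system *)

Section ReflectionAlgebra.
Variable R : realType.
Implicit Types (s e : R) (u v : nat -> R).

Lemma forward_eq0 s u m : s != 0 -> u 0%N = 0 -> u 1%N = 0 ->
  (forall j, (j.+2 < m)%N -> u j + s * u j.+2 = 0) ->
  forall j, (j < m)%N -> u j = 0.
Proof.
move=> s0 u0 u1 Ru j; have [i ->] : exists i, j = i by exists j.
suff : (i < m)%N -> u i = 0 /\ ((i.+1 < m)%N -> u i.+1 = 0) by move=> h /h[].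
elim: i => [//|i IH im]; have [ui uSi] := IH (ltnW im).
split; first exact: uSi.
move=> im2; have := Ru i im2; rewrite ui add0r => /eqP.
by rewrite mulf_eq0 (negbTE s0) => /eqP.
Qed.

(* The relations at the left end tie [v j] to [u j] by a sign; those at the right
   end then give [u m.+1 = u m = 0], and the recurrence for [u] runs backwards. *)
Lemma nondegenerate_eq0 s e u v m : s * s = 1 -> (if odd m then e = s else e = -1) ->
  u 1%N + v 1%N = 0 -> u 0%N + v 2%N = 0 ->
  (forall j, (j.+2 < m.+2)%N -> u j + s * u j.+2 = 0) ->
  (forall j, (j.+3 <= m.+2)%N -> v j.+1 + s * v j.+3 = 0) ->
  u m + e * v m.+2 = 0 -> v m.+1 + e * u m.+1 = 0 ->
  forall j, (j < m.+2)%N -> u j = 0.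
Proof.
move=> s2 he E1 E2 Ru Rv T1 T2.
(* The relations at the left end give [v 1 = - u 1] and [v 2 = - u 0 = s * u 2]; as [u] and [v] obey
   the same two-step recurrence, these signs persist by parity. *)
pose eps j : R := if odd j then -1 else s.
have vE i : (i.+1 <= m.+1)%N -> v i.+1 = eps i.+1 * u i.+1 /\
    ((i.+2 <= m.+1)%N -> v i.+2 = eps i.+2 * u i.+2).
  elim: i => [_|i IH im].
    split=> [|m1]; rewrite /eps/=; first by lra.
    have := Ru 0%N m1 => h.
    have -> : v 2%N = - u 0%N by lra.
    have -> : u 0%N = - (s * u 2%N) by lra.
    by rewrite opprK.
  have [h1 h2] := IH (ltnW im); split; first exact: h2.
  move=> im2; have := Ru i.+1 im2; have := Rv i (leq_trans im2 (leqnSn _)) => hv hu.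
  have uE : u i.+1 = - (s * u i.+3) by lra.
  have vE' : s * v i.+3 = - v i.+1 by lra.
  have -> : v i.+3 = s * (s * v i.+3) by rewrite mulrA s2 mul1r.
  rewrite vE' h1 uE /eps /= !negbK; case: (odd i) => /=.
    by transitivity ((s * s) * (s * u i.+3)); [ring|rewrite s2 mul1r].
  by transitivity (- ((s * s) * u i.+3)); [ring|rewrite s2; ring].
(* The condition on [e] makes the two terms of the last relation equal, so it gives [u m.+1 = 0];
   with the opposite sign, the degenerate case, it would hold trivially. *)
have um1 : u m.+1 = 0.
  have [h _] := vE m (leqnn _); move: T2 h; rewrite /eps /=.
  case: (odd m) he => /= -> h1 h2.
    have : s * (u m.+1 + u m.+1) = 0 by rewrite mulrDr -{1}h2.
    have s0 : s != 0 by apply/eqP => h; move: s2; rewrite h mul0r => /esym/eqP; rewrite oner_eq0.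
    by move/eqP; rewrite mulf_eq0 (negbTE s0) /= => /eqP; lra.
  lra.
have um : u m = 0.
  case: m Ru Rv T1 T2 vE um1 he => [|m] Ru Rv T1 T2 vE um1 he.
    by move: he T1 E2 => /= -> ; lra.
  have [h _] := vE m (leqnSn _); have hv := Rv m (leqnn _); move: he h T1; rewrite /eps /=.
  case: (odd m) => /= -> h h1.
    have : s * (u m.+1 + v m.+3) = 0 by rewrite mulrDr -h hv.
    have s0 : s != 0 by apply/eqP => h'; move: s2; rewrite h' mul0r => /esym/eqP; rewrite oner_eq0.
    move/eqP; rewrite mulf_eq0 (negbTE s0) /= => /eqP; lra.
  lra.
have back i : (i <= m.+1)%N -> u (m.+1 - i)%N = 0 /\ ((i.+1 <= m.+1)%N -> u (m.+1 - i.+1)%N = 0).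
  elim: i => [_|i IH im]; first by rewrite subn0 subn1.
  have [h1 h2] := IH (ltnW im); split; first exact: h2.
  move=> im2.
  have e2 : (m.+1 - i = (m.+1 - i.+2).+2)%N by rewrite -subnSK 1?ltnW// -subnSK.
  have := Ru (m.+1 - i.+2)%N; rewrite -e2 h1 mulr0 addr0; apply.
  by rewrite ltnS leq_subr.
move=> j jm; have := (back (m.+1 - j)%N (leq_subr _ _)).1.
by rewrite subKn.
Qed.

End ReflectionAlgebra.

(** * Splitting [(0, pi)] into pieces of length [a] *)

Section PiecewiseVanishing.
Variable R : realType.
Local Notation mu := (@lebesgue_measure R).
Implicit Types (a x y t : R) (f : R -> R).

Lemma ae_shifts a (P : R -> Prop) : {ae mu, forall y, P y} ->
  {ae mu, forall t, forall j : nat, P (j%:R * a + t) /\ P (j%:R * a - t)}.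
Proof.
move=> hP; apply: ae_foralln => j.
by apply: ae_and; [exact: ae_translate|exact: ae_reflect].
Qed.

Lemma piece_exists a k x : 0 < x < k%:R * a -> (forall j : nat, x != j%:R * a) ->
  exists2 j, (j < k)%N & 0 < x - j%:R * a < a.
Proof.
move=> /andP[x0 xk] xj; elim: k xk => [|k IH]; first by rewrite mul0r ltNge (ltW x0).
rewrite -natr1 mulrDl mul1r => xk; have [h|h] := ltP x (k%:R * a).
  by have [j jk hj] := IH h; exists j => //; exact: ltnW.
exists k => //; rewrite subr_gt0 lt_neqAle eq_sym xj h /=; lra.
Qed.

(** The grid points [j * a] form a null set, and off it every point lies inside a piece. *)
Lemma pieces_ae_eq0 a k f :
  {ae mu, forall t, 0 < t < a -> forall j, (j < k)%N -> f (j%:R * a + t) = 0} ->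
  {ae mu, forall x, 0 < x < k%:R * a -> f x = 0}.
Proof.
move=> h.
have h1 : {ae mu, forall x, forall j : nat, 0 < - (j%:R * a) + x < a ->
    forall i, (i < k)%N -> f (i%:R * a + (- (j%:R * a) + x)) = 0}.
  by apply: ae_foralln => j; exact: ae_translate h.
have h2 : {ae mu, forall x, forall j : nat, x != j%:R * a}.
  apply: ae_foralln => j; exists [set j%:R * a]; split => //.
    exact: lebesgue_measure_set1.
  by move=> x /= /negP; rewrite negbK => /eqP.
apply: ae_imp (ae_and h1 h2) => x [{}h1 {}h2] xk.
have [j jk hj] := piece_exists xk h2.
by have := h1 j; rewrite (addrC (- _)) => /(_ hj j jk); rewrite [_ + (x - _)]addrC subrK.
Qed.

Section Relations.
Variables (rho : R -> R) (a s e t : R).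
Hypothesis rho_out : forall x, x <= 0 \/ pi <= x -> rho x = 0.
Hypotheses (a0 : 0 < a) (ta : 0 < t < a).

Definition relation_at y := 0 < y < pi ->
  rho (y - a) + s * (rho (a - y) + rho (a + y)) + e * rho (2 * pi - a - y) = 0.

Hypothesis rel : forall j : nat, relation_at (j%:R * a + t) /\ relation_at (j%:R * a - t).

Let u j := rho (j%:R * a + t).
Let v j := rho (j%:R * a - t).

(** The case [k = 1]: at [y = a - t] two terms equal [rho t], the others fall outside [(0, pi)], and
    [s = e] keeps the sum from cancelling. *)
Lemma relations_one : pi = a -> s = e -> s != 0 -> u 0%N = 0.
Proof.
move=> pE se s0; have /andP[t0 t1] := ta; have := (rel 1).2; rewrite /relation_at mul1r => h.
have {}h := h ltac:(by apply/andP; split; lra).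
move: h; rewrite (rho_out (x := a - t - a)); last by left; lra.
rewrite (rho_out (x := a + (a - t))); last by right; lra.
have -> : a - (a - t) = t by ring.
have -> : 2 * pi - a - (a - t) = t by rewrite pE; ring.
rewrite add0r addr0 -se -mulrDr => /eqP; rewrite mulf_eq0 (negbTE s0) /= /u mul0r add0r => /eqP h; lra.
Qed.

Let natSa j : j.+1%:R * a = j%:R * a + a.
Proof. by rewrite -natr1 mulrDl mul1r. Qed.

Let nat_le i j : (i <= j)%N -> i%:R * a <= j%:R * a.
Proof. by move=> ij; rewrite ler_wpM2r ?(ltW a0)// ler_nat. Qed.

(** Which terms survive depends on [y]: [a - y] counts only for [y < a] and [y - a] only for
    [y > a]; [a + y] only for [y < pi - a] and [2 * pi - a - y] only for [y > pi - a]. The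
    conclusions run through these ranges, with [k = m.+2]. *)
Lemma relations_many m : pi = m.+2%:R * a -> s != 0 ->
  [/\ u 1%N + v 1%N = 0, u 0%N + v 2%N = 0,
    forall j, (j.+2 < m.+2)%N -> u j + s * u j.+2 = 0,
    forall j, (j.+3 <= m.+2)%N -> v j.+1 + s * v j.+3 = 0 &
    u m + e * v m.+2 = 0 /\ v m.+1 + e * u m.+1 = 0].
Proof.
move=> pE s0; have /andP[t0 t1] := ta; have a1 := a0.
have n0 j : 0 <= j%:R * a by rewrite mulr_ge0 ?(ltW a1).
have m0 := n0 m; have pE' : pi = m%:R * a + a + a by rewrite pE !natSa.
have E x y : x = y -> rho x = rho y by move=> ->.
split.
- have := (rel 0).1; rewrite /relation_at mul0r add0r => h.
  have {}h := h ltac:(by apply/andP; split; lra).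
  move: h; rewrite (rho_out (x := t - a)); last by left; lra.
  rewrite (rho_out (x := 2 * pi - a - t)); last by right; lra.
  rewrite add0r mulr0 addr0 => /eqP; rewrite mulf_eq0 (negbTE s0) /= => /eqP.
  by rewrite /u /v !mul1r addrC.
- have := (rel 1).2; rewrite /relation_at mul1r => h.
  have {}h := h ltac:(by apply/andP; split; lra).
  move: h; rewrite (rho_out (x := a - t - a)); last by left; lra.
  rewrite (rho_out (x := 2 * pi - _ - _)); last by right; lra.
  rewrite add0r mulr0 addr0 => /eqP; rewrite mulf_eq0 (negbTE s0) /= => /eqP.
  have -> : a - (a - t) = 0%:R * a + t by ring.
  by have -> : a + (a - t) = 2%:R * a - t by ring.
- move=> j jm; have := nat_le jm; rewrite !natSa => le3; have j0 := n0 j.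
  have := (rel j.+1).1; rewrite /relation_at natSa => h.
  have {}h := h ltac:(by apply/andP; split; lra).
  move: h; rewrite (rho_out (x := a - _)); last by left; lra.
  rewrite (rho_out (x := 2 * pi - _ - _)); last by right; lra.
  rewrite add0r mulr0 addr0 => <-; rewrite /u !natSa; congr (_ + s * _); apply: E; ring.
- move=> j jm; have := nat_le jm; rewrite !natSa => le3; have j0 := n0 j.
  have := (rel j.+2).2; rewrite /relation_at !natSa => h.
  have {}h := h ltac:(by apply/andP; split; lra).
  move: h; rewrite (rho_out (x := a - _)); last by left; lra.
  rewrite (rho_out (x := 2 * pi - _ - _)); last by right; lra.
  rewrite add0r mulr0 addr0 => <-; rewrite /v !natSa; congr (_ + s * _); apply: E; ring.
split.
- have := (rel m.+1).1; rewrite /relation_at natSa => h.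
  have {}h := h ltac:(by apply/andP; split; lra).
  move: h; rewrite (rho_out (x := a - _)); last by left; lra.
  rewrite (rho_out (x := a + _)); last by right; lra.
  rewrite addr0 mulr0 addr0 => <-; rewrite /u /v !natSa.
  by congr (_ + e * _); apply: E; rewrite ?pE'; ring.
- have := (rel m.+2).2; rewrite /relation_at !natSa => h.
  have {}h := h ltac:(by apply/andP; split; lra).
  move: h; rewrite (rho_out (x := a - _)); last by left; lra.
  rewrite (rho_out (x := a + _)); last by right; lra.
  rewrite addr0 mulr0 addr0 => <-; rewrite /u /v !natSa.
  by congr (_ + e * _); apply: E; rewrite ?pE'; ring.
Qed.

End Relations.

End PiecewiseVanishing.

(** * Uniqueness of the potential *)

Section Uniqueness.
Variable R : realType.
Local Notation mu := (@lebesgue_measure R).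
Local Notation I := (`]0, pi[%classic : set R).
Variables (k : nat) (alpha beta : bool) (a : R).
Hypotheses (k0 : (0 < k)%N) (pE : pi = k%:R * a).

Let a0 : 0 < a.
Proof. by have := pi_gt0 R; rewrite pE pmulr_rgt0// ltr0n. Qed.

Let api : a <= pi.
Proof. by rewrite pE ler_peMl ?(ltW a0)// ler1n. Qed.

Section Real.
Variable r : R -> R.
Hypotheses (ir : mu.-integrable I (EFin \o r))
  (coef0 : forall n, \int[mu]_(t in I) (kernel_coef alpha beta a n t * r t) = 0).
Local Notation r0 := (ext r).

Let s2 : sgna R alpha * sgna R alpha = 1.
Proof. by rewrite /sgna; case: (alpha); rewrite ?mulrNN mulr1. Qed.

Let s0 : sgna R alpha != 0.
Proof. by rewrite /sgna; case: (alpha); rewrite ?oppr_eq0 oner_eq0. Qed.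

Let relations : {ae mu, forall t, forall j : nat,
  relation_at r0 a (sgna R alpha) (sgnab R alpha beta) (j%:R * a + t) /\
  relation_at r0 a (sgna R alpha) (sgnab R alpha beta) (j%:R * a - t)}.
Proof. exact/ae_shifts/functional_relation. Qed.

Let in_pieces : {ae mu, forall t, 0 < t < a -> forall j, (j < k)%N -> r0 (j%:R * a + t) = 0} ->
  {ae mu, forall x, I x -> r x = 0}.
Proof.
move/pieces_ae_eq0; apply: ae_imp => x; rewrite -pE /= in_itv/= => h xI.
by have := h xI; rewrite extE xI.
Qed.

(** Nondegeneracy is precisely the sign condition of the linear system: with [s = sgna] and
    [e = sgnab] it says [e = s] for odd [k] and [e = -1] for even [k]. *)
Lemma nondegenerate_ae_eq0 : nondegenerate_case k alpha beta ->
  {ae mu, forall x, I x -> r x = 0}.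
Proof.
move=> nd; apply: in_pieces; apply: ae_imp relations => t rel ta.
have rout := @ext_out R r.
case: k k0 pE nd => [//|[|m]] _ pE' nd.
  move=> [|//] _. apply: (relations_one rout ta rel) => //; first by rewrite pE' mul1r.
  by move: nd; rewrite /sgna /sgnab; case: (alpha); case: (beta); rewrite //= expr1.
have [E1 E2 Ru Rv [T1 T2]] := relations_many rout a0 ta rel pE' s0.
move=> j jk; apply: (nondegenerate_eq0 (v := fun j => r0 (j%:R * a - t)) s2 _ E1 E2 Ru Rv T1 T2 jk).
move: nd; rewrite /nondegenerate_case /= negbK /sgna /sgnab.
by case: (odd m); case: (alpha); case: (beta) => //=; rewrite ?expr1 ?expr0.
Qed.

Lemma fold_at_a : (1 < k)%N -> {ae mu, forall t, 0 < t < a -> r (a - t) + r (a + t) = 0}.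
Proof.
case: k pE => [//|[//|m]] pE' _; apply: ae_imp relations => t rel ta.
have [E1 _ _ _ _] := relations_many (@ext_out R r) a0 ta rel pE' s0.
move: E1; rewrite !mul1r !extE; have /andP[t0 t1] := ta.
have hp : a + a <= pi.
  have : 2%:R * a <= m.+2%:R * a by rewrite ler_wpM2r ?(ltW a0)// ler_nat.
  by rewrite -pE'; lra.
have -> : 0 < a + t < pi by apply/andP; split; lra.
have -> : 0 < a - t < pi by apply/andP; split; lra.
by rewrite addrC.
Qed.

Lemma degenerate_ae_eq0 : (1 < k)%N ->
  {ae mu, forall t, 0 < t < a -> r (a + t) = 0} -> {ae mu, forall x, I x -> r x = 0}.
Proof.
move=> k1 h1; apply: in_pieces.
(* Replacing [t] by [a - t] gives [r0 (2 * a - t) = 0], and the relation at [y = a - t] turns this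
   into [r0 t = 0], the second initial value of the recurrence. *)
have h2 := ae_reflect a h1.
apply: ae_imp (ae_and (ae_and h1 h2) relations) => t [[{}h1 {}h2] rel] ta.
case: k k1 pE => [//|[//|m]] _ pE'.
have [E1 E2 Ru _ _] := relations_many (@ext_out R r) a0 ta rel pE' s0.
have /andP[t0 t1] := ta.
have ext0 x : r x = 0 -> r0 x = 0 by rewrite extE => ->; rewrite if_same.
apply: (forward_eq0 s0 _ _ Ru).
  suff e2 : r0 (2%:R * a - t) = 0 by move: E2; rewrite e2 addr0.
  rewrite (_ : 2%:R * a - t = a + (a - t)); last by ring.
  by apply/ext0/h2; apply/andP; split; lra.
by rewrite mul1r; apply/ext0/h1.
Qed.

End Real.

Lemma L2c_translate (q : R -> R[i]) : (1 < k)%N -> L2c I q -> L2c `]0, a[ (fun t => q (a + t)).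
Proof.
move=> k1 [mR mI i2].
have hp : a + a <= pi.
  have : 2%:R * a <= k%:R * a by rewrite ler_wpM2r ?(ltW a0)// ler_nat.
  by rewrite -pE; lra.
have a1 := a0.
have sub : [set a + t | t in (`]0, a[%classic : set R)] `<=` I.
  by move=> _ [t + <-]; rewrite /= !in_itv/= => /andP[t0 t1]; apply/andP; split; lra.
have mt : measurable_fun (`]0, a[%classic : set R) (fun t : R => a + t).
  by apply: measurable_funD; [exact: measurable_cst|exact: measurable_id].
split.
- by apply: (measurable_comp _ sub mR mt); exact: measurable_itv.
- by apply: (measurable_comp _ sub mI mt); exact: measurable_itv.
pose g x := complex.Re (q x) ^+ 2 + complex.Im (q x) ^+ 2.
have ig : Rintegrable (ext g) by apply: Rintegrable_ext.
have [ig1 _] := integrable_reflect 0 ig; have [ig2 _] := integrable_reflect (- a) ig1.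
have ig3 : mu.-integrable `]0, a[ (EFin \o (fun x => ext g (0 - (- a - x)))).
  by apply: integrableS ig2 => //; exact: measurable_oo.
apply: eq_integrable ig3; first exact: measurable_oo.
move=> x; rewrite inE /= in_itv/= => /andP[x0 xa].
rewrite (_ : 0 - (- a - x) = a + x); last by ring.
by rewrite extE (_ : 0 < a + x < pi)//; apply/andP; split; lra.
Qed.

Lemma kernel_coef_ReIm (f : R -> R[i]) : cintegrable I f ->
  (forall n, cintegral I (fun t => (kernel_coef alpha beta a n t)%:C * f t) = 0) ->
  (forall n, \int[mu]_(t in I) (kernel_coef alpha beta a n t * complex.Re (f t)) = 0) /\
  (forall n, \int[mu]_(t in I) (kernel_coef alpha beta a n t * complex.Im (f t)) = 0).
Proof.
move=> hf h; split=> n; have := h n; rewrite /cintegral => -[hR hI].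
  by rewrite -[RHS]hR; apply: eq_Rintegral => t _; rewrite Re_realM.
by rewrite -[RHS]hI; apply: eq_Rintegral => t _; rewrite Im_realM.
Qed.

End Uniqueness.

Theorem theorem4p1 (R : realType) (k : nat) (alpha beta : bool)
  (q qt : R -> R[i]) :
  (0 < k)%N ->
  L2c `]0, pi[ q -> L2c `]0, pi[ qt ->
  let a : R := pi / (k%:R : R) in
  (nondegenerate_case k alpha beta ->
     same_spectrum (Delta q a alpha beta) (Delta qt a alpha beta) ->
     ae_eqc `]0, pi[ q qt)
  /\
  (degenerate_case k alpha beta -> (1 < k)%N ->
   forall K : (R -> R[i]) -> (R -> R[i]),
     (* K is an operator on L_2(0,a) (acting on a.e.-classes) *)
     (forall f, L2c `]0, a[ f -> L2c `]0, a[ (K f)) ->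
     (forall f g, L2c `]0, a[ f -> L2c `]0, a[ g ->
        ae_eqc `]0, a[ f g -> ae_eqc `]0, a[ (K f) (K g)) ->
     (* I + K is invertible on L_2(0,a) *)
     (forall f g, L2c `]0, a[ f -> L2c `]0, a[ g ->
        ae_eqc `]0, a[ (fun t => f t + K f t) (fun t => g t + K g t) ->
        ae_eqc `]0, a[ f g) ->
     (forall h, L2c `]0, a[ h -> exists2 f, L2c `]0, a[ f &
        ae_eqc `]0, a[ (fun t => f t + K f t) h) ->
     (* q(a - t) = K(q(a + .))(t),  qt(a - t) = K(qt(a + .))(t) on (0,a) *)
     ae_eqc `]0, a[ (fun t => q (a - t)) (K (fun t => q (a + t))) ->
     ae_eqc `]0, a[ (fun t => qt (a - t)) (K (fun t => qt (a + t))) ->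
     same_spectrum (Delta q a alpha beta) (Delta qt a alpha beta) ->
     ae_eqc `]0, pi[ q qt).
Proof.
move=> k0 Lq Lqt a.
have kn0 : k%:R != 0 :> R by rewrite pnatr_eq0 -lt0n.
have pE : pi = k%:R * a by rewrite /a mulrC divfK.
have a0 : 0 < a by rewrite divr_gt0 ?pi_gt0// ltr0n.
have api : a <= pi by rewrite pE ler_peMl ?(ltW a0)// ler1n.
have fin : (lebesgue_measure (`]0%R, pi[%classic : set R) < +oo)%E.
  by rewrite lebesgue_measure_itv/= lte_fin pi_gt0 -EFinB ltry.
have iq := L2c_cintegrable (measurable_oo _ _) fin Lq.
have iqt := L2c_cintegrable (measurable_oo _ _) fin Lqt.
have [iR iI] := cintegrableB (measurable_oo _ _) iq iqt.
have coef0 := same_spectrum_kernel_coef a0 api iq iqt.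
(* The kernel coefficients are real, so the real and imaginary parts of [q - qt] are treated
   separately. *)
have combine :
    {ae lebesgue_measure, forall x, (`]0, pi[%classic : set R) x -> complex.Re (q x - qt x) = 0} ->
    {ae lebesgue_measure, forall x, (`]0, pi[%classic : set R) x -> complex.Im (q x - qt x) = 0} ->
    ae_eqc `]0, pi[ q qt.
  move=> hR hI; apply: ae_imp (ae_and hR hI) => x [{}hR {}hI] Ix.
  by apply/eqP; rewrite -subr_eq0; apply/eqP; apply: complex_eq; [rewrite hR|rewrite hI].
split=> [nd hs|_ k1 K _ _ inj _ hq hqt hs].
  have [cR cI] := kernel_coef_ReIm (conj iR iI) (coef0 _ _ hs).
  by apply: combine; [exact: (nondegenerate_ae_eq0 k0 pE iR cR nd)|
    exact: (nondegenerate_ae_eq0 k0 pE iI cI nd)].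
have [cR cI] := kernel_coef_ReIm (conj iR iI) (coef0 _ _ hs).
have fR := fold_at_a k0 pE iR cR k1; have fI := fold_at_a k0 pE iI cI k1.
(* By the folding relation [q (a - t) + q (a + t)] does not change when [q] is replaced by [qt]; by
   hypothesis it is the image of the translate [q (a + t)] under [I + K]. *)
have right_eq : ae_eqc `]0, a[ (fun t => q (a + t)) (fun t => qt (a + t)).
  apply: inj; [exact: (L2c_translate k0 pE k1 Lq)|exact: (L2c_translate k0 pE k1 Lqt)|].
  apply: ae_imp (ae_and (ae_and fR fI) (ae_and hq hqt)) => t [[{}fR {}fI] [{}hq {}hqt]] It.
  rewrite -(hq It) -(hqt It); move: It; rewrite /= in_itv/= => It.
  have {}fR := fR It; have {}fI := fI It.
  apply/eqP; rewrite -subr_eq0; apply/eqP; apply: complex_eq.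
    by move: fR; rewrite !(creD, creN) /= => <-; ring.
  by move: fI; rewrite !(cimD, cimN) /= => <-; ring.
apply: combine.
  apply: (degenerate_ae_eq0 k0 pE iR cR k1); apply: ae_imp right_eq => t h It.
  by rewrite h ?subrr//= in_itv.
apply: (degenerate_ae_eq0 k0 pE iI cI k1); apply: ae_imp right_eq => t h It.
by rewrite h ?subrr//= in_itv.
Qed.
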